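(* Let $s\in(0,1)$, $N>2s$, let $\Omega\subset\mathbb{R}^N$ be a bounded domain with Lipschitz boundary, let $k\ge2$, and let $(a,b)\in Q_k=(\lambda_{k-1},\lambda_{k+1})^2$. (i) The function $\nu_{k-1}$ is continuous, strictly decreasing, and satisfies: (a) $\nu_{k-1}(\lambda_k)=\lambda_k$; (b) $b=\nu_{k-1}(a)$ implies $(a,b)\in\Sigma^s(\Omega)$; (c) $b<\nu_{k-1}(a)$ implies $(a,b)\notin\Sigma^s(\Omega)$. (ii) The function $\mu_k$ is continuous, strictly decreasing, and satisfies: (a) $\mu_k(\lambda_k)=\lambda_k$; (b) $b=\mu_k(a)$ implies $(a,b)\in\Sigma^s(\Omega)$; (c) $b>\mu_k(a)$ implies $(a,b)\notin\Sigma^s(\Omega)$. (iii) $\nu_{k-1}(a)\le\mu_k(a)$.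
   Context: Let $X^s(\Omega)=\{u\in L^2(\mathbb{R}^N): \|u\|<\infty,\ u=0\text{ a.e. in }\mathbb{R}^N\setminus\Omega\}$, a Hilbert space with inner product $(u,v)=\int_{\mathbb{R}^{2N}}\frac{(u(x)-u(y))(v(x)-v(y))}{|x-y|^{N+2s}}\,dx\,dy$ and norm $\|u\|=(u,u)^{1/2}$. Write $u^\pm=\max\{\pm u,0\}$. $\Sigma^s(\Omega)$ (the Dancer-Fučík spectrum of $(-\Delta)^s$ in $\Omega$) is the set of all $(a,b)\in\mathbb{R}^2$ for which $(-\Delta)^su=bu^+-au^-$ in $\Omega$, $u=0$ in $\mathbb{R}^N\setminus\Omega$, has a nontrivial weak solution, i.e. there is $u\in X^s(\Omega)\setminus\{0\}$ with $(u,v)=\int_\Omega(bu^+-au^-)v\,dx$ for all $v\in X^s(\Omega)$. Let $0<\lambda_1<\lambda_2<\cdots$ be the distinct eigenvalues of $(-\Delta)^s$ in $\Omega$, i.e. the $\lambda$ for which there is $u\in X^s(\Omega)\setminus\{0\}$ with $(u,v)=\lambda\int_\Omega uv\,dx$ for all $v\in X^s(\Omega)$; let $E_k$ be the (finite dimensional) eigenspace of $\lambda_k$, $N_k=\bigoplus_{j=1}^kE_j$, and $M_k=N_k^\perp\cap X^s(\Omega)$ (orthogonality in $X^s(\Omega)$ and in $L^2(\Omega)$ give the same space). Let $I(u,a,b)=\frac12\|u\|^2-\frac12\int_\Omega\left[b(u^+)^2+a(u^-)^2\right]dx$ for $u\in X^s(\Omega)$. For $B\subset X^s(\Omega)$ put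 $\widetilde B=\{u\in B:\|u\|=1\}$. For $(a,b)\in Q_k$ set $$n_{k-1}(a,b)=\inf_{w\in\widetilde M_{k-1}}\ \sup_{v\in N_{k-1}}I(v+w,a,b),\qquad m_k(a,b)=\sup_{v\in\widetilde N_k}\ \inf_{w\in M_k}I(v+w,a,b),$$ and for $a\in(\lambda_{k-1},\lambda_{k+1})$ set $$\nu_{k-1}(a)=\sup\{b\in(\lambda_{k-1},\lambda_{k+1}):n_{k-1}(a,b)\ge0\},\qquad\mu_k(a)=\inf\{b\in(\lambda_{k-1},\lambda_{k+1}):m_k(a,b)\le0\}.$$
   Formalization: Strict decrease of ν_{k-1} and μ_k is claimed when at least one of the two graph points lies in Q_k, and continuity where the set under the sup or inf is nonempty; as worded it fails, since for k=2 ν_1=λ_3 is constant near λ_1 and μ_2's set is empty there. *)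

(* Defs.v *)
From HB Require Import structures.
From mathcomp Require Import all_boot all_order all_algebra.
From mathcomp Require Import all_classical all_reals all_analysis.

Set Implicit Arguments.
Unset Strict Implicit.
Unset Printing Implicit Defensive.
Import Order.TTheory GRing.Theory Num.Theory.
Import numFieldNormedType.Exports.

Local Open Scope classical_set_scope.
Local Open Scope ring_scope.

Definition measure_rV_display : measure_display.
Proof. exact. Qed.

(* The product sigma-algebra of R^n (the one the library puts on
   [n.-tuple R]), that is, the Borel sets. *)
Section measurable_rV.
Context {R : realType} (n : nat).

Let coors : 'I_n -> 'rV[R]_n -> R := fun i x => x ord0 i.

Let rV_set0 : g_sigma_preimage coors set0.
Proof. exact: sigma_algebra0. Qed.

Let rV_setC A : g_sigma_preimage coors A -> g_sigma_preimage coors (~` A).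
Proof. exact: sigma_algebraC. Qed.

Let rV_bigcup (F : _^nat) : (forall i, g_sigma_preimage coors (F i)) ->
  g_sigma_preimage coors (\bigcup_i (F i)).
Proof. exact: sigma_algebra_bigcup. Qed.

HB.instance Definition _ := @isMeasurable.Build measure_rV_display
  'rV[R]_n (g_sigma_preimage coors) rV_set0 rV_setC rV_bigcup.

End measurable_rV.

Lemma measurable_coord (R : realType) (n : nat) (i : 'I_n) :
  measurable_fun [set: 'rV[R]_n] (fun x : 'rV[R]_n => x ord0 i : R).
Proof.
move=> _ Y mY; rewrite setTI; apply: sub_sigma_algebra => /=.
rewrite -bigcup_seq/=; exists i => /=; first by rewrite mem_index_enum.
by exists Y => //; rewrite setTI.
Qed.

Lemma measurable_fun_rV d (T : measurableType d) (R : realType) (n : nat)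
    (f : T -> 'rV[R]_n) :
  (forall i, measurable_fun [set: T] (fun t => f t ord0 i : R)) ->
  measurable_fun [set: T] f.
Proof.
move=> mf; apply: (@measurability _ _ _ _ _ _
  (\big[setU/set0]_(i < n) preimage_set_system setT
    (fun x : 'rV[R]_n => x ord0 i : R) measurable)) => // A [B + <-].
rewrite -bigcup_seq => -[i _ [C mC <-]].
by have := mf i measurableT C mC; rewrite !setTI.
Qed.

Definition rV_cons (R : realType) (n : nat) (z : measurableTypeR R * 'rV[R]_n)
    : 'rV[R]_n.+1 :=
  row_mx (const_mx z.1 : 'rV[R]_1) z.2.

Section rV_cons_theory.
Context {R : realType} (n : nat).

Definition rV_uncons (x : 'rV[R]_n.+1) : measurableTypeR R * 'rV[R]_n :=
  (x ord0 ord0, rsubmx (x : 'rV[R]_(1 + n))).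

Lemma rV_consK : cancel (@rV_cons R n) rV_uncons.
Proof.
move=> [a y]; rewrite /rV_uncons /rV_cons /=; congr pair.
  transitivity (row_mx (const_mx a : 'rV[R]_1) y ord0 (lshift n ord0)).
    by congr (row_mx _ _ _ _); exact/val_inj.
  by rewrite row_mxEl mxE.
by rewrite row_mxKr.
Qed.

Lemma rV_unconsK : cancel rV_uncons (@rV_cons R n).
Proof.
move=> x; rewrite /rV_uncons /rV_cons /= -[RHS](@hsubmxK _ 1 1 n).
have -> // : const_mx (x ord0 ord0) = @lsubmx _ 1 1 n x.
apply/rowP => i; rewrite !mxE (ord1 i).
by congr (fun_of_matrix x _ _); exact/val_inj.
Qed.

Lemma measurable_rV_cons : measurable_fun [set: _] (@rV_cons R n).
Proof.
apply: measurable_fun_rV => i; rewrite /rV_cons.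
case: (@split_ordP 1 n i) => j ->.
  rewrite (_ : (fun _ => _) = fst) ?(ord1 j); first exact: measurable_fst.
  by apply/funext => -[a y]; exact: (etrans (row_mxEl _ _ _ _) (mxE _ _ _ _)).
rewrite (_ : (fun _ => _) = (fun x : 'rV[R]_n => x ord0 j) \o snd).
  by apply: measurableT_comp; [exact: measurable_coord|exact: measurable_snd].
by apply/funext => -[a y]; exact: row_mxEr.
Qed.

Lemma measurable_rV_uncons : measurable_fun [set: _] rV_uncons.
Proof.
apply/measurable_fun_pairP; split => /=.
  exact: measurable_coord.
apply: measurable_fun_rV => i.
rewrite (_ : (fun _ => _) = (fun x : 'rV[R]_n.+1 => x ord0 (rshift 1 i))).
  exact: measurable_coord.
by apply/funext => x /=; rewrite mxE.
Qed.

End rV_cons_theory.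

Section cons_measure.
Context {R : realType} (n : nat).
Variable mu : {sigma_finite_measure set 'rV[R]_n -> \bar R}.

Definition cons_measure : set 'rV[R]_n.+1 -> \bar R :=
  pushforward (@lebesgue_measure R \x mu)%E (@rV_cons R n).

Let pushforward_cons : {measure set 'rV[R]_n.+1 -> \bar R} :=
  measure_function_pushforward__canonical__measure_function_Measure
    (@lebesgue_measure R \x mu)%E (@measurable_rV_cons R n).

HB.instance Definition _ := isMeasure.Build _ _ _ cons_measure
  (measure0 pushforward_cons) (measure_ge0 pushforward_cons)
  (@measure_semi_sigma_additive _ _ _ pushforward_cons).

Let cons_measure_sigma_finite : sigma_finite setT cons_measure.
Proof.
have /sigma_finiteP[F [TF ndF Foo]] := sigma_finiteT (@lebesgue_measure R).
have /sigma_finiteP[G [TG ndG Goo]] := sigma_finiteT mu.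
exists (fun i => @rV_uncons R n @^-1` (F i `*` G i)).
  rewrite -preimage_bigcup; apply/esym/seteqP; split => // x _.
  have [i _ Fia] : (\bigcup_i F i) (rV_uncons x).1 by rewrite -TF.
  have [j _ Gjy] : (\bigcup_i G i) (rV_uncons x).2 by rewrite -TG.
  exists (maxn i j) => //; split => /=.
  - by move: Fia; exact/subsetPset/ndF/leq_maxl.
  - by move: Gjy; exact/subsetPset/ndG/leq_maxr.
move=> i; have [mFi Fi] := Foo i; have [mGi Gi] := Goo i; split.
  rewrite -[X in measurable X]setTI.
  by apply: measurable_rV_uncons => //; exact: measurableX.
rewrite /cons_measure /pushforward -comp_preimage.
rewrite (_ : _ \o _ = id) ?preimage_id; last exact/funext/rV_consK.
by rewrite product_measure1E// lte_mul_pinfty// ge0_fin_numE.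
Qed.

HB.instance Definition _ := Measure_isSigmaFinite.Build _ _ _ cons_measure
  cons_measure_sigma_finite.

End cons_measure.

(* The N-fold product of the Lebesgue measure of R; on the one-point space
   'rV_0 it is the unit mass. *)
Fixpoint lebesgue_rV (R : realType) (N : nat) :
    {sigma_finite_measure set 'rV[R]_N -> \bar R} :=
  match N with
  | 0 => [the {sigma_finite_measure set _ -> \bar R} of dirac (0 : 'rV[R]_0)]
  | n.+1 => [the {sigma_finite_measure set _ -> \bar R} of
              cons_measure (lebesgue_rV R n)]
  end.

Definition dotp (R : realType) (N : nat) (x y : 'rV[R]_N) : R :=
  \sum_(i < N) x ord0 i * y ord0 i.

(* The norm [`|x|] of the library on matrices is the sup norm; the kernel
   |x - y|^-(N + 2s) involves the Euclidean one. *)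
Definition enorm (R : realType) (N : nat) (x : 'rV[R]_N) : R :=
  Num.sqrt (dotp x x).

(* Near each boundary point, Omega is the part of the space lying strictly
   above the graph of a Lipschitz function, in an orthonormal frame with last
   vector [nu]. The hyperplane orthogonal to [nu] plays the role of R^(N-1):
   [g] is only evaluated there (a Lipschitz function on the hyperplane extends
   to R^N by composition with the orthogonal projection). *)
Definition lipschitz_boundary (R : realType) (N : nat) (Omega : set 'rV[R]_N) :=
  forall x0, (closure Omega `\` interior Omega) x0 ->
  exists (r : R) (nu : 'rV[R]_N) (g : 'rV[R]_N -> R),
    [/\ 0 < r, dotp nu nu = 1,
        exists L : R, forall x y, `|g x - g y| <= L * enorm (x - y) &
        forall x, enorm (x - x0) < r ->
          (Omega x <-> g (x - dotp x nu *: nu) < dotp x nu)].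

Definition bounded_lipschitz_domain (R : realType) (N : nat)
    (Omega : set 'rV[R]_N) :=
  [/\ open Omega, connected Omega, Omega !=set0, bounded_set Omega &
      lipschitz_boundary Omega].

Section fractional.
Context {R : realType} (s : R) {N : nat} (Omega : set 'rV[R]_N).

Local Notation leb := (lebesgue_rV R N).
Local Notation fct := ('rV[R]_N -> R).

(* On the diagonal the numerator is 0, and so is the quotient. *)
Definition gagliardo (u v : fct) (z : 'rV[R]_N * 'rV[R]_N) : R :=
  (u z.1 - u z.2) * (v z.1 - v z.2) / enorm (z.1 - z.2) `^ (N%:R + 2 * s).

Definition inner (u v : fct) : R :=
  \int[(leb \x leb)%E]_z gagliardo u v z.

Definition norm_X (u : fct) : R := Num.sqrt (inner u u).

(* Elements of X^s(Omega) are represented by functions; the space is stable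
   under modification on a null set, and nothing below depends on the
   representative. *)
Definition Xs : set fct := [set u |
  [/\ u \in Lfun leb 2%:E,
      (\int[leb \x leb]_z (gagliardo u u z)%:E < +oo)%E &
      \forall x \ae leb, ~ Omega x -> u x = 0]].

Definition Xs_nonzero : set fct :=
  [set u | Xs u /\ ~ (\forall x \ae leb, u x = 0)].

Definition Fucik : set (R * R) := [set ab | exists2 u, Xs_nonzero u &
  forall v, Xs v -> inner u v =
    \int[leb]_(x in Omega) ((ab.2 * u^\+ x - ab.1 * u^\- x) * v x)].

Definition eigenspace (lambda : R) : set fct := [set u | Xs u /\
  forall v, Xs v -> inner u v = lambda * \int[leb]_(x in Omega) (u x * v x)].

Definition is_eigenvalue (lambda : R) : Prop :=
  exists2 u, Xs_nonzero u & eigenspace lambda u.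

(* [lam j], j >= 1, is the j-th distinct eigenvalue; [lam 0] is not used. *)
Definition distinct_eigenvalues (lam : nat -> R) : Prop :=
  [/\ 0 < lam 1%N,
      forall i j, (0 < i < j)%N -> lam i < lam j &
      forall lambda, is_eigenvalue lambda <->
        exists2 j, (0 < j)%N & lambda = lam j].

Variable lam : nat -> R.

Definition Nsp (k : nat) : set fct := [set u |
  exists2 e : nat -> fct,
    forall j, (1 <= j <= k)%N -> eigenspace (lam j) (e j) &
    forall x, u x = \sum_(1 <= j < k.+1) e j x].

Definition Msp (k : nat) : set fct :=
  [set w | Xs w /\ forall v, Nsp k v -> inner w v = 0].

Definition unit_part (B : set fct) : set fct := [set u | B u /\ norm_X u = 1].

Definition energy (u : fct) (a b : R) : R :=
  2^-1 * norm_X u ^+ 2 -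
  2^-1 * \int[leb]_(x in Omega) (b * u^\+ x ^+ 2 + a * u^\- x ^+ 2).

Definition n_func (l : nat) (a b : R) : \bar R :=
  ereal_inf [set ereal_sup [set (energy (v \+ w) a b)%:E | v in Nsp l]
            | w in unit_part (Msp l)].

Definition m_func (k : nat) (a b : R) : \bar R :=
  ereal_sup [set ereal_inf [set (energy (v \+ w) a b)%:E | w in Msp k]
            | v in unit_part (Nsp k)].

(* The interval (lambda_(k-1), lambda_(k+1)), so that Q_k is its square. *)
Definition Jint (k : nat) : set R := [set a | lam k.-1 < a < lam k.+1].

(* [nu_curve k] is the function written nu_(k-1), and [mu_curve k] is mu_k.
   They take extended real values, with sup of the empty set equal to -oo and
   inf of the empty set equal to +oo. *)
Definition nu_curve (k : nat) (a : R) : \bar R :=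
  ereal_sup [set b%:E | b in Jint k `&` [set b | (0 <= n_func k.-1 a b)%E]].

Definition mu_curve (k : nat) (a : R) : \bar R :=
  ereal_inf [set b%:E | b in Jint k `&` [set b | (m_func k a b <= 0)%E]].

(* The graph of the curve [f] at [a] lies in the open square Q_k. *)
Definition in_square (k : nat) (f : R -> \bar R) (a : R) : Prop :=
  Jint k a /\ exists2 b, Jint k b & f a = b%:E.

(* Continuity at every point of (lambda_(k-1), lambda_(k+1)) where the curve
   has a finite value, i.e. where the set whose sup (inf) is taken is not
   empty. *)
Definition curve_continuous (k : nat) (f : R -> \bar R) : Prop :=
  forall a, Jint k a -> f a \is a fin_num -> {for a, continuous f}.

(* Strict monotonicity cannot hold where the curve has left Q_k: for k = 2 and
   every Omega there is delta > 0 such that n_1(a, lambda_1 + delta) >= 0 for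
   all a in (lambda_1, lambda_3), and n_1 is symmetric in (a, b), so that nu_1
   is constantly equal to lambda_3 on (lambda_1, lambda_1 + delta). Hence one
   of the two points of the graph is required to lie in Q_k. *)
Definition curve_decreasing (k : nat) (f : R -> \bar R) : Prop :=
  forall a1 a2, Jint k a1 -> Jint k a2 -> a1 < a2 ->
    in_square k f a1 \/ in_square k f a2 -> (f a2 < f a1)%E.

End fractional.

(* Main.v *)
(* Idea. Extrema over infinite dimensional sets are never attained a priori;
   they are replaced by almost critical points, which converge along a
   subsequence since X^s embeds compactly into L^2. Call P the set of the (a, b)
   with n_(k-1)(a, b) >= 0 and S the set where n_(k-1)(a, b) > 0. As (a, b) lies
   in Q_k, I is uniformly concave along N_(k-1), and almost minimizing
   w |-> sup_v I(v + w) gives almost critical points: on P \ S there is a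
   nontrivial solution, while on S there is none. A nontrivial solution changes
   sign, since for k >= 2 an eigenfunction of lambda_k does; hence decreasing a
   or b from a point of P leads into S. With P closed and S open this yields all
   the properties of the curve nu_(k-1) bounding P, and those of mu_k are obtained
   in the same way from -I, with the roles of M_k and N_k. Finally, if
   n_(k-1)(a, b) > 0 and y is an eigenfunction of lambda_k, the minimax over
   N_(k-1) and y + M_k is positive, and by convexity along M_k it is almost
   attained by some z in N_k with inf_(w in M_k) I(z + w) > 0, so that
   m_k(a, b) > 0. *)
Require Import Defs.
From HB Require Import structures.
From mathcomp Require Import all_boot all_order all_algebra.
From mathcomp Require Import all_classical all_reals all_analysis.
From mathcomp Require Import measurable_realfun.
From mathcomp Require Import ring lra.
Set Implicit Arguments.
Unset Strict Implicit.
Unset Printing Implicit Defensive.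
Import Order.TTheory GRing.Theory Num.Theory.
Import numFieldNormedType.Exports.
Local Open Scope classical_set_scope.
Local Open Scope ring_scope.

(** * Square integrable functions *)

(** From the spectral part on, the argument only sees a real vector space with two semi-inner
    products (those of X^s and of L^2) and a map u |-> u^+. They are semidefinite because functions
    equal almost everywhere are not identified, so null vectors are carried along throughout. The
    energy is not twice differentiable, as u^+ is not. What replaces the Hessian is that the second
    order remainders of |u^+|^2 and |u^-|^2 are nonnegative and add up to |d|^2. Hence the energy
    has quadratic upper and lower expansions, and almost critical points come out of comparing
    quadratics, with no reduction map to differentiate. The sign change of eigenfunctions rests on
    nonlocality instead of a maximum principle: disjoint nonnegative functions have a nonpositive
    product in X^s, which is zero only if one of them is null. Both curves are instances of one
    statement with a sign [sg] equal to 1 or -1. The difficulty in closedness and openness is that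
    the inner extremum runs over an unbounded subspace; coercivity along it makes perturbations of
    (a, b) uniformly small. *)

Section square_integrable.
Context d (T : measurableType d) (R : realType).
Variable mu : {measure set T -> \bar R}.
Implicit Types (f g h : T -> R).

Definition sqint f := measurable_fun [set: T] f /\
  mu.-integrable [set: T] (EFin \o (fun x => f x ^+ 2)).

Lemma limn_einf_ge0 (u : (\bar R)^nat) : (forall n, 0 <= u n)%E ->
  (0 <= limn_einf u)%E.
Proof.
move=> u0; rewrite limn_einf_lim; apply: lime_ge; first exact: is_cvg_einfs.
by apply: nearW => n; apply: le_ereal_inf_tmp => _ [m _ <-].
Qed.

Definition l2 f g : R := \int[mu]_x (f x * g x).

Lemma sqintP f : measurable_fun [set: T] f ->
  (\int[mu]_x (f x ^+ 2)%:E < +oo)%E -> sqint f.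
Proof.
move=> mf foo; split=> //; apply/integrableP; split.
  by apply/measurable_EFinP; exact: measurable_funX.
apply: le_lt_trans foo; rewrite le_eqVlt; apply/orP; left; apply/eqP.
by apply: eq_integral => x _ /=; rewrite ger0_norm// sqr_ge0.
Qed.

Lemma sqint_lty f : sqint f -> (\int[mu]_x (f x ^+ 2)%:E < +oo)%E.
Proof. by move=> [_ /integrable_lty]; exact. Qed.

Lemma sqint_mul f g : sqint f -> sqint g ->
  mu.-integrable [set: T] (EFin \o (fun x => f x * g x)).
Proof.
move=> [mf f2] [mg g2].
apply: (@le_integrable _ _ _ _ _ _ _
  ((EFin \o (fun x => f x ^+ 2)) \+ (EFin \o (fun x => g x ^+ 2)))) => //.
- by apply/measurable_EFinP; exact: measurable_funM.
- move=> x _ /=; rewrite lee_fin [leRHS]ger0_norm ?addr_ge0 ?sqr_ge0//.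
  rewrite normrM -(real_normK (num_real (f x))) -(real_normK (num_real (g x))).
  have := sqr_ge0 (`|f x| - `|g x|).
  have := mulr_ge0 (normr_ge0 (f x)) (normr_ge0 (g x)).
  nra.
- exact: integrableD.
Qed.

Lemma sqint_le f g : measurable_fun [set: T] f -> sqint g ->
  (forall x, f x ^+ 2 <= g x ^+ 2) -> sqint f.
Proof.
move=> mf [mg g2] fg; split=> //.
apply: (@le_integrable _ _ _ _ _ _ _ (EFin \o (fun x => g x ^+ 2))) => //.
  by apply/measurable_EFinP; exact: measurable_funX.
by move=> x _ /=; rewrite lee_fin !ger0_norm ?sqr_ge0.
Qed.

Lemma sqintD f g : sqint f -> sqint g -> sqint (f \+ g).
Proof.
move=> sf sg; have ifg := sqint_mul sf sg.
case: sf sg => [mf f2] [mg g2].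
split; first exact: measurable_funD.
rewrite (_ : _ \o _ = (fun x => (f x ^+ 2)%:E + ((g x ^+ 2)%:E +
    2%:E * (f x * g x)%:E))%E); last first.
  by apply/funext => x /=; rewrite -EFinM -!EFinD; congr EFin; ring.
by do 2 apply: integrableD => //; exact: integrableZl.
Qed.

Lemma sqintZ r f : sqint f -> sqint (fun x => r * f x).
Proof.
move=> [mf f2]; split; first exact: measurable_funM.
rewrite (_ : _ \o _ = (fun x => (r ^+ 2)%:E * (f x ^+ 2)%:E)%E).
  exact: integrableZl.
by apply/funext => x /=; rewrite -EFinM exprMn.
Qed.

Lemma sqint0 : sqint (fun=> 0).
Proof.
split=> //; rewrite (_ : _ \o _ = cst 0%E); first exact: integrable0.
by apply/funext => x /=; rewrite expr0n.
Qed.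

Lemma sqintB f g : sqint f -> sqint g -> sqint (f \- g).
Proof.
move=> sf sg; rewrite (_ : _ \- _ = f \+ (fun x => -1 * g x)).
  by apply: sqintD => //; exact: sqintZ.
by apply/funext => x /=; rewrite mulN1r.
Qed.

Lemma l2C f g : l2 f g = l2 g f.
Proof. by apply: eq_Rintegral => x _; rewrite mulrC. Qed.

Lemma l2Dl f g h : sqint f -> sqint g -> sqint h ->
  l2 (fun x => f x + g x) h = l2 f h + l2 g h.
Proof.
move=> sf sg sh; rewrite /l2 -RintegralD//; [|exact: sqint_mul..].
by apply: eq_Rintegral => x _; rewrite mulrDl.
Qed.

Lemma l2Zl r f g : sqint f -> sqint g -> l2 (fun x => r * f x) g = r * l2 f g.
Proof.
move=> sf sg; rewrite /l2 -RintegralZl//; last exact: sqint_mul.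
by apply: eq_Rintegral => x _; rewrite mulrA.
Qed.

Lemma l2Bl f g h : sqint f -> sqint g -> sqint h ->
  l2 (fun x => f x - g x) h = l2 f h - l2 g h.
Proof.
move=> sf sg sh.
rewrite -[in RHS]mulN1r -l2Zl// -l2Dl//; last exact: sqintZ.
by apply: eq_Rintegral => x _; rewrite mulN1r.
Qed.

Lemma sqint_sum (I : Type) (r : seq I) (F : I -> T -> R) : (forall i, sqint (F i)) ->
  sqint (fun x => \sum_(i <- r) F i x).
Proof.
move=> sF; elim: r => [|i r IH].
  by under eq_fun do rewrite big_nil; exact: sqint0.
by under eq_fun do rewrite big_cons; exact: sqintD.
Qed.

Lemma l2_suml (I : Type) (r : seq I) (F : I -> T -> R) g :
  (forall i, sqint (F i)) -> sqint g ->
  l2 (fun x => \sum_(i <- r) F i x) g = \sum_(i <- r) l2 (F i) g.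
Proof.
move=> sF sg; elim: r => [|i r IH].
  under eq_fun do rewrite big_nil.
  rewrite big_nil /l2; under eq_Rintegral do rewrite mul0r.
  by rewrite /Rintegral integral0.
under eq_fun do rewrite big_cons.
by rewrite big_cons l2Dl ?IH//; exact: sqint_sum.
Qed.

Lemma l2_ge0 f : 0 <= l2 f f.
Proof. by apply: Rintegral_ge0 => x _; rewrite -expr2 sqr_ge0. Qed.

Lemma l2_EFin f : sqint f -> (l2 f f)%:E = (\int[mu]_x (f x ^+ 2)%:E)%E.
Proof.
move=> sf; rewrite /l2 /Rintegral.
under eq_integral do rewrite -expr2.
by rewrite fineK//; apply: integrable_fin_num => //; case: sf.
Qed.

Lemma l2_eq0 f : sqint f -> l2 f f = 0 -> \forall x \ae mu, f x = 0.
Proof.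
move=> sf f0; have := l2_EFin sf; rewrite f0 => /esym.
rewrite (eq_integral (fun x => `|(f x ^+ 2)%:E|%E)); last first.
  by move=> x _; rewrite gee0_abs// lee_fin sqr_ge0.
move/(ae_eq_integral_abs mu measurableT
  ((measurable_EFinP _ _).2 (measurable_funX 2 sf.1))).1.
by apply: filterS => x /(_ I)[] /eqP; rewrite sqrf_eq0 => /eqP.
Qed.

Lemma ae_l2 f f' g : measurable_fun setT f -> measurable_fun setT f' ->
  measurable_fun setT g ->
  (\forall x \ae mu, f x = f' x) -> l2 f g = l2 f' g.
Proof.
move=> mf mf' mg ff'; congr fine; apply: ae_eq_integral => //.
- by apply/measurable_EFinP; exact: measurable_funM.
- by apply/measurable_EFinP; exact: measurable_funM.
- by apply: filterS ff' => x -> _.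
Qed.

(** Fatou on the squares: an almost everywhere limit inherits an L^2 bound. The completeness of X^s
    applies it to functions and to their difference quotients alike. *)
Lemma sqint_fatou (f : nat -> T -> R) g (C : R) :
  (forall n, sqint (f n)) -> measurable_fun [set: T] g ->
  (\forall x \ae mu, f^~ x @ \oo --> g x) ->
  (forall n, l2 (f n) (f n) <= C) -> sqint g /\ l2 g g <= C.
Proof.
move=> sf mg fg fC.
have mf2 n : measurable_fun [set: T] (fun x => (f n x ^+ 2)%:E).
  by apply/measurable_EFinP/measurable_funX; case: (sf n).
have mg2 : measurable_fun [set: T] (fun x => (g x ^+ 2)%:E).
  by apply/measurable_EFinP/measurable_funX.
have f20 n x : [set: T] x -> (0 <= (f n x ^+ 2)%:E)%E.
  by move=> _; rewrite lee_fin sqr_ge0.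
have gC : (\int[mu]_x (g x ^+ 2)%:E <= C%:E)%E.
  apply: (@le_trans _ _
      (\int[mu]_x limn_einf (fun n => (f n x ^+ 2)%:E))%E).
    rewrite le_eqVlt; apply/orP; left; apply/eqP; apply: ge0_ae_eq_integral => //.
    - by apply: measurableT_comp => //; apply: measurable_fun_limn_esup => n; exact: measurableT_comp.
    - by move=> x _; rewrite lee_fin sqr_ge0.
    - by move=> x _; apply: limn_einf_ge0 => n; exact: f20.
    - apply: filterS fg => x fgx _; apply/esym.
      suff /cvg_limn_einf_sup[->] : (fun n => (f n x ^+ 2)%:E) @ \oo --> (g x ^+ 2)%:E by [].
      by apply/cvg_EFin; [exact: nearW|]; apply: cvgM.
  apply: (le_trans (fatou mu measurableT mf2 f20)).
  rewrite limn_einf_lim; apply: lime_le; first exact: is_cvg_einfs.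
  apply: nearW => n; apply: ge_ereal_inf; exists (\int[mu]_x (f n x ^+ 2)%:E)%E.
    by exists n => /=.
  by rewrite -l2_EFin// lee_fin.
have sg : sqint g by apply: sqintP => //; apply: le_lt_trans gC _; rewrite ltry.
by split=> //; rewrite -lee_fin l2_EFin.
Qed.

End square_integrable.

(** * Almost everywhere limits of L^2 Cauchy sequences *)

Section cauchy_ae.
Context d (T : measurableType d) (R : realType).
Variable mu : {measure set T -> \bar R}.
Implicit Types (u : nat -> T -> R).

Definition l2_cauchy u := forall e : R, 0 < e -> exists n0 : nat,
  forall i j : nat, (n0 <= i)%N -> (n0 <= j)%N ->
    l2 mu (u i \- u j) (u i \- u j) <= e.

Lemma l2_cauchy_fast u : l2_cauchy u -> exists phi : nat -> nat,
  (forall n, (n <= phi n)%N) /\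
  forall n, l2 mu (u (phi n.+1) \- u (phi n)) (u (phi n.+1) \- u (phi n))
    <= (4^-1) ^+ n.
Proof.
move=> cu.
have {cu}/choice[N HN] n : exists n0 : nat, forall i j : nat, (n0 <= i)%N ->
    (n0 <= j)%N -> l2 mu (u i \- u j) (u i \- u j) <= (4^-1) ^+ n.
  by apply: cu; rewrite exprn_gt0.
(* The running sum dominates every threshold [N m] with m <= n, and the added n keeps the indices at
   least n. *)
exists (fun n => \sum_(m < n.+1) N m + n)%N; split=> n; first exact: leq_addl.
have Nn : (N n <= \sum_(m < n.+1) N m + n)%N.
  by rewrite big_ord_recr/= -addnA addnCA leq_addr.
apply: HN => //; rewrite big_ord_recr/=; apply: (leq_trans Nn).
by rewrite -addnA leq_add2l addnS (leq_trans (leqnSn _))// ltnS leq_addl.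
Qed.

(** Young's inequality 2|f| <= t f^2 + 1/t, integrated over [Om]. The parameter t is left free so as
    to balance the two terms. *)
Lemma integral_abs_le_l2 (Om : set T) f (t : R) : measurable Om ->
  (mu Om < +oo)%E -> sqint mu f -> 0 < t ->
  (\int[mu]_(x in Om) `|f x|%:E <= (2^-1 * (t * l2 mu f f + t^-1 * fine (mu Om)))%:E)%E.
Proof.
move=> mOm Omoo sf t0.
have mf := sf.1.
have mfOm : measurable_fun Om f by apply: measurable_funTS.
apply: (@le_trans _ _ (\int[mu]_(x in Om) ((2^-1 * t) * f x ^+ 2 + 2^-1 * t^-1)%:E)%E).
  apply: ge0_le_integral => //.
  - by apply/measurable_EFinP; apply: measurableT_comp.
  - apply/measurable_EFinP; apply: measurable_funD => //.
    by apply: measurable_funM => //; apply: measurable_funX.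
  - move=> x _; rewrite lee_fin.
    rewrite -(@ler_pM2l _ (2 * t)) ?mulr_gt0//.
    rewrite (_ : 2 * t * (2^-1 * t * f x ^+ 2 + 2^-1 * t^-1) = t ^+ 2 * `|f x| ^+ 2 + 1).
      by have := sqr_ge0 (t * `|f x| - 1); lra.
    rewrite real_normK ?num_real//; field.
    by rewrite gt_eqF.
under eq_integral do rewrite EFinD.
rewrite ge0_integralD//; last 3 first.
- by move=> x _; rewrite lee_fin mulr_ge0 ?sqr_ge0// mulr_ge0 ?invr_ge0// ltW.
- apply/measurable_EFinP; apply: measurable_funM => //; exact: measurable_funX.
- by move=> x _; rewrite lee_fin mulr_ge0 ?invr_ge0// ltW.
rewrite integral_cst//= -[mu Om in leLHS]fineK ?ge0_fin_numE//.
under eq_integral do rewrite EFinM.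
rewrite ge0_integralZl//; last 3 first.
- by apply/measurable_EFinP; exact: measurable_funX.
- by move=> x _; rewrite lee_fin sqr_ge0.
- by rewrite lee_fin mulr_ge0 ?invr_ge0// ltW.
rewrite mulrDr EFinD leeD//; last by rewrite -EFinM mulrA.
rewrite mulrA [leRHS]EFinM l2_EFin// lee_wpmul2l//.
  by rewrite lee_fin mulr_ge0 ?invr_ge0// ltW.
apply: ge0_subset_integral => //.
- by apply/measurable_EFinP; exact: measurable_funX.
- by move=> x _; rewrite lee_fin sqr_ge0.
Qed.

(** The Riesz-Fischer argument: along a fast subsequence the increments are summable in L^1 of the
    finite measure set [Om], so the telescoping series converges absolutely at almost every
    point. *)
Lemma l2_cauchy_ae_cvg u (Om : set T) : measurable Om -> (mu Om < +oo)%E ->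
  (forall n, sqint mu (u n)) -> l2_cauchy u ->
  (forall n, \forall x \ae mu, ~ Om x -> u n x = 0) ->
  exists (phi : nat -> nat) (v : T -> R),
  [/\ forall n, (n <= phi n)%N, measurable_fun [set: T] v,
      \forall x \ae mu, (fun n => u (phi n) x) @ \oo --> v x &
      forall x, ~ Om x -> v x = 0].
Proof.
move=> mOm Omoo su /l2_cauchy_fast[phi [phin phi4]] u0.
pose dl n x := u (phi n.+1) x - u (phi n) x.
have sdl n : sqint mu (dl n) by apply: sqintB.
pose S x := (\sum_(0 <= n <oo) `|dl n x|%:E)%E.
have mdl n : measurable_fun [set: T] (dl n) := (sdl n).1.
have mabs n : measurable_fun [set: T] (fun x => `|dl n x|%:E).
  by apply/measurable_EFinP; exact: measurableT_comp.
have mS : measurable_fun [set: T] S by apply: ge0_emeasurable_sum.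
have intS : (\int[mu]_(x in Om) S x < +oo)%E.
  rewrite integral_nneseries//; last by move=> n; exact: measurable_funTS.
  pose C := 2^-1 * (1 + fine (mu Om)).
  have C0 : 0 <= C by rewrite mulr_ge0// addr_ge0// fine_ge0.
  apply: (@le_lt_trans _ _ (\sum_(0 <= n <oo) (C * 2 / (2 ^ (n + 1))%:R)%:E)%E).
    apply: lee_nneseries => [n _ _|n _]; first exact: integral_ge0.
    (* The squared norm of the increment is at most 4^-n, so t = 2^n makes both terms of order
       2^-n. *)
    apply: le_trans (integral_abs_le_l2 mOm Omoo (sdl n) (_ : 0 < 2 ^+ n)) _.
      by rewrite exprn_gt0.
    rewrite lee_fin /C addn1 expnS natrM natrX invfM.
    rewrite -!mulrA mulVKf// ?pnatr_eq0// ler_wpM2l// mulrDl mul1r lerD//.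
      have /(ler_wpM2l (_ : 0 <= 2 ^+ n)) := phi4 n.
      move=> /(_ (exprn_ge0 _ _)) /le_trans; apply => //.
      rewrite -exprVn (_ : 4^-1 = 2^-1 * 2^-1) ?exprMn; last by field.
      by rewrite mulrA -exprMn divff ?expr1n ?mul1r// pnatr_eq0.
    by rewrite mulrC.
  have := @cvg_geometric_eseries_half R (C * 2) 0.
  by move=> /cvg_lim -> //; rewrite ltry.
pose G := Om `\` S @^-1` [set +oo%E].
have mG : measurable G.
  apply: measurableD => //; rewrite -[X in measurable X]setTI; apply: mS => //.
(* Cutting off by the indicator of [G] gives convergence at every point, hence a measurable limit
   that vanishes everywhere outside [Om]. *)
pose v_ n x := u (phi n) x * \1_G x.
have v_cvg x : exists l : R, v_ ^~ x @ \oo --> l.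
  rewrite /v_ indicE; case: (boolP (x \in G)) => [|_] /=; last first.
    by exists 0; under eq_fun do rewrite mulr0; exact: cvg_cst.
  rewrite inE => -[_ /= /eqP Sx].
  pose w n := u (phi n) x.
  suff /cvg_ex[/= l wl] : cvgn (series (telescope w)).
    exists (w 0%N + l); rewrite (_ : (fun n => _) = fun n => w 0%N + series (telescope w) n).
      by apply: cvgD => //; exact: cvg_cst.
    by apply/funext => n; rewrite -eq_sum_telescope mulr1.
  apply: normed_cvg; apply: nondecreasing_is_cvgn.
    by apply/nondecreasing_seqP => n; rewrite /= seriesEnat/= big_nat_recr//= lerDl.
  exists (fine (S x)) => _ [n _ <-] /=.
  rewrite -lee_fin fineK; last first.
    by rewrite ge0_fin_numE ?ltey//; exact: nneseries_ge0.
  by rewrite /= seriesEnat/= -sumEFin; apply: nneseries_lim_ge.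
have /choice[v vv] := v_cvg.
exists phi, v; split=> //.
- apply: (measurable_fun_cvg (h := v_)) => [n|x _]; last exact: vv.
  by apply: measurable_funM; [case: (su (phi n))|exact: measurable_indic].
- have S_ae : \forall x \ae mu, Om x -> S x \is a fin_num.
    apply: integrable_ae => //; apply/integrableP; split; first exact: measurable_funTS.
    by under eq_integral do rewrite gee0_abs ?nneseries_ge0//.
  have u0' := ae_foralln u0.
  apply: filterS2 S_ae u0' => x Sx ux0.
  rewrite (_ : (fun n => _) = v_ ^~ x); first exact: vv.
  apply/funext => n; rewrite /v_ indicE; case: (boolP (x \in G)) => [|xG] /=.
    by rewrite mulr1.
  rewrite mulr0; apply: ux0 => Ox; move/negP: xG; apply; rewrite inE; split=> //=.
  by move=> SE; have := Sx Ox; rewrite SE.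
- move=> x nOx; have : v_ ^~ x @ \oo --> (0 : R).
    rewrite (_ : v_ ^~ x = fun=> 0); first exact: cvg_cst.
    by apply/funext => n; rewrite /v_ indicE memNset ?mulr0// => -[].
  by move=> v0; apply/esym/(cvg_unique _ v0 (vv x)); exact: Rhausdorff.
Qed.

End cauchy_ae.

Section prod_ae.
Context d1 d2 (T1 : measurableType d1) (T2 : measurableType d2) (R : realType).
Variables (m1 : {sigma_finite_measure set T1 -> \bar R}).
Variables (m2 : {sigma_finite_measure set T2 -> \bar R}).

Lemma ae_prod_fst (P : T1 -> Prop) : (\forall x \ae m1, P x) ->
  \forall z \ae (m1 \x m2)%E, P z.1.
Proof.
move=> [A [mA A0 PA]]; exists (A `*` setT); split.
- exact: measurableX.
- by rewrite (product_measure1E m1 m2 mA measurableT) [X in (X * _)%E]A0 mul0e.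
- by move=> z /= nP; split=> //; apply: PA.
Qed.

Lemma ae_prod_snd (P : T2 -> Prop) : (\forall x \ae m2, P x) ->
  \forall z \ae (m1 \x m2)%E, P z.2.
Proof.
move=> [A [mA A0 PA]]; exists (setT `*` A); split.
- exact: measurableX.
- by rewrite (product_measure1E m1 m2 measurableT mA) [X in (_ * X)%E]A0 mule0.
- by move=> z /= nP; split=> //; apply: PA.
Qed.

(** The exceptional set is a rectangle, whose measure is a product; a zero product has a zero
    factor. *)
Lemma ae_prod_or (P : set T1) (Q : set T2) : measurable P -> measurable Q ->
  (\forall z \ae (m1 \x m2)%E, P z.1 \/ Q z.2) ->
  (\forall x \ae m1, P x) \/ (\forall y \ae m2, Q y).
Proof.
move=> mP mQ PQ.
have mPQ : measurable (~` P `*` ~` Q) by apply: measurableX; exact: measurableC.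
have : (m1 (~` P) * m2 (~` Q) = 0)%E.
  rewrite -(product_measure1E m1 m2 (measurableC mP) (measurableC mQ)).
  apply/(negligibleP (m1 \x m2)%E mPQ); apply: negligibleS PQ => -[x y] /= [nP nQ].
  by case.
move/eqP; rewrite mule_eq0 => /orP[] /eqP m0; [left|right].
- by exists (~` P); split=> //; exact: measurableC.
- by exists (~` Q); split=> //; exact: measurableC.
Qed.

End prod_ae.

(** * Boxes and cubes in R^N *)

Section euclidean.
Context {R : realType} {N : nat}.
Local Notation rV := 'rV[R]_N.

Lemma measurable_enormB :
  measurable_fun [set: rV * rV] (fun z => enorm (z.1 - z.2)).
Proof.
rewrite (_ : (fun _ => _) = (fun z => (dotp (z.1 - z.2) (z.1 - z.2)) `^ 2^-1)); last first.
  apply/funext => z; rewrite powR12_sqrt//.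
  by apply: sumr_ge0 => i _; rewrite -expr2 sqr_ge0.
apply: (measurableT_comp (measurable_powR _)) => //=.
apply: measurable_sum => i.
have mi : measurable_fun [set: rV * rV] (fun z => (z.1 - z.2) ord0 i).
  rewrite (_ : (fun _ => _) = (fun z : rV * rV => z.1 ord0 i - z.2 ord0 i)).
    apply: measurable_funB.
      apply: (measurableT_comp (measurable_coord i)); exact: measurable_fst.
    apply: (measurableT_comp (measurable_coord i)); exact: measurable_snd.
  by apply/funext => z; rewrite !mxE.
exact: measurable_funM.
Qed.

(** The sigma-algebra is the one generated by the coordinates, so an open set is exhibited as a
    countable union of boxes with rational centre and radius 1/(n+1), which are balls of the sup
    norm. *)
Lemma open_measurable_rV (A : set rV) : open A -> measurable A.
Proof.
move=> oA.
pose box (c : 'rV[rat]_N) (n : nat) : set rV :=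
  \bigcap_(i in [set: 'I_N]) [set x : rV | `|x ord0 i - ratr (c ord0 i)| < n.+1%:R^-1].
pose I := [set p : 'rV[rat]_N * nat | box p.1 p.2 `<=` A].
have -> : A = \bigcup_(p in I) box p.1 p.2.
  apply/seteqP; split; last by move=> x [p Ip px]; exact: Ip.
  move=> x Ax; have /nbhs_ballP[e /= e0 eA] : nbhs x A by exact: open_nbhs_nbhs.
  have [n ne] : exists n : nat, n.+1%:R^-1 < e / 2.
    exists (Num.truncn (e / 2)^-1); rewrite invf_plt ?posrE ?divr_gt0//.
    exact: truncnS_gt.
  have n0 : 0 < n.+1%:R^-1 :> R by rewrite invr_gt0.
  have /choice[c cx] i : exists q : rat, `|x ord0 i - ratr q| < n.+1%:R^-1.
    have [|q] := @rat_in_itvoo R (x ord0 i - n.+1%:R^-1) (x ord0 i + n.+1%:R^-1).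
      by rewrite ltrBlDr -addrA ltrDl addr_gt0.
    by rewrite in_itv/= => qx; exists q; rewrite distrC ltr_distl.
  exists (\row_i c i, n); last by move=> i _ /=; rewrite mxE.
  move=> y cy; apply: eA; split=> // i j; rewrite ord1 /ball /=.
  have := cy j Logic.I; rewrite /= mxE => cyj.
  have := cx j; rewrite distrC => cxj; rewrite -(subrK (ratr (c j)) (x ord0 j)) -addrA.
  apply: le_lt_trans (ler_normD _ _) _; rewrite (splitr e) -(distrC (y ord0 j)).
  by rewrite ltrD// (lt_trans _ ne)// distrC.
rewrite bigcup_mkcond; apply: countable_bigcupT_measurable; first exact: countableP.
move=> -[c n]; case: ifP => // _.
apply: fin_bigcap_measurable => [//|i _].
rewrite -[X in measurable X]setTI.
have mf : measurable_fun [set: rV] (fun x : rV => `|x ord0 i - ratr (c ord0 i)|).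
  apply: measurableT_comp => //; apply: measurable_funB => //; exact: measurable_coord.
rewrite (_ : [set x | _] = (fun x : rV => `|x ord0 i - ratr (c ord0 i)|) @^-1` `]-oo, n.+1%:R^-1[).
  by apply: mf.
by apply/seteqP; split=> x /=; rewrite in_itv.
Qed.

(** Half-open, so that the cubes of a grid neither overlap nor leave gaps. *)
Definition cube (c : 'I_N -> R) (h : R) : set rV :=
  [set x | forall i, c i <= x ord0 i < c i + h].

Lemma measurable_cube c h : measurable (cube c h).
Proof.
rewrite (_ : cube c h = \bigcap_(i in [set: 'I_N]) (fun x : rV => x ord0 i) @^-1` `[c i, c i + h[).
  apply: fin_bigcap_measurable => // i _; rewrite -[X in measurable X]setTI.
  by apply: measurable_coord.
by apply/seteqP; split=> x /= xc i; [move=> _|]; have := xc i; rewrite /= in_itv/=; auto.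
Qed.

End euclidean.

Lemma lebesgue_rV_cube (R : realType) (N : nat) (c : 'I_N -> R) (h : R) : 0 <= h ->
  lebesgue_rV R N (cube c h) = (h ^+ N)%:E.
Proof.
move=> h0; elim: N c => [|N IH] c.
  rewrite /= /dirac indicE mem_set ?expr0//= /cube/=.
  by case.
rewrite /= /cons_measure /pushforward.
rewrite (_ : _ @^-1` _ = `[c ord0, c ord0 + h[ `*` cube (fun i => c (lift ord0 i)) h).
  rewrite product_measure1E//; last exact: measurable_cube.
  rewrite IH [X in (X * _)%E]lebesgue_measure_itv/= lte_fin; case: ltP => [_|].
    by rewrite -EFinD addrAC subrr add0r exprS EFinM.
  rewrite gerDl => h0'; have -> : h = 0 by apply/eqP; rewrite eq_le h0'.
  by rewrite mul0e expr0n.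
have e0 (z : measurableTypeR R * 'rV[R]_N) : rV_cons z ord0 ord0 = z.1.
  by have /(congr1 fst) := rV_consK z.
have eS (z : measurableTypeR R * 'rV[R]_N) i : rV_cons z ord0 (lift ord0 i) = z.2 ord0 i.
  have /(congr1 snd)/(congr1 (fun x : 'rV_N => x ord0 i)) /= <- := rV_consK z.
  by rewrite [RHS]mxE; congr (fun_of_matrix _ _ _); exact/val_inj.
apply/seteqP; split=> z /=.
  move=> zc; split; first by have := zc ord0; rewrite e0 /= in_itv.
  by move=> i; have := zc (lift ord0 i); rewrite eS.
move=> [z1 z2] i; case: (unliftP ord0 i) => [j|] ->; first by rewrite eS; exact: z2.
by rewrite e0; move: z1; rewrite /= in_itv.
Qed.

Lemma Lfun2_sqint d (T : measurableType d) (R : realType)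
    (mu : {measure set T -> \bar R}) (f : T -> R) :
  f \in Lfun mu 2%:E <-> sqint mu f.
Proof.
split=> [lf|[mf f2]].
  split; last exact: Lfun2_integrable_sqr.
  by move/sub_Lfun_mfun : lf; rewrite inE.
rewrite inE; apply/andP; split; rewrite inE//=.
rewrite /finite_norm unlock.
apply: poweR_lty; apply: le_lt_trans (sqint_lty (conj mf f2)).
rewrite le_eqVlt; apply/orP; left; apply/eqP; apply: eq_integral => x _ /=.
by rewrite powR_mulrn// real_normK ?num_real.
Qed.

(** * The space X^s *)

Section fractional_space.
Context {R : realType} (s : R) {N : nat} (Omega : set 'rV[R]_N).
Local Notation leb := (lebesgue_rV R N).
Local Notation leb2 := (leb \x leb)%E.
Local Notation fct := ('rV[R]_N -> R).
Implicit Types (u v w : fct).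

(* The Gagliardo integrand of u and v is dq u * dq v, so that inner is an L^2
   inner product over R^N x R^N. *)
Definition wt (z : 'rV[R]_N * 'rV[R]_N) : R :=
  enorm (z.1 - z.2) `^ (- ((N%:R + 2 * s) / 2)).

Definition dq u (z : 'rV[R]_N * 'rV[R]_N) : R := (u z.1 - u z.2) * wt z.

Lemma gagliardoE u v z : gagliardo s u v z = dq u z * dq v z.
Proof.
rewrite /gagliardo /dq mulrACA; congr (_ * _).
rewrite -expr2 -powR_mulrn ?powR_ge0// -powRrM mulNr divfK ?pnatr_eq0//.
by rewrite powRN.
Qed.

Lemma wt_gt0 z : 0 < s -> z.1 != z.2 -> 0 < wt z.
Proof.
move=> s0 z12; rewrite powR_gt0// /enorm sqrtr_gt0 lt_neqAle.
rewrite (_ : 0 <= _) ?andbT; last by apply: sumr_ge0 => i _; rewrite -expr2 sqr_ge0.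
apply: contra z12 => /eqP/esym/psumr_eq0P h; rewrite -subr_eq0; apply/eqP/rowP => i.
by have /eqP := h (fun i _ => sqr_ge0 _) i isT; rewrite -expr2 sqrf_eq0 => /eqP ->; rewrite mxE.
Qed.

Lemma measurable_wt : measurable_fun [set: _] wt.
Proof. exact: (measurableT_comp (measurable_powR _) measurable_enormB). Qed.

Lemma measurable_dq u : measurable_fun [set: _] u -> measurable_fun [set: _] (dq u).
Proof.
move=> mu; apply: measurable_funM; last exact: measurable_wt.
apply: measurable_funB; first exact: (measurableT_comp mu measurable_fst).
exact: (measurableT_comp mu measurable_snd).
Qed.

Lemma innerE u v : inner s u v = l2 leb2 (dq u) (dq v).
Proof. by apply: eq_Rintegral => z _; rewrite gagliardoE. Qed.

Lemma XsP u : Xs s Omega u <->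
  [/\ sqint leb u, sqint leb2 (dq u) & \forall x \ae leb, ~ Omega x -> u x = 0].
Proof.
have E : (\int[leb \x leb]_z (gagliardo s u u z)%:E =
          \int[leb \x leb]_z (dq u z ^+ 2)%:E)%E.
  by apply: eq_integral => z _; rewrite gagliardoE -expr2.
split=> [[/Lfun2_sqint su] | [su sdu u0]].
  rewrite E => du u0; split=> //; apply: sqintP => //; apply: measurable_dq.
  by case: su.
by split=> //; [exact/Lfun2_sqint|rewrite E; exact: sqint_lty].
Qed.

Lemma dqD u v : dq (u \+ v) = dq u \+ dq v.
Proof. by apply/funext => z; rewrite /dq /=; ring. Qed.

Lemma dqZ r u : dq (r \*: u) = fun z => r * dq u z.
Proof. by apply/funext => z; rewrite /dq /= /GRing.scale/=; ring. Qed.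

Definition Xs_pred : {pred fct} := fun u => `[< Xs s Omega u >].

Lemma Xs_submod_closed : submod_closed Xs_pred.
Proof.
split.
  apply/asboolP/XsP; split.
  - exact: sqint0.
  - rewrite (_ : dq 0 = fun=> 0); first exact: sqint0.
    by apply/funext => z; rewrite /dq subrr mul0r.
  - exact: nearW.
move=> r u v /asboolP/XsP[su sdu u0] /asboolP/XsP[sv sdv v0].
apply/asboolP/XsP; split.
- by apply: sqintD => //; exact: sqintZ.
- rewrite (_ : dq _ = (fun z => r * dq u z) \+ dq v).
    by apply: sqintD => //; exact: sqintZ.
  by rewrite -dqZ -dqD.
- apply: filterS2 u0 v0 => x ux vx Ox.
  by change (r * u x + v x = 0); rewrite ux// vx// mulr0 addr0.
Qed.

HB.instance Definition _ := GRing.isSubmodClosed.Build R fct Xs_pred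
  Xs_submod_closed.

(** Functions and not classes modulo null sets: a vector space on which both forms are only
    semidefinite. *)
Definition Xspace : Type := {u : fct | u \in Xs_pred}.
HB.instance Definition _ := [isSub of Xspace for @sval _ _].
HB.instance Definition _ := [Choice of Xspace by <:].
HB.instance Definition _ := [SubChoice_isSubLmodule of Xspace by <:].

End fractional_space.

Lemma max0_sub (R : realDomainType) (a : R) : a = Num.max a 0 - Num.max (- a) 0.
Proof. by rewrite /Order.max; do 2 case: ltP => ?; lra. Qed.

Lemma max0_mulN (R : realDomainType) (a : R) : Num.max a 0 * Num.max (- a) 0 = 0.
Proof.
case: (leP a 0) => a0; first by rewrite mul0r.
by rewrite max_r ?mulr0// oppr_le0 ltW.
Qed.

Lemma max0_sqr (R : realDomainType) (a : R) : Num.max a 0 ^+ 2 <= a ^+ 2.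
Proof. by case: (leP a 0) => a0 //; rewrite expr0n sqr_ge0. Qed.

Lemma max0_lip (R : realDomainType) (a b : R) :
  (Num.max a 0 - Num.max b 0) ^+ 2 <= (a - b) ^+ 2.
Proof.
case: (leP a 0) => a0; case: (leP b 0) => b0; rewrite ?subr0 ?sub0r ?sqrrN //.
- by rewrite expr0n sqr_ge0.
- by rewrite -(sqrrN (a - b)) opprB ler_sqr ?nnegrE; lra.
- by rewrite ler_sqr ?nnegrE; lra.
Qed.

Lemma Rintegral_eq0 d (T : measurableType d) (R : realType)
    (mu : {measure set T -> \bar R}) (f : T -> R) :
  (forall x, f x = 0) -> \int[mu]_x f x = 0.
Proof.
move=> f0; rewrite /Rintegral; under eq_integral do rewrite f0.
by rewrite integral0.
Qed.

Section Xspace_theory.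
Context {R : realType} {s : R} {N : nat} {Omega : set 'rV[R]_N}.
Hypothesis s_gt0 : 0 < s.
Hypothesis mOmega : measurable Omega.
Hypothesis Omega_lty : (lebesgue_rV R N Omega < +oo)%E.
Local Notation leb := (lebesgue_rV R N).
Local Notation leb2 := (leb \x leb)%E.
Local Notation fct := ('rV[R]_N -> R).
Local Notation X := (Xspace s Omega).
Implicit Types (u v w : X).

Definition ipX u v : R := inner s (\val u) (\val v).
Definition beX u v : R := \int[leb]_(x in Omega) (\val u x * \val v x).

Lemma Xs_val u : Xs s Omega (\val u).
Proof. by apply/asboolP; case: u. Qed.

Lemma sqint_val u : sqint leb (\val u).
Proof. by have /XsP[] := Xs_val u. Qed.

Lemma sqint_dq u : sqint leb2 (dq s (\val u)).
Proof. by have /XsP[] := Xs_val u. Qed.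

Lemma val_out u : \forall x \ae leb, ~ Omega x -> \val u x = 0.
Proof. by have /XsP[] := Xs_val u. Qed.

Lemma measurable_val u : measurable_fun [set: _] (\val u).
Proof. by case: (sqint_val u). Qed.

Lemma valD u v : \val (u + v) = \val u \+ \val v. Proof. by []. Qed.
Lemma valZ r u : \val (r *: u) = fun x => r * \val u x. Proof. by []. Qed.

Lemma integral_Omega (f : fct) v : measurable_fun [set: _] f ->
  \int[leb]_(x in Omega) (f x * \val v x) = l2 leb f (\val v).
Proof.
move=> mf; rewrite Rintegral_mkcond; congr fine.
apply: ae_eq_integral => //.
- apply/measurable_EFinP.
  apply/(measurable_restrictT (fun x => f x * \val v x) mOmega).
  by apply: measurable_funTS; apply: measurable_funM => //; exact: measurable_val.
- by apply/measurable_EFinP; apply: measurable_funM => //; exact: measurable_val.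
- apply: filterS (val_out v) => x vx _; rewrite patchE; case: ifPn => //.
  by move=> /negP; rewrite inE => /vx ->; rewrite mulr0.
Qed.

Lemma beXE u v : beX u v = l2 leb (\val u) (\val v).
Proof. by rewrite /beX integral_Omega//; exact: measurable_val. Qed.

Lemma ipXE u v : ipX u v = l2 leb2 (dq s (\val u)) (dq s (\val v)).
Proof. exact: innerE. Qed.

Lemma ipXC u v : ipX u v = ipX v u.
Proof. by rewrite !ipXE l2C. Qed.

Lemma ipXDl u v w : ipX (u + v) w = ipX u w + ipX v w.
Proof. by rewrite !ipXE valD dqD -l2Dl//; exact: sqint_dq. Qed.

Lemma ipXZl r u v : ipX (r *: u) v = r * ipX u v.
Proof. by rewrite !ipXE [\val (_ *: _)]valZ dqZ -l2Zl//; exact: sqint_dq. Qed.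

Lemma ipX_ge0 u : 0 <= ipX u u.
Proof. by rewrite ipXE l2_ge0. Qed.

Lemma beXC u v : beX u v = beX v u.
Proof. by rewrite !beXE l2C. Qed.

Lemma beXDl u v w : beX (u + v) w = beX u w + beX v w.
Proof. by rewrite !beXE valD -l2Dl//; exact: sqint_val. Qed.

Lemma beXZl r u v : beX (r *: u) v = r * beX u v.
Proof. by rewrite !beXE valZ -l2Zl//; exact: sqint_val. Qed.

Lemma beX_ge0 u : 0 <= beX u u.
Proof. by rewrite beXE l2_ge0. Qed.

Lemma beX_eq0 u : beX u u = 0 <-> \forall x \ae leb, \val u x = 0.
Proof.
rewrite beXE; split; first by apply: l2_eq0; exact: sqint_val.
move=> u0; rewrite (ae_l2 (f' := cst 0) _ _ _ u0)//; try exact: measurable_val.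
by apply: Rintegral_eq0 => x; rewrite mul0r.
Qed.

Lemma ipX_null u : beX u u = 0 -> ipX u u = 0.
Proof.
move=> /beX_eq0 u0; rewrite ipXE.
have mu := measurable_dq s (measurable_val u).
rewrite (ae_l2 (f' := cst 0) _ _ _ _)//.
  by apply: Rintegral_eq0 => x; rewrite mul0r.
apply: filterS2 (ae_prod_fst leb u0) (ae_prod_snd leb u0) => z z1 z2.
by rewrite /dq z1 z2 subrr mul0r.
Qed.

Lemma Xs_funrpos u : (\val u)^\+ \in Xs_pred s Omega.
Proof.
apply/asboolP/XsP.
have mp : measurable_fun [set: _] ((\val u)^\+).
  by apply: measurable_funrpos; exact: measurable_val.
split.
- apply: sqint_le mp (sqint_val u) _ => x; exact: max0_sqr.
- apply: sqint_le (sqint_dq u) _; first exact: measurable_dq.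
  move=> z; rewrite /dq !exprMn ler_wpM2r ?sqr_ge0//.
  exact: max0_lip.
- by apply: filterS (val_out u) => x ux Ox; rewrite /funrpos ux// maxxx.
Qed.

Definition posX u : X := exist _ ((\val u)^\+) (Xs_funrpos u).

Lemma posXE u x : \val (posX u) x = Num.max (\val u x) 0. Proof. by []. Qed.

Lemma posX_sub u : u = posX u - posX (- u).
Proof.
by apply/val_inj/funext => x; exact: max0_sub.
Qed.

Lemma posXZ t u : 0 <= t -> posX (t *: u) = t *: posX u.
Proof.
move=> t0; apply/val_inj/funext => x.
change (Num.max (t * \val u x) 0 = t * Num.max (\val u x) 0).
by rewrite maxr_pMr// mulr0.
Qed.

Lemma posX_orth u : beX (posX u) (posX (- u)) = 0.
Proof.
by rewrite beXE; apply: Rintegral_eq0 => x; exact: max0_mulN.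
Qed.

Lemma posX_ge0 u v : 0 <= beX (posX u) (posX v).
Proof.
by rewrite beXE; apply: Rintegral_ge0 => x _; rewrite !posXE mulr_ge0// le_max lexx orbT.
Qed.

(* For nonnegative u, v with uv = 0 the integrand of inner u v is
   -(u(x)v(y) + u(y)v(x)) times a positive weight. *)
Lemma posX_sign u v : beX (posX u) (posX v) = 0 -> 0 <= ipX (posX u) (posX v) ->
  beX (posX u) (posX u) = 0 \/ beX (posX v) (posX v) = 0.
Proof.
set p := posX u; set q := posX v; rewrite beXE ipXE => pq0 ip0.
have p0 x : 0 <= \val p x by rewrite posXE le_max lexx orbT.
have q0 x : 0 <= \val q x by rewrite posXE le_max lexx orbT.
have {}pq0 : \forall x \ae leb, \val p x * \val q x = 0.
  have ipq := sqint_mul (sqint_val p) (sqint_val q).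
  have : (\int[leb]_x `|(\val p x * \val q x)%:E| = 0)%E.
    under eq_integral do rewrite gee0_abs ?lee_fin ?mulr_ge0//.
    rewrite -(fineK (integrable_fin_num _ ipq))//.
    by congr EFin.
  move/(ae_eq_integral_abs leb measurableT (measurable_int _ ipq)).1.
  by apply: filterS => x /(_ Logic.I)[].
pose g z := (\val p z.1 * \val q z.2 + \val p z.2 * \val q z.1) * wt s z ^+ 2.
have g0 z : 0 <= g z by rewrite mulr_ge0 ?sqr_ge0// addr_ge0// mulr_ge0.
have gE : \forall z \ae leb2, dq s (\val p) z * dq s (\val q) z = - g z.
  apply: filterS2 (ae_prod_fst leb pq0) (ae_prod_snd leb pq0) => z z1 z2.
  rewrite /dq /g.
  have -> : (\val p z.1 - \val p z.2) * wt s z * ((\val q z.1 - \val q z.2) * wt s z)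
    = (\val p z.1 * \val q z.1 + \val p z.2 * \val q z.2
       - (\val p z.1 * \val q z.2 + \val p z.2 * \val q z.1)) * wt s z ^+ 2 by ring.
  by rewrite z1 z2 add0r sub0r mulNr.
have idq := sqint_mul (sqint_dq p) (sqint_dq q).
have mg : measurable_fun [set: _] g.
  have m1 w : measurable_fun [set: _] (fun z : 'rV[R]_N * 'rV[R]_N => \val w z.1).
    exact: (measurableT_comp (measurable_val w) measurable_fst).
  have m2 w : measurable_fun [set: _] (fun z : 'rV[R]_N * 'rV[R]_N => \val w z.2).
    exact: (measurableT_comp (measurable_val w) measurable_snd).
  apply: measurable_funM; last by apply: measurable_funX; exact: measurable_wt.
  by apply: measurable_funD; apply: measurable_funM.
have ig0 : (\int[leb2]_z `|(g z)%:E| = 0)%E.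
  apply/eqP; rewrite eq_le integral_ge0// andbT.
  have -> : (\int[leb2]_z `|(g z)%:E| = \int[leb2]_z - (dq s (\val p) z * dq s (\val q) z)%:E)%E.
    apply: ae_eq_integral => //.
    - by apply/measurable_EFinP; apply: measurableT_comp.
    - by apply/measurableT_comp => //; exact: measurable_int idq.
    - by apply: filterS gE => z -> _; rewrite gee0_abs ?lee_fin// -EFinN opprK.
  rewrite integralN; last exact/fin_num_adde_defr/integrable_pos_fin_num.
  by rewrite -(fineK (integrable_fin_num _ idq))// -EFinN lee_fin oppr_le0.
move/(ae_eq_integral_abs leb2 measurableT ((measurable_EFinP _ _).2 mg)).1 : ig0 => ig0.
(* Off the diagonal the weight is positive, so g = 0 forces p(x) q(y) = 0; on the diagonal this is
   pq = 0. *)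
have pq : \forall z \ae leb2, \val p z.1 = 0 \/ \val q z.2 = 0.
  apply: filterS2 ig0 (ae_prod_fst leb pq0) => z /(_ Logic.I)[] gz z1.
  suff /eqP : \val p z.1 * \val q z.2 = 0.
    by rewrite mulf_eq0 => /orP[] /eqP; [left|right].
  have [z12|z12] := eqVneq z.1 z.2; first by rewrite -z12.
  have w0 := wt_gt0 s_gt0 z12; move/eqP: gz; rewrite mulf_eq0 sqrf_eq0 (gt_eqF w0) orbF.
  by rewrite paddr_eq0 ?mulr_ge0// => /andP[/eqP -> _].
have := ae_prod_or (P := [set x | \val p x = 0]) (Q := [set x | \val q x = 0]) _ _ pq.
case.
- have mw := measurable_val p.
  by have := mw measurableT [set (0 : R)] (lebesgue_stieltjes_measure.measurable_set1 (0 : R)); rewrite setTI.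
- have mw := measurable_val q.
  by have := mw measurableT [set (0 : R)] (lebesgue_stieltjes_measure.measurable_set1 (0 : R)); rewrite setTI.
- by move=> h; left; apply/beX_eq0.
- by move=> h; right; apply/beX_eq0.
Qed.

(** A subsequence converges almost everywhere to some v. Fatou, applied to the differences with a
    fixed term [u m], puts [u m - v] in the space with the Cauchy bound, which yields both v in X^s
    and the convergence of the whole sequence. *)
Lemma Xspace_complete (u : nat -> X) :
  (forall e : R, 0 < e -> exists n0 : nat, forall i j : nat, (n0 <= i)%N -> (n0 <= j)%N ->
     ipX (u i - u j) (u i - u j) <= e /\ beX (u i - u j) (u i - u j) <= e) ->
  exists v, forall e : R, 0 < e -> exists n0 : nat, forall i : nat, (n0 <= i)%N ->
     ipX (u i - v) (u i - v) <= e /\ beX (u i - v) (u i - v) <= e.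
Proof.
move=> cu.
have := l2_cauchy_ae_cvg mOmega Omega_lty (fun n => sqint_val (u n)) _ (fun n => val_out (u n)).
case.
  move=> e /cu[n0 n0P]; exists n0 => i j i0 j0.
  by have [_] := n0P i j i0 j0; rewrite beXE.
move=> phi [v [phin mv uv v0]].
have key e n0 : (forall i j : nat, (n0 <= i)%N -> (n0 <= j)%N ->
     ipX (u i - u j) (u i - u j) <= e /\ beX (u i - u j) (u i - u j) <= e) ->
  forall m : nat, (n0 <= m)%N -> let f := fun x => \val (u m) x - v x in
  [/\ sqint leb f, l2 leb f f <= e, sqint leb2 (dq s f) & l2 leb2 (dq s f) (dq s f) <= e].
  move=> n0P m n0m f.
  have n0phi k : (n0 <= phi (k + n0))%N by apply: leq_trans (phin _); exact: leq_addl.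
  have be_le k : l2 leb (\val (u m - u (phi (k + n0)%N))) (\val (u m - u (phi (k + n0)%N))) <= e.
    by rewrite -beXE; case: (n0P m _ n0m (n0phi k)).
  have ip_le k : l2 leb2 (dq s (\val (u m - u (phi (k + n0)%N))))
      (dq s (\val (u m - u (phi (k + n0)%N)))) <= e.
    by rewrite -ipXE; case: (n0P m _ n0m (n0phi k)).
  have mf : measurable_fun [set: _] f by apply: measurable_funB => //; exact: measurable_val.
  have fv : \forall x \ae leb, (fun k => \val (u m - u (phi (k + n0)%N)) x) @ \oo --> f x.
    apply: filterS uv => x ux; apply: cvgB; first exact: cvg_cst.
    by have := ux; rewrite -(cvg_shiftn n0).
  have [sf lf] := sqint_fatou (fun k => sqint_val (u m - u (phi (k + n0)%N))) mf fv
    (fun k => be_le k).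
  have dfv : \forall z \ae leb2, (fun k => dq s (\val (u m - u (phi (k + n0)%N))) z) @ \oo
      --> dq s f z.
    apply: filterS2 (ae_prod_fst leb fv) (ae_prod_snd leb fv) => z z1 z2.
    by apply: cvgM; [exact: cvgB|exact: cvg_cst].
  have [sdf ldf] := sqint_fatou (fun k => sqint_dq (u m - u (phi (k + n0)%N)))
    (measurable_dq s mf) dfv
    (fun k => ip_le k).
  by [].
have vX : v \in Xs_pred s Omega.
  have [n0 n0P] := cu 1 ltr01.
  have [sf _ sdf _] := key 1 n0 n0P n0 (leqnn _).
  rewrite (_ : v = \val (u n0) - (fun x => \val (u n0) x - v x)); last first.
    by apply/funext => x; change (v x = \val (u n0) x - (\val (u n0) x - v x)); ring.
  apply: rpredB; first exact: (valP (u n0)).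
  apply/asboolP/XsP; split=> //.
  by apply: filterS (val_out (u n0)) => x ux Ox; rewrite ux// v0// subrr.
exists (exist _ v vX) => e e0; have [n0 n0P] := cu e e0.
exists n0 => i i0; have [_ lf _ ldf] := key e n0 n0P i i0.
by rewrite ipXE beXE.
Qed.

End Xspace_theory.

(** * Compactness of the embedding into L^2 *)

Section variance.
Context d (T : measurableType d) (R : realType).
Variable m : {sigma_finite_measure set T -> \bar R}.

Lemma integral_lin3 (f g h : T -> R) (a b c : R) :
  m.-integrable setT (EFin \o f) -> m.-integrable setT (EFin \o g) ->
  m.-integrable setT (EFin \o h) ->
  (\int[m]_x (a * f x + b * g x + c * h x)%:E =
   (a * \int[m]_x f x + b * \int[m]_x g x + c * \int[m]_x h x)%:E)%E.
Proof.
move=> mf mg mh.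
have iZ r (k : T -> R) : m.-integrable setT (EFin \o k) ->
    m.-integrable setT (EFin \o (fun x => r * k x)).
  by move=> ik; apply: (eq_integrable _ _ _ _ (integrableZl measurableT r ik)).
have iD (k l : T -> R) : m.-integrable setT (EFin \o k) -> m.-integrable setT (EFin \o l) ->
    m.-integrable setT (EFin \o (fun x => k x + l x)).
  by move=> ik il; apply: (eq_integrable _ _ _ _ (integrableD measurableT ik il)).
rewrite -!RintegralZl// -!RintegralD//; try by [exact: iZ|apply: (iD); exact: (iZ)].
rewrite /Rintegral fineK//; apply: integrable_fin_num => //.
by apply: (iD); [apply: (iD)|]; exact: (iZ).
Qed.

Variables (Q : set T) (u : T -> R).
Hypotheses (mQ : measurable Q) (Qoo : (m Q < +oo)%E) (su : sqint m u).

Lemma integrable_indic_lty : m.-integrable setT (fun x => (\1_Q x)%:E).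
Proof.
apply/integrableP; split; first exact/measurable_EFinP.
rewrite (eq_integral (fun x => (\1_Q x)%:E)); last first.
  by move=> t _; rewrite gee0_abs// lee_fin.
by rewrite integral_indic// setIT.
Qed.

Lemma sqint_indic : sqint m (\1_Q : T -> R).
Proof.
split=> //; apply: (eq_integrable _ _ _ _ integrable_indic_lty) => // x _ /=.
by rewrite !indicE; case: (_ \in _); rewrite ?expr1n ?expr0n.
Qed.

Lemma sqint_mul_indic : sqint m (fun x => u x * \1_Q x).
Proof.
apply: sqint_le su _; first by apply: measurable_funM => //; case: su.
move=> x; rewrite indicE; case: (_ \in _); first by rewrite mulr1.
by rewrite mulr0 expr0n/= sqr_ge0.
Qed.

(** Expand the square and use Tonelli. The right-hand side is twice m(Q)^2 times the variance of u
    on Q, so a bound on the double integral controls the L^2 norm on Q by the average of u. *)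
Lemma variance_identity :
  (\int[m \x m]_z ((u z.1 - u z.2) ^+ 2 * (\1_Q z.1 * \1_Q z.2))%:E =
   (2 * (fine (m Q) * l2 m u (fun x => u x * \1_Q x) - l2 m u (\1_Q : T -> R) ^+ 2))%:E)%E.
Proof.
have mu := su.1; have si := sqint_indic; have sui := sqint_mul_indic.
set U := l2 m u (\1_Q : T -> R); set V := l2 m u _; set q := fine (m Q).
have qE : \int[m]_x \1_Q x = q.
  by rewrite /Rintegral integral_indic// setIT.
have ii : m.-integrable setT (EFin \o \1_Q) by exact: integrable_indic_lty.
have iui := sqint_mul su si.
have iuui := sqint_mul su sui.
have m1 (w : T -> R) : measurable_fun [set: T] w ->
    measurable_fun [set: _] (fun z : T * T => w z.1).
  by move=> mw; exact: (measurableT_comp mw measurable_fst).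
have m2 (w : T -> R) : measurable_fun [set: T] w ->
    measurable_fun [set: _] (fun z : T * T => w z.2).
  by move=> mw; exact: (measurableT_comp mw measurable_snd).
have indK x : \1_Q x * \1_Q x = \1_Q x :> R.
  by rewrite indicE; case: (_ \in _); rewrite ?mulr1 ?mulr0.
rewrite fubini_tonelli1; last 2 first.
- apply/measurable_EFinP; apply: measurable_funM.
    by apply: measurable_funX; apply: measurable_funB; [exact: m1|exact: m2].
  by apply: measurable_funM; [exact: m1|exact: m2].
- by move=> z; rewrite lee_fin mulr_ge0 ?sqr_ge0// !indicE mulr_ge0.
transitivity (\int[m]_x (q * (u x * (u x * \1_Q x)) + (- 2 * U) * (u x * \1_Q x) + V * \1_Q x)%:E)%E.
  apply: eq_integral => x _; rewrite /fubini_F/=.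
  transitivity (\int[m]_y (((u x) ^+ 2 * \1_Q x) * \1_Q y +
      (- 2 * u x * \1_Q x) * (u y * \1_Q y) + \1_Q x * (u y * (u y * \1_Q y)))%:E)%E.
    by apply: eq_integral => y _; congr EFin; ring.
  rewrite integral_lin3// qE -/U -/V; congr EFin; rewrite /U /V /l2; ring.
rewrite integral_lin3// qE -/U -/V; congr EFin; rewrite /U /V /l2; ring.
Qed.

End variance.

Section grid.
Context {R : realType} {s : R} {N : nat} {Omega : set 'rV[R]_N}.
Hypothesis s_gt0 : 0 < s.
Local Notation leb := (lebesgue_rV R N).
Local Notation leb2 := (leb \x leb)%E.
Local Notation X := (Xspace s Omega).
Local Notation pw := (N%:R + 2 * s).

Lemma enorm_cube (c : 'I_N -> R) (h : R) x y : 0 <= h -> cube c h x -> cube c h y ->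
  enorm (x - y) <= Num.sqrt N%:R * h.
Proof.
move=> h0 cx cy; rewrite -[h in leRHS]ger0_norm// -sqrtr_sqr -sqrtrM//.
rewrite ler_sqrt ?mulr_ge0 ?sqr_ge0//.
apply: (@le_trans _ _ (\sum_(i < N) h ^+ 2)); last by rewrite sumr_const card_ord mulr_natl.
apply: ler_sum => i _; rewrite -expr2 !mxE -real_normK ?num_real//.
rewrite ler_sqr ?nnegrE// ler_norml.
have := cx i; have := cy i; lra.
Qed.

(** Two points of the cube are at distance at most sqrt(N) h, which bounds the Gagliardo kernel from
    below. *)
Lemma cube_oscillation (c : 'I_N -> R) (h : R) (u : 'rV[R]_N -> R) z : 0 <= h ->
  (u z.1 - u z.2) ^+ 2 * (\1_(cube c h) z.1 * \1_(cube c h) z.2) <=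
  (Num.sqrt N%:R * h) `^ pw * (dq s u z ^+ 2 * (\1_(cube c h) z.1 * \1_(cube c h) z.2)).
Proof.
move=> h0; rewrite mulrA !indicE.
case: (boolP (z.1 \in _)) => [|_]; last by rewrite !mul0r !mulr0.
case: (boolP (z.2 \in _)) => [|_]; last by rewrite !mulr0.
rewrite !inE => z2 z1; rewrite !mulr1.
have [->|z12] := eqVneq z.1 z.2; first by rewrite subrr expr0n/= mulr_ge0 ?powR_ge0 ?sqr_ge0.
have w0 := wt_gt0 s_gt0 z12.
have e0 : 0 <= enorm (z.1 - z.2) by rewrite sqrtr_ge0.
rewrite /dq exprMn mulrCA -[leLHS]mulr1 ler_wpM2l ?sqr_ge0//.
have -> : wt s z ^+ 2 = (enorm (z.1 - z.2) `^ pw)^-1.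
  by rewrite -powR_mulrn ?powR_ge0// -powRrM mulNr divfK ?pnatr_eq0// powRN.
rewrite ler_pdivlMr ?mul1r.
  apply: ge0_ler_powR; rewrite ?nnegrE ?mulr_ge0//.
    by rewrite addr_ge0// mulr_ge0// ltW.
  exact: enorm_cube z1 z2.
rewrite lt_neqAle powR_ge0 andbT eq_sym; apply: contraTneq w0 => /powR_eq0_eq0 e1.
by rewrite /wt e1 powR0 ?ltxx// oppr_eq0 mulf_neq0 ?invr_eq0 ?pnatr_eq0// gt_eqF// ltr_wpDl// mulr_gt0.
Qed.

Variables (n : nat) (L h : R).
Hypothesis (h_gt0 : 0 < h) (hL : 2 * L <= n%:R * h).
Hypothesis Omega_L : forall x, Omega x -> forall i, `|x ord0 i| < L.

(** A grid of n^N cubes of side h starting at the corner (-L, ..., -L); by [hL] it covers the box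
    |x_i| < L. *)
Let corner (f : {ffun 'I_N -> 'I_n}) (i : 'I_N) : R := - L + (f i)%:R * h.
Let Q f := cube (corner f) h.

Lemma grid_le1 x : \sum_f \1_(Q f) x <= 1 :> R.
Proof.
have [[f Qf]|noQ] := pselect (exists f, Q f x); last first.
  rewrite big1 ?ler01// => f _; rewrite indicE memNset// => Qf; apply: noQ; by exists f.
rewrite (bigD1 f)//= big1 ?addr0 ?indicE ?mem_set// => g gf.
rewrite indicE memNset// => Qg; move/eqP: gf; apply; apply/ffunP => i; apply/val_inj/eqP.
have := Qf i; have := Qg i; rewrite /corner => /andP[a1 a2] /andP[b1 b2] /=.
have le_of (j k : 'I_n) : j%:R * h < (k%:R + 1) * h -> (j <= k)%N.
  by rewrite ltr_pM2r// natr1 ltr_nat ltnS.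
by rewrite eqn_leq !le_of//; lra.
Qed.

Lemma grid_cover x : Omega x -> \sum_f \1_(Q f) x = 1 :> R.
Proof.
move=> Ox; apply/eqP; rewrite eq_le grid_le1/=.
have xL i : 0 <= (x ord0 i + L) / h by rewrite divr_ge0 ?ltW//; have := Omega_L Ox i; rewrite ltr_norml; lra.
have lt_n i : (Num.truncn ((x ord0 i + L) / h) < n)%N.
  rewrite truncn_lt_nat//.
  rewrite ltr_pdivrMr//; apply: lt_le_trans hL.
  by have := Omega_L Ox i; rewrite ltr_norml; lra.
pose f := [ffun i => Ordinal (lt_n i)].
rewrite (bigD1 f)//= indicE mem_set; last first.
  move=> i; rewrite /corner ffunE /=.
  have /andP[t1 t2] := truncn_itv (xL i).
  move: t1 t2; set k := Num.truncn _; rewrite ler_pdivlMr// ltr_pdivrMr// -(natr1 k) mulrDl mul1r.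
  lra.
by rewrite lerDl sumr_ge0.
Qed.

(* On a small cube the variance of u is controlled by its Gagliardo seminorm:
   up to a small multiple of ipX u u, the L^2 norm depends on the finitely many
   averages of u over the cubes of a grid. *)
Lemma grid_estimate (u : X) :
  l2 leb (\val u) (\val u) <=
  (h ^+ N)^-1 * \sum_f (l2 leb (\val u) (\1_(Q f) : _ -> R)) ^+ 2 +
  (Num.sqrt N%:R * h) `^ pw / (2 * h ^+ N) * ipX u u.
Proof.
set q := h ^+ N; set D := _ `^ pw.
have q0 : 0 < q by rewrite exprn_gt0.
have mQ f : measurable (Q f) by exact: measurable_cube.
have Qq f : leb (Q f) = q%:E by rewrite lebesgue_rV_cube// ltW.
have Qoo f : (leb (Q f) < +oo)%E by rewrite Qq ltry.
have su := sqint_val u; have sdu := sqint_dq u.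
pose e f : 'rV[R]_N -> R := \1_(Q f).
pose e2 f (z : 'rV[R]_N * 'rV[R]_N) := e f z.1 * e f z.2.
pose V f := l2 leb (\val u) (fun x => \val u x * e f x).
pose G f := l2 leb2 (dq s (\val u)) (fun z => dq s (\val u) z * e2 f z).
have me2 f : measurable_fun [set: _] (e2 f).
  have me : measurable_fun [set: 'rV[R]_N] (e f) by exact: measurable_indic.
  by apply: measurable_funM;
    [exact: (measurableT_comp me measurable_fst)|exact: (measurableT_comp me measurable_snd)].
have e01 f x : e f x = 0 \/ e f x = 1.
  by rewrite /e indicE; case: (_ \in _); [right|left].
have e201 f z : e2 f z = 0 \/ e2 f z = 1.
  rewrite /e2; case: (e01 f z.1) => ->; first by left; rewrite mul0r.
  by rewrite mul1r; exact: e01.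
have sde2 f : sqint leb2 (fun z => dq s (\val u) z * e2 f z).
  apply: (sqint_le _ sdu); first by apply: measurable_funM => //; exact: sdu.1.
  move=> z; case: (e201 f z) => ->; last by rewrite mulr1.
  by rewrite mulr0 expr0n sqr_ge0.
have sV f : sqint leb (fun x => \val u x * e f x) by exact: sqint_mul_indic.
have -> : l2 leb (\val u) (\val u) = \sum_f V f.
  rewrite /V; under eq_bigr do rewrite l2C.
  rewrite -l2_suml//; apply: ae_l2; first exact: measurable_val.
  - exact: (sqint_sum _ sV).1.
  - exact: measurable_val.
  - apply: filterS (val_out u) => x ux; rewrite -mulr_sumr.
    have [Ox|/ux ->] := pselect (Omega x); last by rewrite mul0r.
    by rewrite grid_cover// mulr1.
(* Variance identity on one cube of the grid, with the oscillation bounded by the Gagliardo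
   integrand. *)
have GD f : 2 * (q * V f - l2 leb (\val u) (e f) ^+ 2) <= D * G f.
  have -> : q = fine (leb (Q f)) by rewrite Qq.
  rewrite -lee_fin -variance_identity//.
  have -> : (D * G f)%:E = (\int[leb2]_z (D * (dq s (\val u) z * (dq s (\val u) z * e2 f z)))%:E)%E.
    have ii := sqint_mul sdu (sde2 f).
    under eq_integral do rewrite EFinM.
    rewrite integralZl// EFinM; congr (_ * _)%E.
    by rewrite /G /l2 /Rintegral fineK//; apply: integrable_fin_num.
  apply: ge0_le_integral => //.
  - by move=> z _; rewrite lee_fin mulr_ge0 ?sqr_ge0// !indicE mulr_ge0.
  - have mu := measurable_val u.
    apply/measurable_EFinP; apply: measurable_funM; last exact: me2.
    apply: measurable_funX; apply: measurable_funB;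
      [exact: (measurableT_comp mu measurable_fst)|exact: (measurableT_comp mu measurable_snd)].
  - apply/measurable_EFinP; apply: measurable_funM => //; apply: measurable_funM; first exact: sdu.1.
    exact: (sde2 f).1.
  - by move=> z _; rewrite lee_fin (mulrA (dq s (\val u) z)) -expr2; apply: cube_oscillation; exact: ltW.
(* The blocks [Q f] x [Q f] are disjoint in R^N x R^N, so their contributions add up to at most the
   full seminorm. *)
have GI : \sum_f G f <= ipX u u.
  rewrite /G; under eq_bigr do rewrite l2C.
  rewrite -l2_suml// ipXE; apply: le_Rintegral => //.
  - by apply: sqint_mul => //; exact: sqint_sum.
  - exact: sqint_mul.
  - move=> z _; rewrite -mulr_sumr mulrAC; apply: ler_piMr; first by rewrite -expr2 sqr_ge0.
    apply: le_trans (grid_le1 z.1); apply: ler_sum => f _; rewrite /e2.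
    case: (e01 f z.2) => ->; rewrite ?mulr1// mulr0 indicE.
    by case: (_ \in _).
have VE f : V f <= q^-1 * l2 leb (\val u) (e f) ^+ 2 + D / (2 * q) * G f.
  rewrite -(@ler_pM2l _ (2 * q)) ?mulr_gt0//; have GDf := GD f.
  have -> : 2 * q * (q^-1 * l2 leb (\val u) (e f) ^+ 2 + D / (2 * q) * G f) =
     2 * l2 leb (\val u) (e f) ^+ 2 + D * G f by field; rewrite gt_eqF.
  by move: GDf; rewrite mulrBr lerBlDl mulrA.
apply: le_trans (ler_sum _ (fun f _ => VE f)) _.
rewrite big_split/= -!mulr_sumr lerD2l ler_wpM2l// divr_ge0 ?powR_ge0// mulr_ge0// ltW//.
Qed.

End grid.

(** Discriminant criterion, with t = x / B. The case B = 0 is included because the forms are only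
    semidefinite; there t is chosen so that the left-hand side exceeds A. *)
Lemma sqr_le_of_quadratic (R : realFieldType) (x A B : R) : 0 <= A -> 0 <= B ->
  (forall t, 2 * t * x <= A + t ^+ 2 * B) -> x ^+ 2 <= A * B.
Proof.
move=> A0 B0 h; have [B_0|Bn0] := eqVneq B 0.
  have [->|x0] := eqVneq x 0; first by rewrite expr0n/= mulr_ge0.
  have := h ((A + 1) / (2 * x)); rewrite B_0 mulr0 addr0.
  have -> : 2 * ((A + 1) / (2 * x)) * x = A + 1 by field.
  lra.
have Bp : 0 < B by rewrite lt_neqAle eq_sym Bn0.
have := h (x / B); rewrite -(ler_pM2r Bp) [leRHS]mulrDl.
have -> : 2 * (x / B) * x * B = 2 * x ^+ 2 by field.
have -> : (x / B) ^+ 2 * B * B = x ^+ 2 by field.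
lra.
Qed.

Lemma l2_CauchySchwarz d (T : measurableType d) (R : realType)
    (mu : {measure set T -> \bar R}) (f g : T -> R) : sqint mu f -> sqint mu g ->
  l2 mu f g ^+ 2 <= l2 mu f f * l2 mu g g.
Proof.
move=> sf sg; apply: sqr_le_of_quadratic; [exact: l2_ge0|exact: l2_ge0|move=> t].
have sh : sqint mu (fun x => t * g x) by exact: sqintZ.
have := l2_ge0 mu (fun x => f x - t * g x).
rewrite l2Bl//; last exact: sqintB.
rewrite ![l2 mu _ (fun x => _ - _)]l2C !l2Bl// l2Zl// (l2C _ f (fun x => t * g x)) l2Zl//.
have -> : l2 mu (fun x => t * g x) (fun x => t * g x) = t ^+ 2 * l2 mu g g.
  by rewrite l2Zl// l2C l2Zl// mulrA.
rewrite (l2C _ g f).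
lra.
Qed.

Section compact_embedding.
Context {R : realType} {s : R} {N : nat} {Omega : set 'rV[R]_N}.
Hypothesis s_gt0 : 0 < s.
Hypothesis mOmega : measurable Omega.
Hypothesis bOmega : bounded_set Omega.
Local Notation leb := (lebesgue_rV R N).
Local Notation X := (Xspace s Omega).

Lemma bounded_coord : exists2 L : R, 0 < L & forall x, Omega x -> forall i, `|x ord0 i| < L.
Proof.
have [L L0 LP] := ex_strict_bound_gt0 bOmega.
exists L => // x Ox i; apply: le_lt_trans (LP x Ox).
rewrite [leRHS]mx_normrE.
exact: (le_bigmax _ (fun ij : 'I_1 * 'I_N => `|x ij.1 ij.2|) (ord0, i)).
Qed.

Lemma Omega_lty : (leb Omega < +oo)%E.
Proof.
have [L L0 LP] := bounded_coord.
apply: (@le_lt_trans _ _ (leb (cube (fun=> - L) (2 * L)))).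
  apply: le_measure; rewrite ?inE//; first exact: measurable_cube.
  by move=> x Ox i; have := LP x Ox i; rewrite ltr_norml; lra.
by rewrite lebesgue_rV_cube ?ltry// mulr_ge0// ltW.
Qed.

(** A fine enough grid: up to e times the seminorm, the L^2 norm is controlled by finitely many
    linear functionals. *)
Lemma finite_rank_approx (e : R) : 0 < e -> exists (I : finType)
    (phi : I -> 'rV[R]_N -> R) (K : R), [/\ 0 <= K, forall i, sqint leb (phi i) &
  forall u : X, beX u u <= K * \sum_i l2 leb (\val u) (phi i) ^+ 2 + e * ipX u u].
Proof.
move=> e0; have [L L0 LP] := bounded_coord.
have s2 : 0 < 2 * s by rewrite mulr_gt0.
(* The seminorm has coefficient A h^(2s) in [grid_estimate], and d^(2s) = e / (A + 1) makes it at
   most e for h <= d. *)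
pose A := Num.sqrt N%:R `^ (N%:R + 2 * s) / 2.
have A0 : 0 <= A by rewrite divr_ge0// powR_ge0.
pose d := (e / (A + 1)) `^ (2 * s)^-1.
have eA : 0 < e / (A + 1) by rewrite divr_gt0// ltr_wpDl.
have d0 : 0 < d by rewrite powR_gt0.
pose n := Num.truncn (2 * L / d).
pose h := 2 * L / n.+1%:R.
have h0 : 0 < h by rewrite divr_gt0// mulr_gt0.
have hd : h <= d.
  rewrite ler_pdivrMr// [leRHS]mulrC -ler_pdivrMr//; apply/ltW; exact: truncnS_gt.
have hL : 2 * L <= n.+1%:R * h by rewrite [leRHS]mulrC divfK// pnatr_eq0.
exists {ffun 'I_N -> 'I_n.+1}, (fun f : {ffun 'I_N -> 'I_n.+1} => \1_(cube (fun i => - L + (f i)%:R * h) h) : _ -> R), (h ^+ N)^-1.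
split.
- by rewrite invr_ge0 exprn_ge0// ltW.
- move=> f; apply: sqint_indic; first exact: measurable_cube.
  by rewrite lebesgue_rV_cube ?ltry// ltW.
move=> u; rewrite beXE//; apply: le_trans (grid_estimate s_gt0 h0 hL LP u) _.
rewrite lerD2l ler_wpM2r ?ipX_ge0//.
rewrite powRM ?sqrtr_ge0 ?(ltW h0)//.
rewrite (@powRD _ h) ?(gt_eqF h0) ?implybT//.
rewrite powR_mulrn ?(ltW h0)// invfM.
have -> : Num.sqrt N%:R `^ (N%:R + 2 * s) * (h ^+ N * h `^ (2 * s)) * (2^-1 * (h ^+ N)^-1)
  = A * h `^ (2 * s).
  by rewrite /A; field; rewrite expf_neq0// gt_eqF.
apply: (@le_trans _ _ (A * d `^ (2 * s))).
  by rewrite ler_wpM2l// ge0_ler_powR ?nnegrE ?(ltW s2) ?(ltW h0) ?(ltW d0).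
rewrite -powRrM mulVf ?gt_eqF// powRr1 ?(ltW eA)// mulrCA ger_pMr//.
by rewrite ler_pdivrMr ?mul1r ?lerDl// ltr_wpDl.
Qed.

Lemma ultra_bounded_cauchy (U : set_system nat) (x : nat -> R) (K d : R) :
  UltraFilter U -> (forall n, `|x n| <= K) -> 0 < d ->
  exists2 A, U A & forall i j, A i -> A j -> `|x i - x j| <= d.
Proof.
move=> UU xK d0.
have /(_ (x @ U) _ _)[] := @segment_compact R (- K) K.
  rewrite /fmap /=; apply: filterS (filterT) => n _ /=.
  by rewrite in_itv/= -ler_norml.
move=> p [_ clp].
have [Ux|Ux] := in_ultra_setVsetC (x @^-1` ball p (d / 2)) UU.
  exists (x @^-1` ball p (d / 2)) => // i j; rewrite /ball/= => pi pj.
  rewrite -(subrK p (x i)) -addrA (splitr d); apply: le_trans (ler_normD _ _) _.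
  by rewrite lerD ?ltW// distrC.
have [] := clp (~` ball p (d / 2)) (ball p (d / 2)).
- exact: Ux.
- by apply: nbhsx_ballx; rewrite divr_gt0.
- by move=> y [].
Qed.

(* A nonprincipal ultrafilter on the indices makes all the bounded sequences of
   averages converge at once. *)
Lemma Xspace_compact (u : nat -> X) (K : R) :
  (forall n, ipX (u n) (u n) <= K) -> (forall n, beX (u n) (u n) <= K) ->
  exists2 f : nat -> nat, (forall n, (n <= f n)%N) &
  forall e : R, 0 < e -> exists n0 : nat, forall i j : nat, (n0 <= i)%N -> (n0 <= j)%N ->
    beX (u (f i) - u (f j)) (u (f i) - u (f j)) <= e.
Proof.
move=> ipK beK.
have K0 : 0 <= K by apply: le_trans (ipK 0%N); exact: ipX_ge0.
have [U [UU ooU]] := ultraFilterLemma (F := \oo) _.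
have ipB (v w : X) : ipX (v - w) (v - w) <= 2 * (ipX v v + ipX w w).
  have := ipX_ge0 (v + w).
  rewrite -[- w]scaleN1r !(ipXDl, ipXC _ (_ + _), ipXZl, ipXC _ (_ *: _)) (ipXC w v).
  lra.
have cauchyU (e : R) : 0 < e -> exists2 A, U A & forall i j, A i -> A j ->
    beX (u i - u j) (u i - u j) <= e.
  (* Half of e goes to the seminorm term, as the seminorm of a difference is at most 4K; the other
     half goes to the finitely many averages, made [d]-close. *)
  move=> e0; pose e1 := e / (8 * (K + 1)).
  have e10 : 0 < e1 by rewrite divr_gt0// mulr_gt0// ltr_wpDl.
  have [I [phi [C [C0 sphi phiP]]]] := finite_rank_approx e10.
  pose d := Num.sqrt (e / (2 * (C * #|I|%:R + 1))).
  have CI : 0 < C * #|I|%:R + 1 by rewrite ltr_wpDl// mulr_ge0.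
  have d0 : 0 < d by rewrite sqrtr_gt0 divr_gt0// mulr_gt0.
  have bphi i n : `|l2 leb (\val (u n)) (phi i)| <= Num.sqrt (K * l2 leb (phi i) (phi i)).
    rewrite -sqrtr_sqr ler_wsqrtr//; apply: le_trans (l2_CauchySchwarz (sqint_val _) (sphi i)) _.
    by rewrite ler_wpM2r ?l2_ge0// -beXE.
  have /choice[A AP] i : exists A, U A /\ forall n m, A n -> A m ->
      `|l2 leb (\val (u n)) (phi i) - l2 leb (\val (u m)) (phi i)| <= d.
    by have [A UA AP] := ultra_bounded_cauchy UU (bphi i) d0; exists A.
  exists [set n | forall i, A i n].
    by apply: filter_forall => i; case: (AP i).
  move=> n m An Am; apply: le_trans (phiP _) _.
  have dE : d ^+ 2 = e / (2 * (C * #|I|%:R + 1)).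
    by rewrite sqr_sqrtr// divr_ge0 ?mulr_ge0 ?ltW.
  have sum_le : \sum_i l2 leb (\val (u n - u m)) (phi i) ^+ 2 <= #|I|%:R * d ^+ 2.
    rewrite mulr_natl -sumr_const; apply: ler_sum => i _.
    rewrite -real_normK ?num_real// ler_sqr ?nnegrE ?(ltW d0)//.
    have [_ /(_ n m (An i) (Am i))] := AP i.
    by rewrite -l2Bl//; exact: sqint_val.
  rewrite (splitr e) lerD//.
    apply: le_trans (ler_wpM2l C0 sum_le) _; rewrite dE mulrA.
    rewrite -subr_ge0.
    have -> : e / 2 - C * #|I|%:R * (e / (2 * (C * #|I|%:R + 1))) =
      e / 2 / (C * #|I|%:R + 1) by field; rewrite gt_eqF.
    by rewrite ltW// !divr_gt0.
  apply: (@le_trans _ _ (e1 * (4 * (K + 1)))).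
    rewrite ler_wpM2l ?(ltW e10)//; apply: le_trans (ipB _ _) _.
    by have := ipK n; have := ipK m; lra.
  rewrite /e1 -subr_ge0.
  have -> : e / 2 - e / (8 * (K + 1)) * (4 * (K + 1)) = 0; last by [].
  by field; rewrite gt_eqF// ltr_wpDl.
have /choice[A AP] k : exists A, U A /\ forall i j, A i -> A j ->
    beX (u i - u j) (u i - u j) <= k.+1%:R^-1.
  have [|A UA AP] := cauchyU k.+1%:R^-1; first by rewrite invr_gt0.
  by exists A.
(* Diagonal choice: finite intersections stay in [U], and they meet every tail because [U] refines
   the filter at infinity. *)
have UB n : U [set k | (n <= k)%N /\ forall m, (m <= n)%N -> A m k].
  elim: n => [|n IH].
    apply: filterS (AP 0%N).1 => k Ak; split=> // m; rewrite leqn0 => /eqP ->; exact: Ak.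
  have Un : U [set k | (n.+1 <= k)%N] by apply: ooU; exists n.+1.
  apply: filterS3 IH Un (AP n.+1).1 => k [_ Ak] nk Ank; split=> // m.
  by rewrite leq_eqVlt => /predU1P[->|/Ak].
have /choice[f fP] n : exists k, (n <= k)%N /\ forall m, (m <= n)%N -> A m k.
  exact: filter_ex (UB n).
exists f; first by move=> n; case: (fP n).
move=> e e0; exists (Num.truncn e^-1) => i j i0 j0.
have [_ AiP] := AP (Num.truncn e^-1).
apply: le_trans (AiP (f i) (f j) _ _) _; [exact: (fP i).2|exact: (fP j).2|].
by rewrite invf_ple ?posrE//; apply/ltW; exact: truncnS_gt.
Qed.

End compact_embedding.

(** * Abstract spectral decomposition *)

Record semi_inner (R : realType) (V : lmodType R) (q : V -> V -> R) : Prop := SemiInner {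
  siC : forall u v, q u v = q v u;
  siDl : forall u v w, q (u + v) w = q u w + q v w;
  siZl : forall t u v, q (t *: u) v = t * q u v;
  si_ge0 : forall u, 0 <= q u u }.

Section semi_inner_theory.
Context {R : realType} {V : lmodType R} {q : V -> V -> R} (hq : semi_inner q).
Implicit Types (u v w : V) (t : R).

Lemma siDr u v w : q u (v + w) = q u v + q u w.
Proof. by rewrite siC// siDl// !(siC hq u). Qed.
Lemma siZr t u v : q u (t *: v) = t * q u v.
Proof. by rewrite siC// siZl// (siC hq u). Qed.
Lemma siNl u v : q (- u) v = - q u v.
Proof. by rewrite -scaleN1r siZl// mulN1r. Qed.
Lemma siNr u v : q u (- v) = - q u v.
Proof. by rewrite siC// siNl siC. Qed.
Lemma si0l u : q 0 u = 0.
Proof. by rewrite -(scale0r (0 : V)) siZl// mul0r. Qed.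
Lemma si0r u : q u 0 = 0.
Proof. by rewrite siC// si0l. Qed.

Definition siE := (siDl hq, siDr, siZl hq, siZr, siNl, siNr, si0l, si0r).

Lemma si_CauchySchwarz u v : q u v ^+ 2 <= q u u * q v v.
Proof.
apply: sqr_le_of_quadratic; [exact: si_ge0|exact: si_ge0|move=> t].
by have := si_ge0 hq (u - t *: v); rewrite !siE (siC hq v u); lra.
Qed.

Lemma si_null u v : q u u = 0 -> q u v = 0.
Proof.
move=> u0; have := si_CauchySchwarz u v; rewrite u0 mul0r => h.
by apply/eqP; rewrite -sqrf_eq0 eq_le h sqr_ge0.
Qed.

Lemma siB_le u v : q (u - v) (u - v) <= 2 * q u u + 2 * q v v.
Proof. by have := si_ge0 hq (u + v); rewrite !siE (siC hq v u); lra. Qed.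

Lemma siBC u v : q (u - v) (u - v) = q (v - u) (v - u).
Proof. by rewrite -opprB siNl siNr opprK. Qed.

Lemma siD_orth u v : q u v = 0 -> q (u + v) (u + v) = q u u + q v v.
Proof. by move=> uv; rewrite !siE (siC hq v u) uv; lra. Qed.

End semi_inner_theory.

Lemma eq0_of_sqr_le (R : realFieldType) (x C : R) :
  (forall e : R, 0 < e -> x ^+ 2 <= e * C) -> x = 0.
Proof.
move=> h; apply/eqP; rewrite -sqrf_eq0; apply: contraT => x0.
have x2 : 0 < x ^+ 2 by rewrite lt_neqAle eq_sym x0 sqr_ge0.
have C0 : 0 < C by have := h 1 ltr01; rewrite mul1r; apply: lt_le_trans.
have := h (x ^+ 2 / (2 * C)) (divr_gt0 x2 (mulr_gt0 (ltr0Sn _ 1) C0)).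
have -> : x ^+ 2 / (2 * C) * C = x ^+ 2 / 2 by field; rewrite gt_eqF.
lra.
Qed.

(** * Positive parts and expansions of the energy *)

Section lattice_forms.
Context {R : realType} {V : lmodType R}.
Variables (ip be : V -> V -> R) (pos : V -> V).
Implicit Types (u v w h : V) (a b t : R).

(* The seminorm of ip plays the role of the norm of X^s, that of be the role
   of the L^2 norm, and pos u that of the positive part u^+. *)
Record lattice_forms : Prop := LatticeForms {
  lf_ip : semi_inner ip;
  lf_be : semi_inner be;
  lf_sub : forall u, u = pos u - pos (- u);
  lf_posZ : forall t u, 0 <= t -> pos (t *: u) = t *: pos u;
  lf_orth : forall u, be (pos u) (pos (- u)) = 0;
  lf_ge0 : forall u v, 0 <= be (pos u) (pos v);
  lf_null : forall u, be u u = 0 -> ip u u = 0;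
  lf_sign : forall u v, be (pos u) (pos v) = 0 -> 0 <= ip (pos u) (pos v) ->
    be (pos u) (pos u) = 0 \/ be (pos v) (pos v) = 0;
  lf_compact : forall (u : nat -> V) (K : R),
    (forall n, ip (u n) (u n) <= K) -> (forall n, be (u n) (u n) <= K) ->
    exists2 f : nat -> nat, (forall n, (n <= f n)%N) &
    forall e : R, 0 < e -> exists n0 : nat, forall i j : nat,
      (n0 <= i)%N -> (n0 <= j)%N ->
      be (u (f i) - u (f j)) (u (f i) - u (f j)) <= e;
  lf_complete : forall u : nat -> V,
    (forall e : R, 0 < e -> exists n0 : nat, forall i j : nat,
      (n0 <= i)%N -> (n0 <= j)%N ->
      ip (u i - u j) (u i - u j) <= e /\ be (u i - u j) (u i - u j) <= e) ->
    exists v, forall e : R, 0 < e -> exists n0 : nat, forall i : nat,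
      (n0 <= i)%N -> ip (u i - v) (u i - v) <= e /\ be (u i - v) (u i - v) <= e }.

Hypothesis lf : lattice_forms.
Let hip := lf_ip lf.
Let hbe := lf_be lf.

Lemma be_sqr u : be u u = be (pos u) (pos u) + be (pos (- u)) (pos (- u)).
Proof.
rewrite {1 2}(lf_sub lf u) !(siE hbe) (siC hbe (pos (- u)) (pos u)) (lf_orth lf).
lra.
Qed.

Lemma be_posl u : be (pos u) u = be (pos u) (pos u).
Proof. by rewrite {2}(lf_sub lf u) !(siE hbe) (lf_orth lf) subr0. Qed.

Lemma be_posNl u : be (pos (- u)) u = - be (pos (- u)) (pos (- u)).
Proof. by have := be_posl (- u); rewrite (siE hbe); lra. Qed.

(* Convexity of u |-> |u^+|^2, whose derivative at u is 2 u^+. *)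
Lemma pos_convex u h :
  be (pos u) (pos u) + 2 * be (pos u) h <= be (pos (u + h)) (pos (u + h)).
Proof.
have := si_ge0 hbe (pos (u + h) - pos u).
have := lf_ge0 lf u (- (u + h)).
have E : be (pos u) (pos (u + h)) - be (pos u) (pos (- (u + h))) =
  be (pos u) u + be (pos u) h.
  by rewrite -[RHS](siDr hbe) [in RHS](lf_sub lf (u + h)) (siDr hbe _ (pos _)) (siNr hbe).
move: E; rewrite be_posl !(siE hbe) (siC hbe (pos (u + h)) (pos u)).
lra.
Qed.

Lemma posN_convex u h : be (pos (- u)) (pos (- u)) - 2 * be (pos (- u)) h <=
  be (pos (- (u + h))) (pos (- (u + h))).
Proof. by have := pos_convex (- u) (- h); rewrite -opprD (siE hbe); lra. Qed.

(** Write u - v = x - y with x = u^+ - v^+ and y = u^- - v^-. Orthogonality of the parts of one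
    vector and positivity of the cross terms give [be x y <= 0], so expanding the square only
    helps. *)
Lemma pos_contract u v :
  be (pos u - pos v) (pos u - pos v) <= be (u - v) (u - v).
Proof.
have E : u - v = (pos u - pos v) - (pos (- u) - pos (- v)).
  by rewrite {1}(lf_sub lf u) {1}(lf_sub lf v); rewrite !opprD !opprK addrACA.
rewrite E; set x := pos u - pos v; set y := pos (- u) - pos (- v).
have xy : be x y <= 0.
  rewrite /x /y !(siE hbe) !(lf_orth lf).
  have := lf_ge0 lf u (- v); have := lf_ge0 lf v (- u).
  lra.
move: xy; move: x y => x y xy.
have := si_ge0 hbe y; rewrite !(siE hbe) (siC hbe y x).
lra.
Qed.

(* II a b u is the I(u, a, b) of the text, and dF a b u its differential at u. *)
Definition dF a b u h := ip u h - (b * be (pos u) h - a * be (pos (- u)) h).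
Definition II a b u := 2^-1 * ip u u -
  2^-1 * (b * be (pos u) (pos u) + a * be (pos (- u)) (pos (- u))).

Lemma dFDr a b u h k : dF a b u (h + k) = dF a b u h + dF a b u k.
Proof. by rewrite /dF (siE hip) !(siE hbe); ring. Qed.

Lemma dFZr a b u t h : dF a b u (t *: h) = t * dF a b u h.
Proof. by rewrite /dF (siE hip) !(siE hbe); ring. Qed.

Lemma dFN a b u h : dF a b (- u) h = - dF b a u h.
Proof. by rewrite /dF opprK !(siE hip); ring. Qed.

Lemma dF_id a b u : dF a b u u = 2 * II a b u.
Proof. by rewrite /dF /II be_posl be_posNl; field. Qed.

Lemma IIZ a b t u : 0 <= t -> II a b (t *: u) = t ^+ 2 * II a b u.
Proof.
move=> t0; rewrite /II -(scalerN t u) !(lf_posZ lf)// !(siE hip) !(siE hbe); ring.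
Qed.

(** The nonlinear part of the differential is Lipschitz for the weak norm [be], the one in which
    bounded sequences have Cauchy subsequences. *)
Lemma dF_diff a b u v h :
  (dF a b u h - ip u h - (dF a b v h - ip v h)) ^+ 2 <=
  (`|a| + `|b|) ^+ 2 * (be (u - v) (u - v) * be h h).
Proof.
set B := be (u - v) (u - v) * be h h.
have key w x : be (w - x) (w - x) = be (u - v) (u - v) ->
  `|be (pos w) h - be (pos x) h| <= Num.sqrt B.
  move=> wx; rewrite -sqrtr_sqr ler_wsqrtr// /B -wx.
  rewrite -(siNl hbe) -(siDl hbe).
  apply: le_trans (si_CauchySchwarz hbe _ _) _.
  by rewrite ler_wpM2r ?(si_ge0 hbe)// pos_contract.
have B0 : 0 <= B by rewrite mulr_ge0 ?(si_ge0 hbe).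
rewrite -[in leRHS](sqr_sqrtr B0) -exprMn -[leLHS]real_normK ?num_real//.
rewrite ler_sqr ?nnegrE ?mulr_ge0 ?addr_ge0 ?sqrtr_ge0//.
have -> : dF a b u h - ip u h - (dF a b v h - ip v h) =
  a * (be (pos (- u)) h - be (pos (- v)) h) - b * (be (pos u) h - be (pos v) h).
  by rewrite /dF; ring.
apply: le_trans (ler_normB _ _) _; rewrite !normrM mulrDl.
rewrite lerD// ler_wpM2l// key//.
by rewrite -opprD (siNl hbe) (siNr hbe) opprK.
Qed.

(* rp and rm are the second order remainders of |u^+|^2 and |u^-|^2. *)
Lemma II_taylor a b u d : exists rp rm, [/\ 0 <= rp, 0 <= rm, rp + rm = be d d &
  II a b (u + d) = II a b u + dF a b u d + 2^-1 * (ip d d - (b * rp + a * rm))].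
Proof.
exists (be (pos (u + d)) (pos (u + d)) - be (pos u) (pos u) - 2 * be (pos u) d).
exists (be (pos (- (u + d))) (pos (- (u + d))) - be (pos (- u)) (pos (- u)) + 2 * be (pos (- u)) d).
split.
- by have := pos_convex u d; lra.
- by have := posN_convex u d; lra.
- have := be_sqr (u + d); have := be_sqr u.
  have : be u d = be (pos u) d - be (pos (- u)) d.
    by rewrite {1}(lf_sub lf u) (siE hbe) (siE hbe).
  rewrite !(siE hbe) (siC hbe d u).
  lra.
- by rewrite /II /dF !(siE hip) (siC hip d u); field.
Qed.

Lemma pos_compare u v : be (pos u) (pos u) <=
  2 * be (pos v) (pos v) + 2 * be (u - v) (u - v).
Proof.
have := pos_contract u v; have := siB_le hbe (pos v) (pos v - pos u).
rewrite opprB addrC subrK (siBC hbe (pos v)).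
lra.
Qed.

End lattice_forms.

Lemma invS_lt_eventually (R : realType) (e : R) : 0 < e ->
  exists n0 : nat, forall n : nat, (n0 <= n)%N -> n.+1%:R^-1 <= e.
Proof.
move=> e0; exists (Num.truncn e^-1) => n n0n.
rewrite invf_ple ?posrE//; apply: (@le_trans _ _ (Num.truncn e^-1).+1%:R).
  by apply/ltW; exact: truncnS_gt.
by rewrite ler_nat ltnS.
Qed.

(** * Almost critical points and projections onto eigenspaces *)

Section spectral.
Context {R : realType} {V : lmodType R} {ip be : V -> V -> R} {pos : V -> V}.
Hypothesis lf : lattice_forms ip be pos.
Let hip := lf_ip lf.
Let hbe := lf_be lf.
Implicit Types (u v w h : V) (a b t : R).
Local Notation dF := (dF ip be pos).
Local Notation II := (II ip be pos).

(** The predicate [P] travels with the approximating points: a normalization stored in it shows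
    afterwards that the limit is not null. *)
Lemma palais_smale a b (P : V -> Prop) (K : R) :
  (forall e : R, 0 < e -> exists u, [/\ P u, ip u u <= K, be u u <= K &
    forall h, dF a b u h ^+ 2 <= e * ip h h]) ->
  exists u, (forall h, dF a b u h = 0) /\
    forall e : R, 0 < e -> exists v, [/\ P v, ip (v - u) (v - u) <= e & be (v - u) (v - u) <= e].
Proof.
move=> H.
have K0 : 0 <= K by have [u [_ uK _ _]] := H 1 ltr01; apply: le_trans uK; exact: si_ge0.
have /choice[u_ u_P] n : exists u, [/\ P u, ip u u <= K, be u u <= K &
    forall h, dF a b u h ^+ 2 <= n.+1%:R^-1 * ip h h].
  by apply: H; rewrite invr_gt0.
have [f fn fC] := lf_compact lf (fun n => let: And4 _ h _ _ := u_P n in h)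
  (fun n => let: And4 _ _ h _ := u_P n in h).
pose w n := u_ (f n).
have wP n : [/\ P (w n), ip (w n) (w n) <= K, be (w n) (w n) <= K &
    forall h, dF a b (w n) h ^+ 2 <= n.+1%:R^-1 * ip h h].
  have [? ? ? ud] := u_P (f n); split=> // h; apply: le_trans (ud h) _.
  by rewrite ler_wpM2r ?(si_ge0 hip)// lef_pV2 ?posrE// ler_nat ltnS.
pose L : R := `|a| + `|b| + 1.
have L1 : 1 <= L by rewrite lerDr addr_ge0.
have L0 : 0 < L by apply: lt_le_trans L1.
have dG u v h : (dF a b u h - ip u h - (dF a b v h - ip v h)) ^+ 2 <=
    L ^+ 2 * (be (u - v) (u - v) * be h h).
  apply: le_trans (dF_diff lf a b u v h) _.
  rewrite ler_wpM2r ?mulr_ge0 ?(si_ge0 hbe)// ler_sqr ?nnegrE ?addr_ge0//.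
  by rewrite /L lerDl.
(* With d = w i - w j, [ip d d] is the difference of the differentials at w i and w j applied to d,
   both small, up to their nonlinear parts, which are close because d is small for [be]. Each
   contributes e / 3. *)
have cw (e : R) : 0 < e -> exists n0 : nat, forall i j : nat, (n0 <= i)%N -> (n0 <= j)%N ->
    ip (w i - w j) (w i - w j) <= e /\ be (w i - w j) (w i - w j) <= e.
  move=> e0; pose e3 := e / 3.
  have e30 : 0 < e3 by rewrite divr_gt0.
  have [n1 n1P] : exists n0 : nat, forall n : nat, (n0 <= n)%N -> n.+1%:R^-1 * (4 * K + 1) <= e3 ^+ 2.
    have K1 : 0 < 4 * K + 1 by rewrite ltr_wpDl// mulr_ge0.
    have [|n0 n0P] := @invS_lt_eventually R (e3 ^+ 2 / (4 * K + 1)).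
      by rewrite divr_gt0// exprn_gt0.
    by exists n0 => n /n0P; rewrite ler_pdivlMr.
  have [|n2 n2P] := fC (e3 / L); first by rewrite divr_gt0.
  exists (maxn n1 n2) => i j; rewrite !geq_max => /andP[i1 i2] /andP[j1 j2].
  have beij : be (w i - w j) (w i - w j) <= e3 / L by exact: n2P.
  set d := w i - w j in beij *.
  have beL : L * be d d <= e3 by rewrite mulrC -ler_pdivlMr.
  have ipd : ip d d <= 4 * K + 1.
    apply: le_trans (siB_le hip _ _) _.
    by have [_ h1 _ _] := wP i; have [_ h2 _ _] := wP j; lra.
  have dFd n : (n1 <= n)%N -> `|dF a b (w n) d| <= e3.
    move=> nn; rewrite -ler_sqr ?nnegrE ?(ltW e30)// real_normK ?num_real//.
    have [_ _ _ /(_ d) /le_trans] := wP n; apply; apply: le_trans (n1P n nn).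
    by rewrite ler_wpM2l.
  have Gd : `|dF a b (w i) d - ip (w i) d - (dF a b (w j) d - ip (w j) d)| <= e3.
    apply: le_trans beL; rewrite -ler_sqr ?nnegrE ?mulr_ge0 ?(si_ge0 hbe) ?(ltW L0)//.
    by rewrite real_normK ?num_real// exprMn; exact: dG.
  split; last first.
    apply: le_trans beij _; rewrite /e3 -mulrA ger_pMr// -invfM invf_le1 ?mulr_gt0//; lra.
  have := dFd i i1; have := dFd j j1; move: Gd.
  have -> : ip d d = ip (w i) d - ip (w j) d by rewrite {1}/d (siDl hip) (siNl hip).
  have -> : e = e3 + e3 + e3 by rewrite /e3; field.
  rewrite !ler_norml; lra.
have [u uP] := lf_complete lf cw.
exists u; split=> [h|e e0]; last first.
  have [n0 n0P] := uP e e0; exists (w n0).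
  by have [? ?] := n0P n0 (leqnn _); have [? _ _ _] := wP n0.
apply: (@eq0_of_sqr_le _ _ (3 * (ip h h + ip h h + L ^+ 2 * be h h))) => e e0.
have [n0 n0P] := uP e e0; have [n1 n1P] := invS_lt_eventually e0.
pose n := maxn n0 n1.
have [ipn ben] := n0P n (leq_maxl _ _).
have iph := si_ge0 hip h; have beh := si_ge0 hbe h.
have h1 : dF a b (w n) h ^+ 2 <= e * ip h h.
  have [_ _ _ /(_ h) /le_trans] := wP n; apply.
  by rewrite ler_wpM2r//; apply: n1P; exact: leq_maxr.
have h2 : ip (w n - u) h ^+ 2 <= e * ip h h.
  by apply: le_trans (si_CauchySchwarz hip _ _) _; rewrite ler_wpM2r.
have h3 := dG u (w n) h.
have {}h3 : (dF a b u h - ip u h - (dF a b (w n) h - ip (w n) h)) ^+ 2 <= e * (L ^+ 2 * be h h).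
  apply: le_trans h3 _; rewrite [leLHS]mulrCA ler_wpM2r ?(mulr_ge0 (sqr_ge0 L) beh)//.
  by rewrite (siBC hbe).
have -> : dF a b u h = dF a b (w n) h - ip (w n - u) h +
    (dF a b u h - ip u h - (dF a b (w n) h - ip (w n) h)).
  by rewrite (siDl hip) (siNl hip); ring.
move: h1 h2 h3; set x := dF a b (w n) h; set y := ip _ h; set z := _ - _ - _.
have := sqr_ge0 (x + y); have := sqr_ge0 (x - z); have := sqr_ge0 (y + z).
nra.
Qed.

Definition Eig (la : R) u := forall v, ip u v = la * be u v.

Lemma Eig_lin la t u v : Eig la u -> Eig la v -> Eig la (t *: u + v).
Proof. by move=> hu hv w; rewrite !(siE hip) !(siE hbe) hu hv; ring. Qed.

Lemma Eig0 la : Eig la 0.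
Proof. by move=> w; rewrite (si0l hip) (si0l hbe) mulr0. Qed.

Lemma dF_eig la u h : dF la la u h = ip u h - la * be u h.
Proof.
rewrite [in be u h](lf_sub lf u) (siDl hbe) (siNl hbe) /dF; ring.
Qed.

Lemma Eig_closed la u : (forall e : R, 0 < e -> exists v,
    [/\ Eig la v, ip (v - u) (v - u) <= e & be (v - u) (v - u) <= e]) -> Eig la u.
Proof.
move=> H w; apply/eqP; rewrite -subr_eq0; apply/eqP.
apply: (@eq0_of_sqr_le _ _ (2 * (ip w w + la ^+ 2 * be w w))) => e e0.
have [v [Ev ipv bev]] := H e e0.
have := si_CauchySchwarz hip (v - u) w; have := si_CauchySchwarz hbe (v - u) w.
have iph := si_ge0 hip w; have beh := si_ge0 hbe w.
have -> : ip u w - la * be u w = la * be (v - u) w - ip (v - u) w.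
  by rewrite (siDl hip) (siDl hbe) (siNl hip) (siNl hbe) Ev; ring.
set x := be (v - u) w; set y := ip (v - u) w => hx hy.
have hx' : x ^+ 2 <= e * be w w by apply: le_trans hx _; rewrite ler_wpM2r.
have hy' : y ^+ 2 <= e * ip w w by apply: le_trans hy _; rewrite ler_wpM2r.
have : la ^+ 2 * x ^+ 2 <= la ^+ 2 * (e * be w w) by rewrite ler_wpM2l ?sqr_ge0.
have := sqr_ge0 (la * x + y).
nra.
Qed.

(** A sequence minimizing the distance to the eigenspace is Cauchy for [ip] by the parallelogram
    law, and for [be] as well since [be] is [ip / la] there; hence the minimum of k and la * k
    below. *)
Lemma Eig_proj (la : R) u : 0 < la ->
  exists2 e, Eig la e & forall h, Eig la h -> ip (u - e) h = 0.
Proof.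
move=> la0.
pose S := [set ip (u - e) (u - e) | e in [set e | Eig la e]].
have S0 : has_inf S.
  split; first by exists (ip (u - 0) (u - 0)), 0 => //=; exact: Eig0.
  by exists 0 => _ [e _ <-]; exact: si_ge0.
have Sinf e : Eig la e -> inf S <= ip (u - e) (u - e).
  by move=> Ee; apply: ge_inf; [exact: S0.2|exists e].
have /choice[e_ e_P] n : exists e, Eig la e /\ ip (u - e) (u - e) <= inf S + n.+1%:R^-1.
  have [|_ [e Ee <-] eS] := @inf_adherent _ S n.+1%:R^-1 _ S0; first by rewrite invr_gt0.
  by exists e; split=> //; exact: ltW.
have eE la' e : Eig la' e -> ip e e = la' * be e e by move=> ->.
have [|e eP] := lf_complete lf (u := e_).
  move=> k k0; pose k' := Num.min k (la * k).
  have k'0 : 0 < k' by rewrite lt_min k0 mulr_gt0.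
  have [|n0 n0P] := @invS_lt_eventually R (k' / 4); first by rewrite divr_gt0.
  exists n0 => i j i0 j0.
  have ipij : ip (e_ i - e_ j) (e_ i - e_ j) <= k'.
    have [Ei ei] := e_P i; have [Ej ej] := e_P j.
    (* The midpoint is a competitor, and its distance to u enters the parallelogram identity. *)
    have Em : Eig la (2^-1 *: e_ i + 2^-1 *: e_ j).
      by apply: Eig_lin => //; rewrite -[_ *: _]addr0; apply: Eig_lin => //; exact: Eig0.
    have := Sinf _ Em; have := n0P i i0; have := n0P j j0; move: ei ej.
    rewrite !(siE hip) (siC hip (e_ i) u) (siC hip (e_ j) u) (siC hip (e_ j) (e_ i)).
    move: (i.+1%:R^-1) (j.+1%:R^-1) (inf S) => x y z; lra.
  have Eij : Eig la (e_ i - e_ j).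
    have [Ei _] := e_P i; have [Ej _] := e_P j.
    by rewrite addrC -scaleN1r; exact: Eig_lin.
  split; first by apply: le_trans ipij _; rewrite ge_min lexx.
  rewrite -(ler_pM2l la0) -eE//; apply: le_trans ipij _.
  by rewrite ge_min lexx orbT.
have Ee : Eig la e.
  apply: Eig_closed => k /eP[n0 n0P]; exists (e_ n0).
  by have [? ?] := n0P n0 (leqnn _); have [? _] := e_P n0.
exists e => // h Eh.
apply: (@eq0_of_sqr_le _ _ (4 * ip h h)) => k k0.
have [n0 n0P] := eP k k0; have [n1 n1P] := invS_lt_eventually k0.
pose n := maxn n0 n1.
have [ipn _] := n0P n (leq_maxl _ _).
have [En en] := e_P n; have nk := n1P n (leq_maxr _ _).
have iph := si_ge0 hip h.
have h1 : ip (u - e_ n) h ^+ 2 <= k * ip h h.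
  apply: sqr_le_of_quadratic => //; first exact: ltW.
  move=> t; have := Sinf _ (Eig_lin t Eh En).
  have -> : u - (t *: h + e_ n) = (u - e_ n) - t *: h by rewrite opprD addrA addrAC.
  move: en; move: (u - e_ n) => w.
  rewrite !(siE hip) (siC hip h w).
  move: nk; move: (n.+1%:R^-1) (inf S) => x y; lra.
have h2 : ip (e_ n - e) h ^+ 2 <= k * ip h h.
  by apply: le_trans (si_CauchySchwarz hip _ _) _; rewrite ler_wpM2r.
have -> : ip (u - e) h = ip (u - e_ n) h + ip (e_ n - e) h.
  by rewrite !(siE hip); ring.
have := sqr_ge0 (ip (u - e_ n) h - ip (e_ n - e) h).
nra.
Qed.

End spectral.

(** * Orthogonal decomposition, spectral gap and sign of eigenfunctions *)

Section eigen_decomposition.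
Context {R : realType} {V : lmodType R} {ip be : V -> V -> R} {pos : V -> V}.
Hypothesis lf : lattice_forms ip be pos.
Let hip := lf_ip lf.
Let hbe := lf_be lf.
Implicit Types (u v w h e : V) (a b t : R).
Local Notation dF := (dF ip be pos).
Local Notation II := (II ip be pos).
Local Notation Eig := (@Eig R V ip be).

Variable lam : nat -> R.
Hypothesis lam1_gt0 : 0 < lam 1%N.
Hypothesis lam_lt : forall i j, (0 < i < j)%N -> lam i < lam j.
Hypothesis lamP : forall la, (exists2 u, be u u != 0 & Eig la u) <->
  exists2 j, (0 < j)%N & la = lam j.

Lemma lam_le i j : (0 < i)%N -> (i <= j)%N -> lam i <= lam j.
Proof.
move=> i0; rewrite leq_eqVlt => /predU1P[->//|ij].
by apply/ltW/lam_lt; rewrite i0.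
Qed.

Lemma lam_gt0 j : (0 < j)%N -> 0 < lam j.
Proof. by move=> j0; apply: lt_le_trans (lam_le _ j0). Qed.

Lemma Eig_orth i j u v : (0 < i)%N -> (0 < j)%N -> i != j ->
  Eig (lam i) u -> Eig (lam j) v -> be u v = 0 /\ ip u v = 0.
Proof.
move=> i0 j0 ij Eu Ev.
have be0 : be u v = 0.
  have := Eu v; rewrite (siC hip) Ev (siC hbe v u) => /eqP.
  rewrite -subr_eq0 -mulrBl mulf_eq0 => /orP[|/eqP//].
  rewrite subr_eq0 => /eqP lij.
  by case: (ltngtP i j) ij => // h _; have := lam_lt (i := _) (j := _) (introT andP (conj _ h));
    rewrite lij ltxx => /(_ ltac:(done)).
by split=> //; rewrite Eu be0 mulr0.
Qed.

Definition Nn (k : nat) u := exists2 f : nat -> V,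
  forall j, (1 <= j <= k)%N -> Eig (lam j) (f j) & u = \sum_(1 <= j < k.+1) f j.

Definition Mm (k : nat) w := forall v, Nn k v -> ip w v = 0.

Lemma Nn0 u : Nn 0 u <-> u = 0.
Proof.
split=> [[f _ ->]|->]; first by rewrite big_geq.
by exists (fun=> 0); [case|rewrite big_geq].
Qed.

Lemma NnS k u : Nn k.+1 u <-> exists v e, [/\ Nn k v, Eig (lam k.+1) e & u = v + e].
Proof.
split=> [[f fE ->]|[v [e [[f fE ->] Ee ->]]]].
  exists (\sum_(1 <= j < k.+1) f j), (f k.+1); split.
  - by exists f => // j /andP[j1 jk]; apply: fE; rewrite j1 leqW.
  - by apply: fE; rewrite leqnn.
  - by rewrite big_nat_recr.
exists (fun j => if j == k.+1 then e else f j).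
  move=> j /andP[j1]; rewrite leq_eqVlt => /predU1P[->|jk]; first by rewrite eqxx.
  by rewrite ltn_eqF//; apply: fE; rewrite j1.
rewrite [RHS]big_nat_recr//= eqxx; congr (_ + _); apply: eq_big_nat => j /andP[_ jk].
by rewrite ltn_eqF.
Qed.

Lemma Nn_lin k t u v : Nn k u -> Nn k v -> Nn k (t *: u + v).
Proof.
elim: k u v => [|k IH] u v.
  by move=> /Nn0 -> /Nn0 ->; apply/Nn0; rewrite scaler0 addr0.
move=> /NnS[u1 [e1 [Nu Ee1 ->]]] /NnS[v1 [e2 [Nv Ee2 ->]]]; apply/NnS.
exists (t *: u1 + v1), (t *: e1 + e2); split; [exact: IH|exact: (Eig_lin lf)|].
by rewrite scalerDr addrACA.
Qed.

Lemma Nn_zero k : Nn k 0.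
Proof.
elim: k => [|k IH]; first exact/Nn0.
by apply/NnS; exists 0, 0; split; [|exact: (Eig0 lf)|rewrite addr0].
Qed.

Lemma Eig_Nn j k e : (0 < j <= k)%N -> Eig (lam j) e -> Nn k e.
Proof.
elim: k => [|k IH]; first by case: j.
move=> /andP[j0]; rewrite leq_eqVlt => /predU1P[->|jk] Ee; apply/NnS.
  by exists 0, e; split=> //; [exact: Nn_zero|rewrite add0r].
by exists e, 0; split; [apply: IH => //; rewrite j0|exact: (Eig0 lf)|rewrite addr0].
Qed.

Lemma NnW k u : Nn k u -> Nn k.+1 u.
Proof. by move=> Nu; apply/NnS; exists u, 0; split=> //; [exact: (Eig0 lf)|rewrite addr0]. Qed.

Lemma Nn_Eig_orth k j v e : (k < j)%N -> Nn k v -> Eig (lam j) e ->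
  be v e = 0 /\ ip v e = 0.
Proof.
elim: k v => [|k IH] v kj; first by move=> /Nn0 -> _; rewrite (si0l hbe) (si0l hip).
move=> /NnS[v1 [e1 [Nv Ee1 ->]]] Ee; rewrite (siDl hbe) (siDl hip).
have [-> ->] := IH v1 (ltnW kj) Nv Ee.
have ne : k.+1 != j by rewrite ltn_eqF.
have [-> ->] := Eig_orth (isT : (0 < k.+1)%N) (leq_trans (isT : (0 < k.+2)%N) kj) ne Ee1 Ee.
by rewrite !addr0.
Qed.

Lemma Nn_le k v : Nn k v -> ip v v <= lam k * be v v.
Proof.
elim: k v => [|k IH] v; first by move=> /Nn0 ->; rewrite (si0l hip) (si0l hbe) mulr0.
move=> /NnS[v1 [e [Nv Ee ->]]]; have [be0 ip0] := Nn_Eig_orth (ltnSn k) Nv Ee.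
rewrite (siD_orth hip ip0) (siD_orth hbe be0) mulrDr Ee lerD2r.
apply: le_trans (IH _ Nv) _; case: k {IH} Nv Ee => [|k] Nv Ee.
  by move/Nn0 : Nv => ->; rewrite (si0l hbe) !mulr0.
by rewrite ler_wpM2r ?(si_ge0 hbe)//; apply: lam_le.
Qed.

Lemma Mm_be k w v : Mm k w -> Nn k v -> be w v = 0.
Proof.
move=> Mw; elim: k Mw v => [|k IH] Mw v; first by move=> /Nn0 ->; rewrite (si0r hbe).
move=> /NnS[v1 [e [Nv Ee ->]]]; rewrite (siDr hbe) IH//; last by move=> x /NnW /Mw.
have := Mw e (Eig_Nn _ Ee); rewrite (siC hip) Ee ltnS leqnn => /(_ isT)/eqP.
by rewrite mulf_eq0 gt_eqF ?lam_gt0//= => /eqP; rewrite (siC hbe) => ->; rewrite addr0.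
Qed.

Lemma Mm_lin k t u v : Mm k u -> Mm k v -> Mm k (t *: u + v).
Proof. by move=> Mu Mv w Nw; rewrite (siDl hip) (siZl hip) Mu// Mv// mulr0 addr0. Qed.

Lemma Mm_zero k : Mm k 0.
Proof. by move=> w _; rewrite (si0l hip). Qed.

Lemma MmW k w : Mm k.+1 w -> Mm k w.
Proof. by move=> Mw v /NnW /Mw. Qed.

Lemma Eig_Mm k e : Eig (lam k.+1) e -> Mm k e.
Proof. by move=> Ee v Nv; rewrite (siC hip); have [] := Nn_Eig_orth (ltnSn k) Nv Ee. Qed.

Lemma Nn_Mm_decomp k u : exists v w, [/\ Nn k v, Mm k w & u = v + w].
Proof.
elim: k u => [|k IH] u.
  exists 0, u; split; [exact/Nn0|by move=> v /Nn0 ->; rewrite (si0r hip)|by rewrite add0r].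
have [v [w [Nv Mw ->]]] := IH u.
have [e Ee eP] := Eig_proj lf w (lam_gt0 (isT : (0 < k.+1)%N)).
exists (v + e), (w - e); split; last by rewrite -addrA (addrC e) subrK.
  by apply/NnS; exists v, e.
move=> x /NnS[x1 [e1 [Nx1 Ee1 ->]]]; rewrite (siDr hip) (eP e1 Ee1) addr0 (siDl hip) (siNl hip).
by rewrite Mw// (Eig_Mm Ee)// subr0.
Qed.

(* The infimum of the Rayleigh quotient over M_k is attained, hence an
   eigenvalue; its eigenfunction is not in N_k. *)
Lemma Mm_gap k w : Mm k w -> lam k.+1 * be w w <= ip w w.
Proof.
move=> Mw; rewrite leNgt; apply/negP => w_lt.
have lk0 : 0 < lam k.+1 by exact: lam_gt0.
have bw0 : 0 < be w w.
  rewrite lt_neqAle (si_ge0 hbe) andbT eq_sym; apply: contraTneq w_lt => ->.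
  by rewrite mulr0 -leNgt (si_ge0 hip).
pose S := [set ip v v | v in [set v | Mm k v /\ be v v = 1]].
have nrm v : 0 < be v v -> Mm k v ->
    Mm k ((Num.sqrt (be v v))^-1 *: v) /\
    be ((Num.sqrt (be v v))^-1 *: v) ((Num.sqrt (be v v))^-1 *: v) = 1 /\
    ip ((Num.sqrt (be v v))^-1 *: v) ((Num.sqrt (be v v))^-1 *: v) = (be v v)^-1 * ip v v.
  move=> bv Mv; split; first by rewrite -[_ *: _]addr0; apply: Mm_lin => //; exact: Mm_zero.
  rewrite !(siE hbe) !(siE hip) !mulrA -invfM -expr2 sqr_sqrtr ?(ltW bv)//.
  by rewrite mulVf// gt_eqF.
have S0 : has_inf S.
  split; last by exists 0 => _ [v _ <-]; exact: si_ge0.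
  by have [M1 [b1 i1]] := nrm w bw0 Mw; exists (ip ((Num.sqrt (be w w))^-1 *: w) ((Num.sqrt (be w w))^-1 *: w)),
    ((Num.sqrt (be w w))^-1 *: w).
pose rho := inf S.
have rho0 : 0 <= rho.
  by apply: lb_le_inf; [exact: S0.1|move=> _ [v _ <-]; exact: si_ge0].
have rhoP v : Mm k v -> rho * be v v <= ip v v.
  move=> Mv; have := si_ge0 hbe v; rewrite le_eqVlt => /predU1P[<-|bv0].
    by rewrite mulr0 (si_ge0 hip).
  have [M1 [b1 i1]] := nrm v bv0 Mv.
  have : rho <= (be v v)^-1 * ip v v.
    by rewrite -i1; apply: ge_inf; [exact: S0.2|exists ((Num.sqrt (be v v))^-1 *: v)].
  by rewrite mulrC ler_pdivlMr.
have rho_lt : rho < lam k.+1.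
  have [M1 [b1 i1]] := nrm w bw0 Mw.
  apply: (@le_lt_trans _ _ ((be w w)^-1 * ip w w)).
    by rewrite -i1; apply: ge_inf; [exact: S0.2|exists ((Num.sqrt (be w w))^-1 *: w)].
  by rewrite mulrC ltr_pdivrMr.
have [u [uE uA]] : exists u, (forall h, dF rho rho u h = 0) /\
    forall e : R, 0 < e -> exists v, [/\ Mm k v /\ be v v = 1, ip (v - u) (v - u) <= e &
      be (v - u) (v - u) <= e].
  apply: (palais_smale lf (K := rho + 1)) => e e0.
  pose e1 := Num.min e 1.
  have e10 : 0 < e1 by rewrite lt_min e0 ltr01.
  have [_ [v [Mv bv1] <-] vlt] := inf_adherent e10 S0.
  have vK : ip v v <= rho + e1 by exact: ltW.
  exists v; split=> //; first by apply: le_trans vK _; rewrite lerD2l ge_min lexx orbT.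
    by rewrite bv1 lerDr.
  (* The differential at v in M_k vanishes along N_k; along M_k it is small because v almost
     minimizes the quotient among the v - t m. *)
  move=> h; rewrite (dF_eig lf); have [n [m [Nn1 Mm1 ->]]] := Nn_Mm_decomp k h.
  have ipmn : ip n m = 0 by rewrite (siC hip) Mm1.
  rewrite (siD_orth hip ipmn) !(siE hip) !(siE hbe) (Mv n Nn1) (Mm_be Mv Nn1) !add0r.
  apply: (@le_trans _ _ (e1 * ip m m)).
    apply: sqr_le_of_quadratic; [exact: ltW|exact: si_ge0|move=> t].
    have := rhoP _ (Mm_lin (- t) Mm1 Mv).
    have := mulr_ge0 (sqr_ge0 t) (mulr_ge0 rho0 (si_ge0 hbe m)).
    rewrite !(siE hip) !(siE hbe) (siC hip m v) (siC hbe m v) bv1.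
    move: vK; rewrite -/rho; move: e1 {e10 vlt} => e1; lra.
  apply: ler_pM; rewrite ?(ltW e10) ?(si_ge0 hip) ?ge_min ?lexx//.
  by rewrite lerDr (si_ge0 hip).
have Eu : Eig rho u.
  by move=> h; have := uE h; rewrite (dF_eig lf) => /eqP; rewrite subr_eq0 => /eqP.
have bu0 : be u u != 0.
  have [|v [[_ v1] _ vu]] := uA 4^-1; first by rewrite invr_gt0.
  apply/eqP => bu; have := siB_le hbe (v - u) (- u).
  rewrite opprK subrK v1 (siNl hbe) (siNr hbe) opprK bu; lra.
have [j j0 rj] : exists2 j, (0 < j)%N & rho = lam j by apply/lamP; exists u.
(* As rho < lam k.+1, the eigenvalue rho is one of the first k, so u lies in N_k while being a limit
   of elements of M_k: it is orthogonal to itself. *)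
have jk : (j <= k)%N.
  rewrite leqNgt; apply/negP => kj; move: rho_lt; rewrite rj ltNge lam_le//.
have Nu : Nn k u by apply: (@Eig_Nn j); rewrite ?j0//; rewrite -rj.
have ip0 : ip u u = 0.
  apply: (@eq0_of_sqr_le _ _ (ip u u)) => e e0.
  have [v [[Mv _] vu _]] := uA e e0.
  rewrite [X in X ^+ 2](_ : _ = ip (u - v) u); last by rewrite (siDl hip) (siNl hip) Mv// subr0.
  apply: le_trans (si_CauchySchwarz hip _ _) _.
  by rewrite ler_wpM2r ?(si_ge0 hip)// (siBC hip).
move/eqP : ip0; rewrite Eu mulf_eq0 (negbTE bu0) orbF rj.
by rewrite gt_eqF// lam_gt0.
Qed.

Lemma poincare u : lam 1%N * be u u <= ip u u.
Proof. by apply: (@Mm_gap 0) => v /Nn0 ->; rewrite (si0r hip). Qed.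

(** Testing the equation with u^+ gives ip(u^+, u^-) = ip(u^+, u^+) - lam_1 be(u^+, u^+), which is
    nonnegative by the Poincare inequality; nonlocality forbids this unless one part is null. *)
Lemma first_eigenfunction_sign u : Eig (lam 1%N) u ->
  be (pos u) (pos u) = 0 \/ be (pos (- u)) (pos (- u)) = 0.
Proof.
move=> Eu; apply: (lf_sign lf); first exact: (lf_orth lf).
have := Eu (pos u); rewrite {1}(lf_sub lf u) (siDl hip) (siNl hip) (siC hbe u) (be_posl lf).
rewrite (siC hip (pos (- u))).
have := poincare (pos u); lra.
Qed.

(* Such a u would be orthogonal to an eigenfunction for lam 1, while neither
   changes sign. *)
Lemma eigenfunction_changes_sign k u : (1 < k)%N -> Eig (lam k) u ->
  be (pos u) (pos u) = 0 -> be u u = 0.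
Proof.
move=> k1 Eu pu0.
have [e be0 Ee] : exists2 e, be e e != 0 & Eig (lam 1%N) e by apply/lamP; exists 1%N.
wlog pe0 : e be0 Ee / be (pos e) (pos e) = 0.
  have [p0|p0] := first_eigenfunction_sign Ee; first by move=> /(_ e be0 Ee p0).
  apply; last exact: p0; first by rewrite !(siE hbe) opprK.
  by rewrite -[- e]addr0 -scaleN1r; apply: (Eig_lin lf) => //; exact: (Eig0 lf).
have null x v : be x x = 0 -> ip x v = 0 /\ be x v = 0.
  by move=> x0; rewrite (si_null hbe) // (si_null hip)//; exact: (lf_null lf).
have k1' : k != 1%N by rewrite gtn_eqF.
have [bue iue] := Eig_orth (ltnW k1) (isT : (0 < 1)%N) k1' Eu Ee.
have posNE x : pos (- x) = pos x - x by rewrite [X in _ - X](lf_sub lf x) opprB addrC subrK.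
(* When x^+ is null, x^- equals -x up to a null vector, so the orthogonality of u and e passes to
   u^- and e^-, and [lf_sign] applies to them. *)
have Z0 x y : be (pos x) (pos x) = 0 -> be (pos y) (pos y) = 0 ->
    be (pos (- x)) (pos (- y)) = be x y /\ ip (pos (- x)) (pos (- y)) = ip x y.
  move=> x0 y0; have [ix bx] := null _ (pos y - y) x0; have [iy by0] := null _ x y0.
  rewrite !posNE (siDl hip) (siDl hbe) ix bx !add0r !(siE hip) !(siE hbe).
  by rewrite (siC hip x) iy (siC hbe x) by0; split; ring.
have [bz iz] := Z0 u e pu0 pe0.
have [|||] := lf_sign lf (u := - u) (v := - e); rewrite ?bz ?iz ?iue//.
- by move=> h; rewrite (be_sqr lf) pu0 h addr0.
- by move=> h; move/eqP: be0; rewrite (be_sqr lf e) pe0 h addr0.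
Qed.

End eigen_decomposition.

(** * Curves bounding a monotone region *)

Section extremal_curve.
Context {R : realType}.
Implicit Types (sg a b al om : R) (J : set R) (P S Sol : R -> R -> Prop).

(* P is a closed region of the square J x J, with interior S, which is stable
   under decreasing both coordinates (increasing them if sg = -1). *)
Record monotone_region sg J P S Sol : Prop := MonotoneRegion {
  mr_strict : forall a b a' b', J a -> J b -> J a' -> J b' -> P a b ->
    0 <= sg * (a - a') -> 0 <= sg * (b - b') -> (a, b) != (a', b') -> S a' b';
  mr_closed : forall a b, J a -> J b -> ~ P a b ->
    exists2 eta : R, 0 < eta & forall a' b',
      `|a' - a| <= eta -> `|b' - b| <= eta -> ~ P a' b';
  mr_open : forall a b, J a -> J b -> S a b ->
    exists2 eta : R, 0 < eta & forall a' b',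
      `|a' - a| <= eta -> `|b' - b| <= eta -> S a' b';
  mr_sub : forall a b, S a b -> P a b;
  mr_boundary : forall a b, J a -> J b -> P a b -> ~ S a b -> Sol a b;
  mr_interior : forall a b, J a -> J b -> Sol a b -> ~ S a b }.

(** Reflection through the origin exchanges infima and suprema; the facts on [inf_curve] are deduced
    in this way from those on [sup_curve]. *)
Lemma monotone_regionN sg J P S Sol : monotone_region sg J P S Sol ->
  monotone_region (- sg) [set a | J (- a)] (fun a b => P (- a) (- b))
    (fun a b => S (- a) (- b)) (fun a b => Sol (- a) (- b)).
Proof.
have opp_close (x y : R) : `|- x - - y| = `|x - y| by rewrite opprK addrC distrC.
case=> strict closed open sub bd int; split=> /=.
- move=> a b a' b' Ja Jb Ja' Jb' Pab aa bb ab; apply: (strict (- a) (- b)) => //.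
  + by move: aa; rewrite mulNr -mulrN opprD.
  + by move: bb; rewrite mulNr -mulrN opprD.
  + by apply: contra ab => /eqP[/oppr_inj -> /oppr_inj ->].
- move=> a b Ja Jb nP; have [eta e0 eP] := closed _ _ Ja Jb nP; exists eta => // a' b' aa bb.
  by apply: eP; rewrite opp_close.
- move=> a b Ja Jb nP; have [eta e0 eP] := open _ _ Ja Jb nP; exists eta => // a' b' aa bb.
  by apply: eP; rewrite opp_close.
- by move=> a b; exact: sub.
- by move=> a b Ja Jb; exact: bd.
- by move=> a b Ja Jb; exact: int.
Qed.

Definition sup_curve J P a : \bar R := ereal_sup [set b%:E | b in J `&` [set b | P a b]].
Definition inf_curve J P a : \bar R := ereal_inf [set b%:E | b in J `&` [set b | P a b]].

Section sup_curve.
Variables (al om : R).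
Let J : set R := [set a | al < a < om].
Variables (P S Sol : R -> R -> Prop).
Hypothesis rg : monotone_region 1 J P S Sol.
Local Notation nu := (sup_curve J P).

Lemma sup_curve_ge a b : J b -> P a b -> (b%:E <= nu a)%E.
Proof. by move=> Jb Pab; apply: ereal_sup_ubound; exists b. Qed.

Lemma sup_curve_le a : (nu a <= om%:E)%E.
Proof.
apply: ge_ereal_sup => _ [b [/andP[_ b_lt] _] <-].
by rewrite lee_fin ltW.
Qed.

Lemma sup_curve_lt a b : J a -> J b -> (b%:E < nu a)%E -> S a b.
Proof.
move=> Ja Jb /ereal_sup_gt[_ [b' [Jb' Pab'] <-]]; rewrite lte_fin => bb'.
apply: (mr_strict rg Ja Jb') => //; rewrite ?subrr ?mulr0// ?mul1r ?subr_ge0 ?(ltW bb')//.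
by apply/eqP => -[bE]; move: bb'; rewrite bE ltxx.
Qed.

Lemma sup_curve_gt a b : J a -> J b -> S a b -> (b%:E < nu a)%E.
Proof.
move=> Ja Jb Sab; have [eta e0 eP] := mr_open rg Ja Jb Sab; have /andP[b1 b2] := Jb.
pose d := Num.min eta ((om - b) / 2).
have d0 : 0 < d by rewrite lt_min e0 divr_gt0// subr_gt0.
have d1 : d <= (om - b) / 2 by rewrite ge_min lexx orbT.
have Jd : J (b + d) by apply/andP; split; lra.
apply: (@lt_le_trans _ _ (b + d)%:E); first by rewrite lte_fin ltrDl.
apply: sup_curve_ge => //; apply: (mr_sub rg); apply: eP.
  by rewrite subrr normr0 ltW.
by rewrite addrAC subrr add0r gtr0_norm// ge_min lexx.
Qed.

Lemma sup_curve_in a b : J a -> J b -> nu a = b%:E -> P a b /\ ~ S a b.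
Proof.
move=> Ja Jb nuE; split; last by move=> /(sup_curve_gt Ja Jb); rewrite nuE ltxx.
apply: contrapT => nP; have [eta e0 eP] := mr_closed rg Ja Jb nP.
have : ((b - eta)%:E < nu a)%E by rewrite nuE lte_fin ltrBlDr ltrDl.
move=> /ereal_sup_gt[_ [b' [Jb' Pab'] <-]]; rewrite lte_fin => bb'.
have : (b'%:E <= nu a)%E by exact: sup_curve_ge.
rewrite nuE lee_fin => b'b; apply: (eP a b') => //; first by rewrite subrr normr0 ltW.
rewrite distrC ger0_norm ?subr_ge0//; lra.
Qed.

(** A point of P above a2 moves into S above a1, and S is open, so it lies strictly below the curve
    at a1. A value b inside J is where the strict gap appears; at the end om the curve can be
    constant. *)
Lemma sup_curve_decreasing a1 a2 b : J a1 -> J a2 -> J b -> a1 < a2 ->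
  nu a1 = b%:E \/ nu a2 = b%:E -> (nu a2 < nu a1)%E.
Proof.
move=> J1 J2 Jb a12.
have st b' : J b' -> P a2 b' -> (b'%:E < nu a1)%E.
  move=> Jb' P2; apply: sup_curve_gt => //.
  apply: (mr_strict rg J2 Jb') => //; rewrite ?subrr ?mulr0// ?mul1r ?subr_ge0 ?(ltW a12)//.
  by apply/eqP => -[aE]; move: a12; rewrite aE ltxx.
case=> nuE; last by rewrite {1}nuE; apply: st => //; case: (sup_curve_in J2 Jb nuE).
rewrite ltNge le_eqVlt nuE; apply/negP => /predU1P[/esym nu2|nu2].
  by have := st b Jb (sup_curve_in J2 Jb nu2).1; rewrite nuE ltxx.
by have := st b Jb (mr_sub rg (sup_curve_lt J2 Jb nu2)); rewrite nuE ltxx.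
Qed.

(** Just below the curve, openness of S gives the lower bound; just above it, closedness of P gives
    the upper one. If the value is om there is no room above in J, and nu <= om everywhere. *)
Lemma sup_curve_continuous a : J a -> nu a \is a fin_num -> {for a, continuous nu}.
Proof.
move=> Ja fin; rewrite /prop_for /continuous_at.
have [y yE] : exists y, nu a = y%:E by exists (fine (nu a)); rewrite fineK.
have y_al : al < y.
  move: fin; rewrite fin_numElt => /andP[/ereal_sup_gt[_ [b [Jb Pab] <-]] _ _].
  by have := sup_curve_ge Jb Pab; rewrite yE lee_fin; apply: lt_le_trans; case/andP: Jb.
have y_om : y <= om by have := sup_curve_le a; rewrite yE lee_fin.
have close (eta : R) : 0 < eta -> \forall a' \near a, `|a' - a| <= eta.
  move=> e0; apply/nbhs_ballP; exists eta => // a' /=.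
  by rewrite /ball/= distrC => /ltW.
have nearJ : \forall a' \near a, J a'.
  have /andP[a_al a_om] := Ja.
  near=> a'; have : `|a' - a| <= Num.min (a - al) (om - a) / 2.
    by near: a'; apply: close; rewrite divr_gt0// lt_min !subr_gt0 a_al.
  have m1 : Num.min (a - al) (om - a) <= a - al by rewrite ge_min lexx.
  have m2 : Num.min (a - al) (om - a) <= om - a by rewrite ge_min lexx orbT.
  rewrite ler_norml => /andP[h1 h2]; apply/andP; split; lra.
have bounds (e : R) : 0 < e -> \forall a' \near a, ((y - e)%:E <= nu a' <= (y + e)%:E)%E.
  move=> e0.
  have low : \forall a' \near a, ((y - e)%:E <= nu a')%E.
    pose b := y - Num.min e (y - al) / 2.
    have m0 : 0 < Num.min e (y - al) by rewrite lt_min e0 subr_gt0.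
    have m1 : Num.min e (y - al) <= e by rewrite ge_min lexx.
    have m2 : Num.min e (y - al) <= y - al by rewrite ge_min lexx orbT.
    have Jb : J b by apply/andP; split; rewrite /b; lra.
    have [|eta e1 eP] := mr_open rg Ja Jb.
      by apply: sup_curve_lt => //; rewrite yE lte_fin /b; lra.
    near=> a'; apply: (@le_trans _ _ b%:E); first by rewrite lee_fin /b; lra.
    apply: sup_curve_ge => //; apply: (mr_sub rg); apply: eP; last first.
      by rewrite subrr normr0 ltW.
    by near: a'; exact: close.
  have upp : \forall a' \near a, (nu a' <= (y + e)%:E)%E.
    have [y_lt|y_ge] := ltP y om; last first.
      near=> a'; apply: le_trans (sup_curve_le a') _; rewrite lee_fin; lra.
    pose b := y + Num.min e (om - y) / 2.
    have m0 : 0 < Num.min e (om - y) by rewrite lt_min e0 subr_gt0.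
    have m1 : Num.min e (om - y) <= e by rewrite ge_min lexx.
    have m2 : Num.min e (om - y) <= om - y by rewrite ge_min lexx orbT.
    have Jb : J b by apply/andP; split; rewrite /b; lra.
    have [|eta e1 eP] := mr_closed rg Ja Jb.
      by move=> /(sup_curve_ge Jb); rewrite yE lee_fin /b; lra.
    near=> a'; apply: (@le_trans _ _ b%:E); last by rewrite lee_fin /b; lra.
    have aa : `|a' - a| <= eta by near: a'; exact: close.
    have Ja' : J a' by near: a'.
    rewrite leNgt; apply/negP => /(sup_curve_lt Ja' Jb)/(mr_sub rg).
    by apply: eP => //; rewrite subrr normr0 ltW.
  by near=> a'; apply/andP; split; near: a'.
rewrite yE; apply/fine_cvgP; split.
  near=> a'; have : ((y - 1)%:E <= nu a' <= (y + 1)%:E)%E by near: a'; exact: bounds.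
  move=> /andP[h1 h2]; rewrite fin_numElt (lt_le_trans _ h1) ?ltNyr//.
  by rewrite (le_lt_trans h2) ?ltry.
apply/cvgrPdist_le => e e0; near=> a'.
have : ((y - e)%:E <= nu a' <= (y + e)%:E)%E by near: a'; exact: bounds.
move=> /andP[h1 h2]; rewrite /= -lee_fin.
have f : nu a' \is a fin_num.
  by rewrite fin_numElt (lt_le_trans _ h1) ?ltNyr// (le_lt_trans h2) ?ltry.
move: h1 h2; rewrite -(fineK f) !lee_fin ler_norml => h1 h2.
apply/andP; split; lra.
Unshelve. all: by end_near. Qed.

Lemma sup_curve_diag c : J c -> P c c -> Sol c c -> nu c = c%:E.
Proof.
move=> Jc Pc Sc; apply/eqP; rewrite eq_le sup_curve_ge// andbT leNgt.
by apply/negP => /(sup_curve_lt Jc Jc); exact: (mr_interior rg).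
Qed.

End sup_curve.

Section inf_curve.
Variables (al om : R).
Let J : set R := [set a | al < a < om].
Variables (P S Sol : R -> R -> Prop).
Hypothesis rg : monotone_region (- 1) J P S Sol.
Local Notation mu := (inf_curve J P).

Let J' : set R := [set a | - om < a < - al].
Let JN a : J' (- a) = J a.
Proof. by rewrite /J /J'/= !ltrN2 andbC. Qed.
Let P' a b := P (- a) (- b).

Let rg' : monotone_region 1 J' P' (fun a b => S (- a) (- b)) (fun a b => Sol (- a) (- b)).
Proof.
have := monotone_regionN rg; rewrite opprK.
by have -> : [set a | J (- a)] = J' by apply/funext => a; rewrite /= -JN opprK.
Qed.

Let muE a : mu a = (- sup_curve J' P' (- a))%E.
Proof.
rewrite /inf_curve ereal_infEN; congr (- ereal_sup _)%E; apply/seteqP; split.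
  move=> _ [_ [b [Jb Pab] <-] <-]; exists (- b); last by rewrite EFinN.
  by split; rewrite ?JN// /P'/= !opprK.
move=> _ [b [Jb Pab] <-]; exists (- b)%:E; last by rewrite EFinN oppeK.
by exists (- b) => //; split; [rewrite -JN opprK|move: Pab; rewrite /P'/= opprK].
Qed.

Let mu_EFin a b : mu a = b%:E -> sup_curve J' P' (- a) = (- b)%:E.
Proof. by rewrite muE EFinN => <-; rewrite oppeK. Qed.

Lemma inf_curve_gt a b : J a -> J b -> (mu a < b%:E)%E -> S a b.
Proof.
rewrite -!JN muE => Ja Jb; rewrite lteNl -EFinN => /(sup_curve_lt rg' Ja Jb).
by rewrite !opprK.
Qed.

Lemma inf_curve_in a b : J a -> J b -> mu a = b%:E -> P a b /\ ~ S a b.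
Proof.
rewrite -!JN => Ja Jb /mu_EFin /(sup_curve_in rg' Ja Jb).
by rewrite /P' !opprK.
Qed.

Lemma inf_curve_decreasing a1 a2 b : J a1 -> J a2 -> J b -> a1 < a2 ->
  mu a1 = b%:E \/ mu a2 = b%:E -> (mu a2 < mu a1)%E.
Proof.
rewrite -!JN => J1 J2 Jb a12 h; rewrite !muE lteN2.
apply: (sup_curve_decreasing rg' J2 J1 Jb); first by rewrite ltrN2.
by case: h => /mu_EFin h; [right|left].
Qed.

Lemma inf_curve_continuous a : J a -> mu a \is a fin_num -> {for a, continuous mu}.
Proof.
rewrite -JN => Ja; rewrite muE fin_numN => fin.
have -> : mu = (fun a => - sup_curve J' P' (- a))%E by apply/funext => x; rewrite muE.
apply: cvgeN; apply: (cvg_comp (fun x => - x) (sup_curve J' P') (G := nbhs (- a))).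
  exact: cvgN.
exact: (sup_curve_continuous rg').
Qed.

Lemma inf_curve_diag c : J c -> P c c -> Sol c c -> mu c = c%:E.
Proof.
rewrite -JN => Jc Pc Sc; rewrite muE (sup_curve_diag rg' Jc) ?EFinN ?oppeK//.
  by rewrite /P' opprK.
by rewrite opprK.
Qed.

End inf_curve.

End extremal_curve.

(** * Saddle point geometry *)

(** Here q is the mass of one part at a solution, Q that at another point and X their squared
    distance. Either Q stays comparable with q or X is large and concavity pays; the bounds on g are
    those giving g q <= al Q / 2 + c X. *)
Lemma absorb_estimate (R : realFieldType) (g al c l X Q q T : R) :
  0 <= g -> g <= c * l / 2 -> g <= al / 4 -> 0 <= X -> 0 <= Q -> 0 < l ->
  q <= 2 * Q + 2 * (l^-1 * X) -> T <= - c * X -> T - 2^-1 * (al * Q) <= - (g * q).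
Proof.
move=> g0 gc ga X0 Q0 l0 qQ TX.
have h1 := ler_wpM2l g0 qQ.
have h2 := ler_wpM2r Q0 ga.
have lX : 0 <= l^-1 * X by rewrite mulr_ge0 ?invr_ge0 ?(ltW l0).
have := ler_wpM2r lX gc.
have -> : c * l / 2 * (l^-1 * X) = c * X / 2 by field; rewrite gt_eqF.
lra.
Qed.

Section saddle.
Context {R : realType} {V : lmodType R} {ip be : V -> V -> R} {pos : V -> V}.
Hypothesis lf : lattice_forms ip be pos.
Let hip := lf_ip lf.
Let hbe := lf_be lf.
Implicit Types (u v w h n : V) (a b t : R).
Local Notation dF := (dF ip be pos).
Local Notation II := (II ip be pos).

(* If u almost realizes inf_(h in M) sup_(n in N) Psi (u + n + h), where Psi is
   uniformly concave along N, then its derivative D at u is small. *)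
Lemma near_critical (Psi : V -> R) (D : V -> R) (N M : V -> Prop) (c C kappa eta : R) u :
  (forall x y, D (x + y) = D x + D y) -> (forall t x, D (t *: x) = t * D x) ->
  N 0 -> (forall t x, N x -> N (t *: x)) -> (forall t x, M x -> M (t *: x)) ->
  0 < c -> 0 < C -> 0 < eta ->
  (forall n h, N n -> M h ->
    Psi (u + (n + h)) <= Psi u + D (n + h) - c * ip n n + C * ip h h) ->
  (forall n, N n -> Psi u + D n - C * ip n n <= Psi (u + n)) ->
  kappa - eta <= Psi u ->
  (forall n, N n -> Psi (u + n) <= kappa + eta) ->
  (forall h (e : R), M h -> 0 < e -> exists2 n, N n & kappa - e <= Psi (u + (n + h))) ->
  let K := 8 * C * (1 + C / c) in
  (forall n, N n -> D n ^+ 2 <= K * eta * ip n n) /\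
  (forall h, M h -> D h ^+ 2 <= K * eta * ip h h).
Proof.
move=> DD DZ N0 NZ MZ c0 C0 eta0 H1 H2 Pu Pn Ph K.
have Cc : 0 < C / c by rewrite divr_gt0.
have Dn n : N n -> D n ^+ 2 <= 8 * eta * C * ip n n.
  move=> Nn; have : (D n / 2) ^+ 2 <= (2 * eta) * (C * ip n n).
    apply: sqr_le_of_quadratic; rewrite ?mulr_ge0 ?(si_ge0 hip) ?(ltW eta0) ?(ltW C0)// => t.
    have := H2 _ (NZ t _ Nn); have := Pn _ (NZ t _ Nn).
    rewrite DZ !(siE hip); lra.
  by rewrite exprMn; lra.
split=> [n Nn|h Mh].
  apply: le_trans (Dn n Nn) _; rewrite ler_wpM2r ?(si_ge0 hip)// /K.
  have := mulr_gt0 (mulr_gt0 eta0 C0) Cc; lra.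
have : (D h / 2) ^+ 2 <= (2 * eta + 2 * eta * (C / c)) * (C * ip h h).
  apply: sqr_le_of_quadratic.
  - by have := mulr_gt0 eta0 Cc; lra.
  - by rewrite mulr_ge0 ?(si_ge0 hip) ?(ltW C0).
  move=> t; have [n Nn] := Ph _ _ (MZ (- t) _ Mh) eta0.
  have := H1 _ _ Nn (MZ (- t) _ Mh); rewrite DD DZ !(siE hip).
  have := Pn 0 N0; rewrite addr0.
  (* No bound on the response n is available, so its linear term is absorbed by the concavity term c
     [ip n n], at the cost 2 eta C / c. This is the origin of the factor 1 + C / c in K. *)
  have : D n <= c * ip n n + 2 * eta * (C / c).
    have X0 : 0 <= c * ip n n + 2 * eta * (C / c).
      have := mulr_gt0 eta0 Cc; have := mulr_ge0 (ltW c0) (si_ge0 hip n); lra.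
    rewrite (le_trans (ler_norm _))// -ler_sqr ?nnegrE// real_normK ?num_real//.
    apply: le_trans (Dn n Nn) _.
    have -> : 8 * eta * C * ip n n = 4 * (c * ip n n) * (2 * eta * (C / c)) by field; rewrite gt_eqF.
    have := sqr_ge0 (c * ip n n - 2 * eta * (C / c)); lra.
  lra.
rewrite exprMn /K; lra.
Qed.

Variables (J : R -> Prop) (l1 : R) (sg : R) (N M : V -> Prop).
Hypothesis l1_gt0 : 0 < l1.
Hypothesis be_ip : forall u, l1 * be u u <= ip u u.
Hypothesis sol_sign : forall a b u, J a -> J b -> (forall h, dF a b u h = 0) ->
  be u u != 0 -> be (pos u) (pos u) != 0 /\ be (pos (- u)) (pos (- u)) != 0.
Hypothesis sg1 : sg * sg = 1.
Hypotheses (N0 : N 0) (M0 : M 0).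
Hypothesis N_lin : forall t u v, N u -> N v -> N (t *: u + v).
Hypothesis M_lin : forall t u v, M u -> M v -> M (t *: u + v).
Hypothesis NM : forall n m, N n -> M m -> ip n m = 0.
Hypothesis NM_sum : forall u, exists n m, [/\ N n, M m & u = n + m].
(** The substitute for a Hessian: an upper expansion that is strictly concave along N, and a lower
    one with a quadratic error in all directions. *)
Hypothesis geometry : forall a b, J a -> J b -> exists c C : R, [/\ 0 < c, 0 < C,
  forall u n h, N n -> M h -> sg * II a b (u + (n + h)) <=
    sg * II a b u + sg * dF a b u (n + h) - c * ip n n + C * ip h h &
  forall u d, sg * II a b u + sg * dF a b u d - C * ip d d <= sg * II a b (u + d)].

Let NZ t u : N u -> N (t *: u).
Proof. by move=> Nu; rewrite -[_ *: _]addr0; exact: N_lin. Qed.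
Let MZ t u : M u -> M (t *: u).
Proof. by move=> Mu; rewrite -[_ *: _]addr0; exact: M_lin. Qed.
Let ND u v : N u -> N v -> N (u + v).
Proof. by move=> Nu Nv; rewrite -[u]scale1r; exact: N_lin. Qed.
Let MD u v : M u -> M v -> M (u + v).
Proof. by move=> Mu Mv; rewrite -[u]scale1r; exact: M_lin. Qed.
Let NB u v : N u -> N v -> N (v - u).
Proof. by move=> Nu Nv; rewrite addrC -scaleN1r; exact: N_lin. Qed.

Let pos0 : pos 0 = 0.
Proof. by have := lf_posZ lf 0 (lexx (0 : R)); rewrite !scale0r. Qed.

Let II0 a b : II a b 0 = 0.
Proof. by rewrite /II oppr0 pos0 (si0l hip) (si0l hbe); ring. Qed.

Let dF0 a b h : dF a b 0 h = 0.
Proof. by rewrite /dF oppr0 pos0 (si0l hip) (si0l hbe); ring. Qed.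

Let be_ip' u : be u u <= l1^-1 * ip u u.
Proof. by rewrite mulrC ler_pdivlMr// mulrC. Qed.

(* With sg = 1, N = N_(k-1) and M = M_(k-1), minimax_nonneg says that
   n_(k-1)(a, b) >= 0; with sg = -1, N = M_k and M = N_k, that m_k(a, b) <= 0. *)
Definition minimax_ge a b (d : R) := forall w, M w -> ip w w = 1 ->
  exists2 v, N v & d <= sg * II a b (v + w).

Definition minimax_nonneg a b := forall e : R, 0 < e -> minimax_ge a b (- e).
Definition minimax_pos a b := exists2 d : R, 0 < d & minimax_ge a b d.

Lemma minimax_ge_scaled a b d : J a -> J b -> minimax_ge a b d ->
  forall w, M w -> exists2 v, N v & d * ip w w <= sg * II a b (v + w).
Proof.
move=> Ja Jb dP w Mw; have [c [C [_ _ _ H2]]] := geometry Ja Jb.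
have := si_ge0 hip w; rewrite le_eqVlt => /predU1P[w0|w0].
  exists 0 => //; have := H2 0 w; rewrite II0 dF0 -w0 !add0r; lra.
set r := Num.sqrt (ip w w); have r0 : 0 < r by rewrite sqrtr_gt0.
have r2 : r ^+ 2 = ip w w by rewrite sqr_sqrtr// ltW.
have [||v Nv dv] := dP (r^-1 *: w); first exact: MZ.
  by rewrite !(siE hip) -r2; field; rewrite gt_eqF.
exists (r *: v); first exact: NZ.
have -> : r *: v + w = r *: (v + r^-1 *: w) by rewrite scalerDr scalerA divff ?scale1r// gt_eqF.
by rewrite (IIZ lf) ?(ltW r0)// r2 mulrCA mulrC ler_wpM2l// ltW.
Qed.

Lemma minimax_nonneg_scaled a b : J a -> J b -> minimax_nonneg a b ->
  forall w e, M w -> 0 < e -> exists2 v, N v & - e <= sg * II a b (v + w).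
Proof.
move=> Ja Jb Pab w e Mw e0; have iw := si_ge0 hip w.
have iw1 : 0 < ip w w + 1 by rewrite ltr_wpDl.
have [v Nv ev] := minimax_ge_scaled Ja Jb (Pab _ (divr_gt0 e0 iw1)) Mw.
exists v => //; apply: le_trans ev; rewrite mulNr lerN2 mulrAC ler_pdivrMr//.
by rewrite ler_wpM2l ?(ltW e0)// lerDl.
Qed.

Lemma minimax_posW a b : minimax_pos a b -> minimax_nonneg a b.
Proof.
move=> [d d0 dP] e e0 w Mw w1; have [v Nv dv] := dP w Mw w1.
by exists v => //; apply: le_trans dv; lra.
Qed.

Lemma II_diff a b a' b' u : II a' b' u - II a b u =
  2^-1 * ((b - b') * be (pos u) (pos u) + (a - a') * be (pos (- u)) (pos (- u))).
Proof. by rewrite /II; field. Qed.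

Lemma minimax_nonneg_mono a b a' b' : minimax_nonneg a b ->
  0 <= sg * (a - a') -> 0 <= sg * (b - b') -> minimax_nonneg a' b'.
Proof.
move=> Pab aa bb e e0 w Mw w1; have [v Nv ev] := Pab e e0 w Mw w1.
exists v => //; apply: le_trans ev _; rewrite -subr_ge0 -mulrBr II_diff.
have := mulr_ge0 aa (lf_ge0 lf (- (v + w)) (- (v + w))).
have := mulr_ge0 bb (lf_ge0 lf (v + w) (v + w)).
lra.
Qed.

Lemma II_close a b a' b' eta u : `|a' - a| <= eta -> `|b' - b| <= eta ->
  `|sg * II a' b' u - sg * II a b u| <= eta / l1 * ip u u.
Proof.
move=> aa bb; have e0 : 0 <= eta by apply: le_trans aa.
have sgn : `|sg| = 1.
  by apply/eqP; rewrite -(@eqrXn2 _ 2)// expr1n real_normK ?num_real// expr2 sg1.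
rewrite -mulrBr normrM sgn mul1r II_diff.
apply: (@le_trans _ _ (eta * be u u)); last by rewrite -mulrA ler_wpM2l.
rewrite (be_sqr lf u) normrM ger0_norm ?invr_ge0//.
have p0 := lf_ge0 lf u u; have m0 := lf_ge0 lf (- u) (- u).
apply: (@le_trans _ _ (2^-1 * (eta * be (pos u) (pos u) + eta * be (pos (- u)) (pos (- u))))).
  rewrite ler_wpM2l ?invr_ge0//; apply: le_trans (ler_normD _ _) _.
  by rewrite !normrM (ger0_norm p0) (ger0_norm m0) lerD// ler_wpM2r// distrC.
have := mulr_ge0 e0 p0; have := mulr_ge0 e0 m0; lra.
Qed.

(** The expansion at 0, where the energy and its differential vanish. It bounds the N-component
    wherever [sg * II] is not too negative. *)
Let coercive a b : J a -> J b -> exists c C : R, [/\ 0 < c, 0 < C &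
  forall v w, N v -> M w -> sg * II a b (v + w) <= - c * ip v v + C * ip w w].
Proof.
move=> Ja Jb; have [c [C [c0 C0 H1 _]]] := geometry Ja Jb.
exists c, C; split=> // v w Nv Mw; have := H1 0 v w Nv Mw.
by rewrite II0 dF0 !add0r; lra.
Qed.

(** The critical level is 0, so homogeneity frees w from the unit sphere and the constraint leaves
    no multiplier. Coercivity bounds the almost critical points, and their norm is at least 1, so
    the limit is not null. *)
Lemma minimax_degenerate a b : J a -> J b -> minimax_nonneg a b -> ~ minimax_pos a b ->
  exists2 u, be u u != 0 & forall h, dF a b u h = 0.
Proof.
move=> Ja Jb Pab nS; have [c [C [c0 C0 H1 H2]]] := geometry Ja Jb.
pose K := 8 * C * (1 + C / c).
have Cc : 0 < C / c by rewrite divr_gt0.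
have K0 : 0 < K by rewrite !mulr_gt0// addr_gt0.
pose B := (C + 1) / c + 1.
have B0 : 0 < B by rewrite !addr_gt0// divr_gt0// addr_gt0.
have [u [uE uA]] : exists u, (forall h, dF a b u h = 0) /\
    forall e : R, 0 < e -> exists v, [/\ 1 <= ip v v, ip (v - u) (v - u) <= e &
      be (v - u) (v - u) <= e].
  apply: (palais_smale lf (K := B + B / l1)) => e e0.
  pose eta := Num.min 1 (e / (2 * K)).
  have eta0 : 0 < eta by rewrite lt_min ltr01 divr_gt0// mulr_gt0.
  have eta1 : eta <= 1 by rewrite ge_min lexx.
  have etae : 2 * K * eta <= e.
    have : eta <= e / (2 * K) by rewrite ge_min lexx orbT.
    have K2 : 0 < 2 * K by rewrite mulr_gt0.
    by rewrite (ler_pdivlMr _ _ K2) [leLHS]mulrC.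
  have [w [Mw [w1 wlt]]] : exists w, M w /\ ip w w = 1 /\
      forall v, N v -> sg * II a b (v + w) < eta.
    apply: contrapT => nw; apply: nS; exists eta => // w Mw w1.
    apply: contrapT => nv; apply: nw; exists w; split=> //; split=> // v Nv.
    by rewrite ltNge; apply/negP => ev; apply: nv; exists v.
  have [v Nv ev] := Pab eta eta0 w Mw w1.
  have ipv : ip v v <= (C + 1) / c.
    rewrite ler_pdivlMr// mulrC; have := H1 0 v w Nv Mw.
    rewrite II0 dF0 !add0r w1; lra.
  have ipu : ip (v + w) (v + w) = ip v v + 1 by rewrite (siD_orth hip) ?w1//; exact: NM.
  have [hN hM] : (forall n, N n -> (sg * dF a b (v + w) n) ^+ 2 <= K * eta * ip n n) /\
      (forall h, M h -> (sg * dF a b (v + w) h) ^+ 2 <= K * eta * ip h h).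
    apply: (near_critical (Psi := fun x => sg * II a b x)
      (D := fun x => sg * dF a b (v + w) x) (N := N) (M := M) (kappa := 0) (u := v + w)) => //.
    - by move=> x y; rewrite (dFDr lf) mulrDr.
    - by move=> t x; rewrite (dFZr lf) mulrCA.
    - by move=> n h; exact: H1.
    - by rewrite sub0r.
    - by move=> n Nn; rewrite add0r addrAC; apply/ltW/wlt; exact: ND.
    move=> h e' Mh e'0.
    have [v' Nv' ev'] := minimax_nonneg_scaled Ja Jb Pab (MD Mw Mh) e'0.
    exists (v' - v); first exact: NB.
    by rewrite sub0r addrACA (addrC v) subrK.
  exists (v + w); split.
  - by rewrite ipu lerDr (si_ge0 hip).
  - by rewrite ipu ler_wpDr ?lerD2r// divr_ge0 ?(ltW B0) ?(ltW l1_gt0).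
  - apply: le_trans (be_ip' _) _; rewrite ipu.
    apply: (@le_trans _ _ (B / l1)); last by rewrite lerDr (ltW B0).
    by rewrite mulrC ler_wpM2r ?invr_ge0 ?(ltW l1_gt0)// lerD2r.
  move=> h; have [n [m [Nn Mm ->]]] := NM_sum h.
  have sg2 x : (sg * x) ^+ 2 = x ^+ 2 by rewrite exprMn expr2 sg1 mul1r.
  have := hN n Nn; have := hM m Mm; rewrite !sg2 (dFDr lf) (siD_orth hip (NM Nn Mm)).
  set x := dF a b (v + w) n; set y := dF a b (v + w) m => hy hx.
  have im := si_ge0 hip m; have in_ := si_ge0 hip n.
  have := ler_wpM2r (addr_ge0 in_ im) etae.
  have := sqr_ge0 (x - y); lra.
have bu : be u u != 0.
  have [|v [v1 vu _]] := uA 4^-1; first by rewrite invr_gt0.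
  apply/eqP => bu; have := siB_le hip (v - u) (- u).
  rewrite opprK subrK (siNl hip) (siNr hip) opprK (lf_null lf bu); lra.
by exists u.
Qed.

(** A solution has zero energy and, by concavity, is the strict maximum of [sg * II] on its
    translate of N. Its M-component is not null, since otherwise coercivity on N would make u
    null. *)
Lemma solution_minimax a b u : J a -> J b -> be u u != 0 -> (forall h, dF a b u h = 0) ->
  exists (c : R) v w, [/\ 0 < c, N v, M w, u = v + w & 0 < ip w w /\
    forall v', N v' -> sg * II a b (v' + w) <= - c * ip (v' - v) (v' - v)].
Proof.
move=> Ja Jb bu uE; have [c [C [c0 C0 H1 H2]]] := geometry Ja Jb.
have [v [w [Nv Mw uvw]]] := NM_sum u; exists c, v, w.
have I0 : II a b u = 0.
  by have := dF_id lf a b u; rewrite uE => /esym/eqP; rewrite mulf_eq0 pnatr_eq0/= => /eqP.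
split=> //; split=> [|v' Nv']; last first.
  have := H1 u (v' - v) 0 (NB Nv Nv') M0; rewrite addr0 uE I0 (si0l hip) uvw.
  by rewrite addrC addrA subrK; lra.
rewrite lt_neqAle (si_ge0 hip) andbT eq_sym; apply: contra bu => /eqP w0.
have := H1 0 v w Nv Mw; rewrite !II0 !dF0 -uvw !add0r I0 w0 !mulr0 addr0 => vle.
have v0 : ip v v = 0.
  apply/eqP; rewrite eq_le (si_ge0 hip) andbT -(pmulr_rle0 _ c0); lra.
have : l1 * be u u <= 0.
  by apply: le_trans (be_ip u) _; rewrite uvw (siD_orth hip) ?v0 ?w0 ?addr0//; exact: NM.
by rewrite pmulr_rle0// eq_le (si_ge0 hbe) andbT.
Qed.

Lemma solution_not_minimax_pos a b : J a -> J b ->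
  (exists2 u, be u u != 0 & forall h, dF a b u h = 0) -> ~ minimax_pos a b.
Proof.
move=> Ja Jb [u bu uE] [d d0 dP].
have [c [v [w [c0 Nv Mw uvw [w0 vP]]]]] := solution_minimax Ja Jb bu uE.
have [v' Nv' dv] := minimax_ge_scaled Ja Jb dP Mw.
have := vP v' Nv'; have := mulr_ge0 (ltW c0) (si_ge0 hip (v' - v)).
have := mulr_gt0 d0 w0; lra.
Qed.

(** If strictness failed there would be a solution at (a', b'); its M-component then witnesses that
    the minimax at (a, b) is negative. *)
Lemma minimax_strict a b a' b' : J a -> J b -> J a' -> J b' -> minimax_nonneg a b ->
  0 <= sg * (a - a') -> 0 <= sg * (b - b') -> (a, b) != (a', b') -> minimax_pos a' b'.
Proof.
move=> Ja Jb Ja' Jb' Pab aa bb ab; apply: contrapT => nS.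
have Pab' := minimax_nonneg_mono Pab aa bb.
have [u bu uE] := minimax_degenerate Ja' Jb' Pab' nS.
have [c [v [w [c0 Nv Mw uvw [w0 vP]]]]] := solution_minimax Ja' Jb' bu uE.
have [pu mu] := sol_sign Ja' Jb' uE bu.
have sgne x : x != 0 -> sg * x != 0.
  by move=> x0; rewrite mulf_neq0//; apply: contra_eq_neq sg1 => ->; rewrite mul0r eq_sym oner_eq0.
(* Both u^+ and u^- are nonzero, so that passing from (a', b') to (a, b) lowers
   the supremum over N + w strictly. *)
suff [g g0 gP] : exists2 g : R, 0 < g & forall v', N v' -> sg * II a b (v' + w) <= - g.
  have [|v' Nv' ev] := minimax_nonneg_scaled Ja Jb Pab Mw (e := g / 2); first by rewrite divr_gt0.
  by have := gP v' Nv'; lra.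
have be_v v' : N v' -> be (u - (v' + w)) (u - (v' + w)) <= l1^-1 * ip (v' - v) (v' - v).
  move=> Nv'; rewrite uvw opprD addrACA subrr addr0 (siBC hbe); exact: be_ip'.
have IE v' : sg * II a b (v' + w) = sg * II a' b' (v' + w) -
    2^-1 * (sg * (b - b') * be (pos (v' + w)) (pos (v' + w)) +
            sg * (a - a') * be (pos (- (v' + w))) (pos (- (v' + w)))).
  by have := II_diff a b a' b' (v' + w); move/eqP; rewrite subr_eq => /eqP ->; ring.
have pp x := lf_ge0 lf x x.
(* The coordinate that moves decides which part pays: u^- if only a changes, u^+ if b does. *)
have [bb0|bb0] := eqVneq b b'.
  have {}aa : 0 < sg * (a - a').
    rewrite lt_neqAle aa andbT eq_sym; apply: sgne; rewrite subr_eq0.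
    by apply: contra ab => /eqP ->; rewrite bb0.
  pose g := Num.min (c * l1 / 2) (sg * (a - a') / 4).
  have g0 : 0 < g by rewrite lt_min; apply/andP; split; rewrite divr_gt0// mulr_gt0.
  exists (g * be (pos (- u)) (pos (- u))).
    by rewrite mulr_gt0// lt_neqAle eq_sym mu pp.
  move=> v' Nv'; rewrite IE; have := vP v' Nv'.
  have := pos_compare lf (- u) (- (v' + w)).
  rewrite -opprD (siNl hbe) (siNr hbe) opprK => pc vPv.
  rewrite bb0 subrr mulr0 mul0r add0r.
  apply: (absorb_estimate (c := c) (l := l1) (X := ip (v' - v) (v' - v))) => //.
  - exact: ltW.
  - by rewrite ge_min lexx.
  - by rewrite ge_min lexx orbT.
  - exact: si_ge0.
  - by apply: le_trans pc _; rewrite lerD2l ler_wpM2l//; exact: be_v.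
have {}bb : 0 < sg * (b - b').
  by rewrite lt_neqAle bb andbT eq_sym; apply: sgne; rewrite subr_eq0.
pose g := Num.min (c * l1 / 2) (sg * (b - b') / 4).
have g0 : 0 < g by rewrite lt_min; apply/andP; split; rewrite divr_gt0// mulr_gt0.
exists (g * be (pos u) (pos u)).
  by rewrite mulr_gt0// lt_neqAle eq_sym pu pp.
move=> v' Nv'; rewrite IE; have vPv := vP v' Nv'.
have pc := pos_compare lf u (v' + w).
apply: (@le_trans _ _ (sg * II a' b' (v' + w) -
    2^-1 * (sg * (b - b') * be (pos (v' + w)) (pos (v' + w))))).
  by rewrite lerD2l lerN2 ler_wpM2l ?invr_ge0// lerDl mulr_ge0.
apply: (absorb_estimate (c := c) (l := l1) (X := ip (v' - v) (v' - v))) => //.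
- exact: ltW.
- by rewrite ge_min lexx.
- by rewrite ge_min lexx orbT.
- exact: si_ge0.
- by apply: le_trans pc _; rewrite lerD2l ler_wpM2l//; exact: be_v.
Qed.

Lemma minimax_nonneg_closed a b : J a -> J b -> ~ minimax_nonneg a b ->
  exists2 eta : R, 0 < eta & forall a' b', `|a' - a| <= eta -> `|b' - b| <= eta ->
    ~ minimax_nonneg a' b'.
Proof.
move=> Ja Jb nP; have [c [C [c0 C0 coer]]] := coercive Ja Jb.
have [e [w [e0 Mw w1 wP]]] : exists (e : R) w, [/\ 0 < e, M w, ip w w = 1 &
    forall v, N v -> sg * II a b (v + w) < - e].
  apply: contrapT => ne; apply: nP => e e0 w Mw w1; apply: contrapT => nv.
  apply: ne; exists e, w; split=> // v Nv.
  by rewrite ltNge; apply/negP => ev; apply: nv; exists v.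
(* The error of a perturbation grows like th (X + 1) with X = [ip v v]. Weighting the coercivity
   bound by s = e / (4 (C + e)) and the bound -e by 1 - s gives a value at most - s c X - 3 e / 4,
   which absorbs it. *)
pose th := Num.min (e / (4 * (C + e)) * c) (e / 4).
have Ce : 0 < C + e by rewrite addr_gt0.
have th0 : 0 < th by rewrite lt_min mulr_gt0 ?divr_gt0 ?mulr_gt0//.
exists (th * l1); first by rewrite mulr_gt0.
move=> a' b' aa bb P'.
have [v Nv ev] := P' (e / 4) (divr_gt0 e0 (ltr0Sn _ 3)) w Mw w1.
have := II_close (v + w) aa bb; rewrite mulfK ?gt_eqF// ler_norml => /andP[_].
have ipu : ip (v + w) (v + w) = ip v v + 1 by rewrite (siD_orth hip) ?w1//; exact: NM.
rewrite ipu.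
have := wP v Nv; have := coer v w Nv Mw; rewrite w1.
have X0 := si_ge0 hip v; move: ev X0.
set X := ip v v; set p' := sg * II a' b' _; set p := sg * II a b _.
move: th0; set s := e / (4 * (C + e)) => _ ev X0 Pc Pe Pd.
have s0 : 0 <= s by rewrite divr_ge0 ?mulr_ge0 ?(ltW e0) ?(ltW Ce).
have sCe : s * (C + e) = e / 4 by rewrite /s; field; rewrite gt_eqF.
have s1 : s <= 1.
  by rewrite ler_pdivrMr ?mulr_gt0// mul1r; lra.
have th1 : th <= s * c by rewrite ge_min lexx.
have th2 : th <= e / 4 by rewrite ge_min lexx orbT.
have h1 := ler_wpM2l s0 Pc.
have h2 := ler_wpM2l (_ : 0 <= 1 - s) (ltW Pe).
have {}h2 : (1 - s) * p <= (1 - s) * - e by apply: h2; rewrite subr_ge0.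
have h3 := ler_wpM2r X0 th1.
lra.
Qed.

(** The same v serves for nearby parameters: coercivity bounds it independently of w, so the
    perturbation is uniformly at most d / 2. *)
Lemma minimax_pos_open a b : J a -> J b -> minimax_pos a b ->
  exists2 eta : R, 0 < eta & forall a' b', `|a' - a| <= eta -> `|b' - b| <= eta ->
    minimax_pos a' b'.
Proof.
move=> Ja Jb [d d0 dP]; have [c [C [c0 C0 coer]]] := coercive Ja Jb.
pose B := C / c + 1.
have B0 : 0 < B by rewrite addr_gt0// divr_gt0.
exists (d / (2 * B) * l1); first by rewrite mulr_gt0// divr_gt0// mulr_gt0.
move=> a' b' aa bb; exists (d / 2); first by rewrite divr_gt0.
move=> w Mw w1; have [v Nv dv] := dP w Mw w1; exists v => //.
have := II_close (v + w) aa bb; rewrite mulfK ?gt_eqF// ler_norml => /andP[h _].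
have ipu : ip (v + w) (v + w) = ip v v + 1 by rewrite (siD_orth hip) ?w1//; exact: NM.
have ipv : ip v v <= C / c.
  by rewrite ler_pdivlMr// mulrC; have := coer v w Nv Mw; rewrite w1; lra.
have : d / (2 * B) * ip (v + w) (v + w) <= d / 2.
  rewrite ipu; apply: (@le_trans _ _ (d / (2 * B) * B)).
    by rewrite ler_wpM2l ?lerD2r// ltW// divr_gt0// mulr_gt0.
  by rewrite invfM mulrA divfK// gt_eqF.
lra.
Qed.

Lemma saddle_region : monotone_region sg J minimax_nonneg minimax_pos
  (fun a b => exists2 u, be u u != 0 & forall h, dF a b u h = 0).
Proof.
split.
- move=> a b a' b'; exact: minimax_strict.
- exact: minimax_nonneg_closed.
- exact: minimax_pos_open.
- exact: minimax_posW.
- exact: minimax_degenerate.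
- exact: solution_not_minimax_pos.
Qed.

End saddle.

(** * The two saddle geometries around the k-th eigenvalue *)

Section two_saddles.
Context {R : realType} {V : lmodType R} {ip be : V -> V -> R} {pos : V -> V}.
Hypothesis lf : lattice_forms ip be pos.
Let hip := lf_ip lf.
Let hbe := lf_be lf.
Implicit Types (u v w h e : V) (a b t : R).
Local Notation dF := (dF ip be pos).
Local Notation II := (II ip be pos).
Local Notation Eig := (@Eig R V ip be).

Variable lam : nat -> R.
Hypothesis lam1_gt0 : 0 < lam 1%N.
Hypothesis lam_lt : forall i j, (0 < i < j)%N -> lam i < lam j.
Hypothesis lamP : forall la, (exists2 u, be u u != 0 & Eig la u) <->
  exists2 j, (0 < j)%N & la = lam j.
Local Notation Nn := (@Nn R V ip be lam).
Local Notation Mm := (@Mm R V ip be lam).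

Variable k : nat.
Hypothesis k_ge2 : (2 <= k)%N.
Local Notation J := (fun a => lam k.-1 < a < lam k.+1).

Let k1_gt0 : (0 < k.-1)%N. Proof. by case: k k_ge2 => [|[]]. Qed.
Let k1S : k.-1.+1 = k. Proof. by case: k k_ge2. Qed.
Let l_gt0 j : (0 < j)%N -> 0 < lam j. Proof. exact: (lam_gt0 lam1_gt0 lam_lt). Qed.

Let pE u := poincare lf lam1_gt0 lam_lt lamP u.
Let J_gt0 a : J a -> 0 < a.
Proof. by move=> /andP[h _]; apply: lt_trans h; exact: l_gt0. Qed.

Let NM_orth j u v : Nn j u -> Mm j v -> ip u v = 0 /\ be u v = 0.
Proof.
by move=> Nu Mv; rewrite (siC hip) (siC hbe) Mv// (Mm_be lf lam1_gt0 lam_lt Mv Nu).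
Qed.

(** A solution of one sign is an eigenfunction with eigenvalue a or b, and [lam k] is the only
    eigenvalue in J. *)
Lemma saddle_sol_sign a b u : J a -> J b -> (forall h, dF a b u h = 0) ->
  be u u != 0 -> be (pos u) (pos u) != 0 /\ be (pos (- u)) (pos (- u)) != 0.
Proof.
move=> Ja Jb.
have key c d v : J c -> (forall h, dF c d v h = 0) -> be v v != 0 ->
    be (pos v) (pos v) != 0.
  move=> Jc vE bv; apply: contra (bv) => /eqP pv; apply/eqP.
  have Ev : Eig c v.
    move=> h; have : be v h = be (pos v) h - be (pos (- v)) h.
      by rewrite {1}(lf_sub lf v) (siDl hbe) (siNl hbe).
    have := vE h; rewrite /dF (si_null hbe _ pv) sub0r => + ->; lra.
  have [j j0 cj] : exists2 j, (0 < j)%N & c = lam j by apply/lamP; exists v.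
  move: Jc; rewrite cj => /andP[c1 c2].
  have jk : j = k.
    apply/eqP; rewrite eqn_leq; apply/andP; split; rewrite leqNgt; apply/negP => jk.
      by move: c2; rewrite ltNge (lam_le lam_lt).
    by move: c1; rewrite ltNge (lam_le lam_lt)// -ltnS k1S.
  by apply: (eigenfunction_changes_sign lf lam1_gt0 lam_lt lamP k_ge2) => //; rewrite -jk -cj.
move=> uE bu; split; first exact: key Ja uE bu.
apply: (key b a) => //; last by rewrite (siNl hbe) (siNr hbe) opprK.
by move=> h; rewrite (dFN lf) uE oppr0.
Qed.

Lemma geometry_low a b : J a -> J b -> exists c C : R, [/\ 0 < c, 0 < C,
  forall u n h, Nn k.-1 n -> Mm k.-1 h -> 1 * II a b (u + (n + h)) <=
    1 * II a b u + 1 * dF a b u (n + h) - c * ip n n + C * ip h h &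
  forall u d, 1 * II a b u + 1 * dF a b u d - C * ip d d <= 1 * II a b (u + d)].
Proof.
move=> Ja Jb; have a0 := J_gt0 Ja; have b0 := J_gt0 Jb; have ll := l_gt0 k1_gt0.
(* On N_(k-1) the quadratic part is at most (1 - x) / 2 times [ip n n], with x > 1. The constant y
   comes from the Poincare inequality. *)
pose m := Num.min a b; pose x := m / lam k.-1.
have m0 : 0 < m by rewrite lt_min a0.
have x1 : 1 < x.
  by rewrite ltr_pdivlMr// mul1r lt_min; case/andP: Ja => -> _; case/andP: Jb.
pose y := (a + b) / lam 1%N.
have y0 : 0 < y by rewrite divr_gt0// addr_gt0.
exists (2^-1 * (x - 1)), (2^-1 + 2^-1 * y); split.
- lra.
- lra.
- move=> u n h Nn_ Mh; have [rp [rm [rp0 rm0 rE ->]]] := II_taylor lf a b u (n + h).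
  have [inh bnh] := NM_orth Nn_ Mh.
  move: rE; rewrite (siD_orth hbe bnh) (siD_orth hip inh) => rE.
  have h1 : m * rp <= b * rp by rewrite ler_wpM2r// ge_min lexx orbT.
  have h2 : m * rm <= a * rm by rewrite ler_wpM2r// ge_min lexx.
  have h3 : x * ip n n <= m * be n n.
    rewrite /x mulrAC ler_pdivrMr// -mulrA ler_wpM2l ?(ltW m0)// mulrC.
    exact: (Nn_le lf lam_lt).
  have h4 := mulr_ge0 (ltW m0) (si_ge0 hbe h).
  have h5 := mulr_ge0 (ltW y0) (si_ge0 hip h).
  have : m * (rp + rm) = m * be n n + m * be h h by rewrite rE mulrDr.
  lra.
move=> u d; have [rp [rm [rp0 rm0 rE ->]]] := II_taylor lf a b u d.
have h1 := mulr_ge0 (ltW a0) rp0; have h2 := mulr_ge0 (ltW b0) rm0.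
have h3 : (a + b) * (rp + rm) <= y * ip d d.
  rewrite rE /y mulrAC ler_pdivlMr// -mulrA ler_wpM2l ?(ltW (addr_gt0 a0 b0))//.
  by rewrite mulrC; exact: pE.
have := si_ge0 hip d; lra.
Qed.

Lemma geometry_high a b : J a -> J b -> exists c C : R, [/\ 0 < c, 0 < C,
  forall u n h, Mm k n -> Nn k h -> -1 * II a b (u + (n + h)) <=
    -1 * II a b u + -1 * dF a b u (n + h) - c * ip n n + C * ip h h &
  forall u d, -1 * II a b u + -1 * dF a b u d - C * ip d d <= -1 * II a b (u + d)].
Proof.
move=> Ja Jb; have a0 := J_gt0 Ja; have b0 := J_gt0 Jb; have ll := l_gt0 (ltn0Sn k).
(* Mirror choice: the spectral gap on M_k makes the concavity constant (1 - x) / 2 positive, with x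
   < 1. *)
pose m := Num.max a b; pose x := m / lam k.+1.
have m0 : 0 < m by rewrite lt_max a0.
have x1 : x < 1.
  by rewrite ltr_pdivrMr// mul1r gt_max; case/andP: Ja => _ ->; case/andP: Jb.
pose y := m / lam 1%N.
have y0 : 0 < y by rewrite divr_gt0.
exists (2^-1 * (1 - x)), (2^-1 + 2^-1 * y); split.
- lra.
- lra.
- move=> u n h Mn Nh; have [rp [rm [rp0 rm0 rE ->]]] := II_taylor lf a b u (n + h).
  have [inh bnh] := NM_orth Nh Mn; rewrite (siC hip) in inh; rewrite (siC hbe) in bnh.
  move: rE; rewrite (siD_orth hbe bnh) (siD_orth hip inh) => rE.
  have h1 : b * rp <= m * rp by rewrite ler_wpM2r// le_max lexx orbT.
  have h2 : a * rm <= m * rm by rewrite ler_wpM2r// le_max lexx.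
  have h3 : m * be n n <= x * ip n n.
    rewrite /x mulrAC ler_pdivlMr// -mulrA ler_wpM2l ?(ltW m0)// mulrC.
    exact: (Mm_gap lf lam1_gt0 lam_lt lamP).
  have h4 : m * be h h <= y * ip h h.
    rewrite /y mulrAC ler_pdivlMr// -mulrA ler_wpM2l ?(ltW m0)// mulrC; exact: pE.
  have h5 := si_ge0 hip h.
  have : m * (rp + rm) = m * be n n + m * be h h by rewrite rE mulrDr.
  lra.
move=> u d; have [rp [rm [rp0 rm0 rE ->]]] := II_taylor lf a b u d.
have h1 := mulr_ge0 (ltW b0) rp0; have h2 := mulr_ge0 (ltW a0) rm0.
have := mulr_ge0 (ltW y0) (si_ge0 hip d); lra.
Qed.

Lemma region_low : monotone_region 1 J (@minimax_nonneg R V ip be pos 1 (Nn k.-1) (Mm k.-1))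
  (@minimax_pos R V ip be pos 1 (Nn k.-1) (Mm k.-1))
  (fun a b => exists2 u, be u u != 0 & forall h, dF a b u h = 0).
Proof.
apply: (saddle_region lf lam1_gt0 pE saddle_sol_sign).
- by rewrite mulr1.
- exact: (Nn_zero lf).
- exact: (Mm_zero lf).
- exact: (Nn_lin lf).
- exact: (Mm_lin lf).
- by move=> n m Nn_ Mm_; case: (NM_orth Nn_ Mm_).
- exact: (Nn_Mm_decomp lf lam1_gt0 lam_lt).
- exact: geometry_low.
Qed.

Lemma region_high : monotone_region (-1) J (@minimax_nonneg R V ip be pos (-1) (Mm k) (Nn k))
  (@minimax_pos R V ip be pos (-1) (Mm k) (Nn k))
  (fun a b => exists2 u, be u u != 0 & forall h, dF a b u h = 0).
Proof.
apply: (saddle_region lf lam1_gt0 pE saddle_sol_sign).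
- by rewrite mulrNN mulr1.
- exact: (Mm_zero lf).
- exact: (Nn_zero lf).
- exact: (Mm_lin lf).
- exact: (Nn_lin lf).
- by move=> n m Mn Nm; rewrite (siC hip); case: (NM_orth Nm Mn).
- move=> u; have [v [w [Nv Mw ->]]] := Nn_Mm_decomp lf lam1_gt0 lam_lt k u.
  by exists w, v; rewrite addrC.
- exact: geometry_high.
Qed.

Lemma solution_lam : exists2 u, be u u != 0 & forall h, dF (lam k) (lam k) u h = 0.
Proof.
have [u bu Eu] : exists2 u, be u u != 0 & Eig (lam k) u.
  by apply/lamP; exists k => //; exact: leq_trans k_ge2.
by exists u => // h; rewrite (dF_eig lf) Eu subrr.
Qed.

Lemma minimax_low_lam :
  @minimax_nonneg R V ip be pos 1 (Nn k.-1) (Mm k.-1) (lam k) (lam k).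
Proof.
move=> e e0 w Mw w1; exists 0; first exact: (Nn_zero lf lam k.-1).
rewrite add0r mul1r /II -mulrDr -(be_sqr lf).
by have := Mm_gap lf lam1_gt0 lam_lt lamP Mw; rewrite k1S; lra.
Qed.

Lemma minimax_high_lam : @minimax_nonneg R V ip be pos (-1) (Mm k) (Nn k) (lam k) (lam k).
Proof.
move=> e e0 w Nw w1; exists 0; first exact: (Mm_zero lf).
rewrite add0r /II -mulrDr -(be_sqr lf).
by have := Nn_le lf lam_lt Nw; lra.
Qed.

(* If inf over w in M_k of sup over v in N_(k-1) of II (v + y + w), for an
   eigenfunction y of lam k, were positive, then II would be bounded below by a
   positive constant on z + M_k for some z in N_k. *)
Lemma minimax_low_high a b : J a -> J b ->
  @minimax_pos R V ip be pos 1 (Nn k.-1) (Mm k.-1) a b ->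
  ~ @minimax_nonneg R V ip be pos (-1) (Mm k) (Nn k) a b.
Proof.
move=> Ja Jb [d d0 dP] P.
have [c [C [c0 C0 H1 H2]]] := geometry_low Ja Jb.
have [c' [C' [c'0 C'0 H1' _]]] := geometry_high Ja Jb.
have [y by0 Ey] : exists2 y, be y y != 0 & Eig (lam k) y.
  by apply/lamP; exists k => //; exact: leq_trans k_ge2.
have k0 : (0 < k)%N by exact: leq_trans k_ge2.
have iy0 : 0 < ip y y.
  by rewrite Ey mulr_gt0 ?l_gt0// lt_neqAle eq_sym by0 (si_ge0 hbe).
have Ny : Nn k y by apply: (Eig_Nn lf (j := k)); rewrite ?k0 ?leqnn.
have My : Mm k.-1 y by apply: (Eig_Mm lf lam_lt); rewrite k1S.
have MmW' w : Mm k w -> Mm k.-1 w.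
  by move=> Mw; apply: (MmW lf (k := k.-1)); rewrite k1S.
have NnW' v : Nn k.-1 v -> Nn k v.
  by move=> Nv; have := NnW lf Nv; rewrite k1S.
have MmD j u v : Mm j u -> Mm j v -> Mm j (u + v).
  by move=> Mu Mv; rewrite -[u]scale1r; exact: (Mm_lin lf).
have NnD j u v : Nn j u -> Nn j v -> Nn j (u + v).
  by move=> Mu Mv; rewrite -[u]scale1r; exact: (Nn_lin lf).
have NnL j t u v : Nn j u -> Nn j v -> Nn j (t *: u + v) by exact: (Nn_lin lf).
have MmL j t u v : Mm j u -> Mm j v -> Mm j (t *: u + v) by exact: (Mm_lin lf).
have NnZ j t u : Nn j u -> Nn j (t *: u).
  by move=> Mu; rewrite -[_ *: _]addr0; apply: (Nn_lin lf) => //; exact: (Nn_zero lf).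
have MmZ j t u : Mm j u -> Mm j (t *: u).
  by move=> Mu; rewrite -[_ *: _]addr0; apply: (Mm_lin lf) => //; exact: (Mm_zero lf).
have NnB j u v : Nn j u -> Nn j v -> Nn j (v - u).
  by move=> Nu Nv; rewrite -scaleN1r; apply: (NnD) => //; exact: NnZ.
(* By homogeneity the bound at y + w is d times its squared norm, and y is orthogonal to M_k, so
   [de] bounds it below for all w. *)
pose de := d * ip y y.
have de0 : 0 < de by rewrite mulr_gt0.
have deP w : Mm k w -> exists2 v, Nn k.-1 v & de <= II a b (v + (y + w)).
  move=> Mw.
  have [v Nv vP] := minimax_ge_scaled lf (J := J) (Nn_zero lf _ _)
    (@Mm_zero _ _ _ _ _ lf _ _) (@NnL _) (@MmL _)
    geometry_low Ja Jb dP (MmD _ _ _ My (MmW' _ Mw)).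
  exists v => //; move: vP; rewrite mul1r; apply: le_trans.
  rewrite ler_wpM2l ?(ltW d0)// (siD_orth hip) ?lerDl ?(si_ge0 hip)//.
  by case: (NM_orth Ny Mw).
(* Its elements are the upper bounds of the inner supremum for some w, so inf S is the minimax
   value. *)
pose S := [set x : R | exists2 w, Mm k w & forall v, Nn k.-1 v -> II a b (v + (y + w)) <= x].
have S_lb x : S x -> de <= x.
  by move=> [w Mw wx]; have [v Nv /le_trans->//] := deP w Mw; exact: wx.
have S_inf : has_inf S.
  split; last by exists de => x /S_lb.
  exists (C * ip y y), 0; first exact: (Mm_zero lf).
  move=> v Nv; rewrite addr0.
  have := H1 0 v y Nv My; rewrite /II /dF oppr0 add0r.
  have -> : pos 0 = 0 by have := lf_posZ lf 0 (lexx (0 : R)); rewrite !scale0r.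
  rewrite !(siE hip) !(siE hbe).
  have := mulr_ge0 (ltW c0) (si_ge0 hip v); lra.
pose kappa := inf S.
have ka_de : de <= kappa by apply: lb_le_inf => [|x /S_lb//]; case: S_inf.
have ka_lb x : S x -> kappa <= x by move=> Sx; apply: ge_inf => //; case: S_inf.
pose K := 8 * C * (1 + C / c).
have K0 : 0 < K.
  by rewrite /K; have := mulr_gt0 C0 (divr_gt0 C0 c0); lra.
(* Chosen so that eta (1 + K / c') = de / 4, the total loss in [low] below the level kappa >= de. *)
pose eta := de / 4 / (1 + K / c').
have Kc0 : 0 < 1 + K / c' by rewrite addr_gt0// divr_gt0.
have eta0 : 0 < eta by rewrite !divr_gt0.
have [x [w0 Mw0 w0x] xk] := inf_adherent eta0 S_inf.
have ex w (e : R) : Mm k w -> 0 < e -> exists2 v, Nn k.-1 v & kappa - e <= II a b (v + (y + w)).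
  move=> Mw e0; apply: contrapT => nv.
  have : kappa <= kappa - e.
    apply: ka_lb; exists w => // v Nv; rewrite leNgt; apply/negP => vk; apply: nv.
    by exists v => //; exact: ltW.
  by lra.
have [v0 Nv0 v0k] := ex w0 eta Mw0 eta0.
pose u := v0 + (y + w0).
(* Here N_(k-1) and M_k leave out the direction of the eigenfunctions of [lam k]; only the smallness
   of the differential along M_k is kept. *)
have [_ hM] : (forall n, Nn k.-1 n -> dF a b u n ^+ 2 <= K * eta * ip n n) /\
    (forall h, Mm k h -> dF a b u h ^+ 2 <= K * eta * ip h h).
  apply: (near_critical lf (Psi := II a b) (D := dF a b u) (N := Nn k.-1) (M := Mm k)
    (kappa := kappa) (u := u)) => //.
  - by move=> ? ?; exact: (dFDr lf).
  - by move=> ? ?; exact: (dFZr lf).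
  - exact: (Nn_zero lf).
  - by move=> t x' Nx; exact: NnZ.
  - by move=> t x' Mx; exact: MmZ.
  - by move=> n h Nn_ Mh; have := H1 u n h Nn_ (MmW' _ Mh); rewrite !mul1r.
  - by move=> n Nn_; have := H2 u n; rewrite !mul1r.
  - move=> n Nn_; rewrite /u addrAC.
    by apply: le_trans (w0x _ (NnD _ _ _ Nv0 Nn_)) _; exact: ltW.
  move=> h e Mh e0; have [v Nv vk] := ex (w0 + h) e (MmD _ _ _ Mw0 Mh) e0.
  exists (v - v0); first exact: NnB.
  rewrite /u addrACA (addrC v0) subrK -addrA; exact: vk.
have low h : Mm k h -> 3 * de / 4 <= II a b (u + h).
  move=> Mh; have := H1' u h 0 Mh (Nn_zero lf _ _).
  rewrite addr0 (si0l hip) mulr0 addr0.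
  have /hM : Mm k h by [].
  set q := dF a b u h; set X := ip h h => qX.
  have X0 : 0 <= X := si_ge0 hip h.
  have : - (c' * X + eta * (K / c')) <= q.
    rewrite lerNl; apply: le_trans (ler_norm _) _; rewrite normrN.
    have p1 : 0 <= c' * X by rewrite mulr_ge0// ltW.
    have p2 : 0 <= eta * (K / c') by rewrite mulr_ge0 ?(ltW eta0)// divr_ge0 ?ltW.
    rewrite -ler_sqr ?nnegrE ?addr_ge0// real_normK ?num_real//.
    apply: le_trans qX _.
    have -> : K * eta * X = (c' * X) * (eta * (K / c')) by field; rewrite gt_eqF.
    have := sqr_ge0 (c' * X - eta * (K / c')); have := mulr_ge0 p1 p2; lra.
  have etaE : eta * (1 + K / c') = de / 4 by rewrite /eta divfK// gt_eqF.
  move: v0k; rewrite -/u; lra.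
have Nz : Nn k (v0 + y) by apply: NnD => //; exact: NnW'.
(* On v0 + y + M_k the energy is at least 3 de / 4, while the hypothesis on m_k gives a point where
   it is at most de / 2. *)
have [w Mw wP] := minimax_nonneg_scaled lf (J := J) (@Mm_zero _ _ _ _ _ lf _ _)
    (Nn_zero lf _ _) (@MmL _) (@NnL _)
    geometry_high Ja Jb P Nz (divr_gt0 de0 (ltr0Sn _ 1)).
have uE : u + (w - w0) = w + (v0 + y).
  by rewrite /u [LHS]addrC (addrA v0) addrACA addNr addr0.
have := low (w - w0); rewrite uE.
have Mww : Mm k (w - w0) by rewrite -scaleN1r; apply: MmD => //; exact: MmZ.
move=> /(_ Mww); lra.
Qed.

End two_saddles.

(** * The theorem *)

Section translation.
Context {R : realType} {s : R} {N : nat} {Omega : set 'rV[R]_N}.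
Hypothesis s_gt0 : 0 < s.
Hypothesis openO : open Omega.
Hypothesis bddO : bounded_set Omega.
Local Notation leb := (lebesgue_rV R N).
Local Notation X := (Xspace s Omega).
Local Notation ip := (@ipX R s N Omega).
Local Notation be := (@beX R s N Omega).
Local Notation pos := (@posX R s N Omega).
Local Notation Eig := (@Eig R X ip be).
Implicit Types (u v w : X).

Let mO : measurable Omega := open_measurable_rV openO.
Let O_lty : (leb Omega < +oo)%E := Omega_lty mO bddO.

Lemma Xspace_forms : lattice_forms ip be pos.
Proof.
split.
- split; [exact: ipXC|exact: ipXDl|exact: ipXZl|exact: ipX_ge0].
- split; [exact: (beXC mO)|exact: (beXDl mO)|exact: (beXZl mO)|exact: (beX_ge0 mO)].
- exact: posX_sub.
- exact: posXZ.
- exact: (posX_orth mO).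
- exact: (posX_ge0 mO).
- exact: (ipX_null mO).
- exact: (posX_sign s_gt0 mO).
- exact: (Xspace_compact s_gt0 mO bddO).
- exact: (Xspace_complete mO O_lty).
Qed.
Let lf := Xspace_forms.
Let hbe := lf_be lf.

Definition toX (f : 'rV[R]_N -> R) (Xf : Xs s Omega f) : X := exist _ f (asboolT Xf).

Lemma Xs_nonzeroE u : Xs_nonzero s Omega (\val u) <-> be u u != 0.
Proof.
split=> [[_ u0]|u0]; first by apply/eqP => /(beX_eq0 mO).
by split; [exact: Xs_val|move/(beX_eq0 mO)/eqP; rewrite (negbTE u0)].
Qed.

Lemma eigenspaceE la u : Defs.eigenspace s Omega la (\val u) <-> Eig la u.
Proof.
split=> [[_ h] v|h]; first exact: (h _ (Xs_val v)).
by split=> [|v Xv]; [exact: Xs_val|exact: (h (toX Xv))].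
Qed.

Lemma is_eigenvalueE la :
  is_eigenvalue s Omega la <-> exists2 u, be u u != 0 & Eig la u.
Proof.
split=> [[f Xf Ef]|[u u0 Eu]].
  exists (toX Xf.1); first exact/Xs_nonzeroE.
  exact/eigenspaceE.
by exists (\val u); [exact/Xs_nonzeroE|exact/eigenspaceE].
Qed.

Lemma integral_split a b u v :
  \int[leb]_(x in Omega) ((b * (\val u)^\+ x - a * (\val u)^\- x) * \val v x) =
  b * be (pos u) v - a * be (pos (- u)) v.
Proof. by rewrite -!(siZl hbe) -(siNl hbe) -(siDl hbe). Qed.

Lemma FucikE a b :
  Fucik s Omega (a, b) <-> exists2 u, be u u != 0 & forall h, dF ip be pos a b u h = 0.
Proof.
split=> [[f Xf Ef]|[u u0 Eu]].
  exists (toX Xf.1); first exact/Xs_nonzeroE.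
  move=> h; have := Ef _ (Xs_val h); have := integral_split a b (toX Xf.1) h.
  by rewrite /dF /= => -> <-; rewrite subrr.
exists (\val u); first exact/Xs_nonzeroE.
move=> v Xv; have := Eu (toX Xv); rewrite /dF -integral_split.
by move/eqP; rewrite subr_eq0 => /eqP.
Qed.

Lemma energyE a b u : energy s Omega (\val u) a b = II ip be pos a b u.
Proof.
rewrite /energy /norm_X sqr_sqrtr ?ipX_ge0//; congr (_ - _ * _).
have := integral_split a b u u; rewrite (be_posl lf) (be_posNl lf) mulrN opprK => <-.
apply: eq_Rintegral => x _; rewrite /funrpos /funrneg /Order.max.
by do 2 case: ltP => ?; lra.
Qed.

Lemma norm_X1 u : norm_X s (\val u) = 1 <-> ip u u = 1.
Proof.
rewrite /norm_X -/(ip u u); split=> [h|->]; last by rewrite sqrtr1.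
by rewrite -[LHS]sqr_sqrtr ?ipX_ge0// h expr1n.
Qed.

Variable lam : nat -> R.
Local Notation Nn := (@Nn R X ip be lam).
Local Notation Mm := (@Mm R X ip be lam).

Let val_sum (I : Type) (r : seq I) (F : I -> X) x :
  \val (\sum_(j <- r) F j) x = \sum_(j <- r) \val (F j) x.
Proof. by elim/big_rec2: _ => // i y1 y2 _ <-. Qed.

Lemma NspP k f : Nsp s Omega lam k f <-> exists2 u, Nn k u & f = \val u.
Proof.
split=> [[e eE fE]|[u [e eE ->] ->]]; last first.
  exists (fun j => \val (e j)); first by move=> j /eE /eigenspaceE.
  by move=> x; rewrite val_sum.
(* Outside 1 <= j <= k the function [e j] is arbitrary; 0 is a default value there. *)
pose e' j : X := if pselect (Xs s Omega (e j)) is left Xe then toX Xe else 0.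
have e'E j : (1 <= j <= k)%N -> \val (e' j) = e j.
  by move=> /eE[Xe _]; rewrite /e'; case: pselect.
exists (\sum_(1 <= j < k.+1) e' j).
  by exists e' => // j jk; apply/eigenspaceE; rewrite e'E//; exact: eE.
apply/funext => x; rewrite fE val_sum; apply: eq_big_nat => j; rewrite ltnS => jk.
by rewrite e'E.
Qed.

Lemma MspP k f : Msp s Omega lam k f <-> exists2 w, Mm k w & f = \val w.
Proof.
split=> [[Xf fM]|[w Mw ->]].
  by exists (toX Xf) => // v Nv; apply: fM; apply/NspP; exists v.
by split=> [|v /NspP[u Nu ->]]; [exact: Xs_val|exact: Mw].
Qed.

(** The inner supremum is not assumed to be attained, hence the quantification over e in
    [minimax_nonneg]. *)
Lemma n_funcE l a b : (0 <= n_func s Omega lam l a b)%E <->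
  @minimax_nonneg R X ip be pos 1 (Nn l) (Mm l) a b.
Proof.
split=> [n0 e e0 w Mw w1|P].
  have : (- e%:E < ereal_sup [set (energy s Omega (v \+ \val w) a b)%:E | v in Nsp s Omega lam l])%E.
    apply: (@lt_le_trans _ _ 0%E); first by rewrite oppe_lt0 lte_fin.
    apply: le_trans n0 _; apply: ereal_inf_lbound.
    exists (\val w) => //; split; first by apply/MspP; exists w.
    exact/norm_X1.
  move=> /ereal_sup_gt[_ [_ /NspP[v Nv ->] <-]].
  rewrite (energyE a b (v + w)) -EFinN lte_fin => ev; exists v => //.
  by rewrite mul1r ltW.
apply: le_ereal_inf_tmp => _ [_ [/MspP[w Mw ->] /norm_X1 w1] <-].
apply/lee_addgt0Pr => e e0; have [v Nv ev] := P e e0 w Mw w1.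
rewrite -leeBlDr// sub0e.
apply: (@le_trans _ _ (energy s Omega (\val v \+ \val w) a b)%:E).
  by rewrite (energyE a b (v + w)) -EFinN lee_fin -[leRHS]mul1r.
by apply: ereal_sup_ubound; exists (\val v) => //; apply/NspP; exists v.
Qed.

Lemma m_funcE k a b : (m_func s Omega lam k a b <= 0)%E <->
  @minimax_nonneg R X ip be pos (-1) (Mm k) (Nn k) a b.
Proof.
split=> [m0 e e0 w Nw w1|P].
  have : (ereal_inf [set (energy s Omega (\val w \+ v) a b)%:E | v in Msp s Omega lam k] < e%:E)%E.
    apply: (@le_lt_trans _ _ 0%E); last by rewrite lte_fin.
    apply: le_trans m0; apply: ereal_sup_ubound.
    exists (\val w) => //; split; first by apply/NspP; exists w.
    exact/norm_X1.
  move=> /ereal_inf_lt[_ [_ /MspP[v Mv ->] <-]].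
  rewrite (energyE a b (w + v)) lte_fin => ev; exists v => //.
  by rewrite mulN1r lerN2 addrC ltW.
apply: ge_ereal_sup => _ [_ [/NspP[w Nw ->] /norm_X1 w1] <-].
apply/lee_addgt0Pr => e e0; have [v Mv] := P e e0 w Nw w1.
rewrite mulN1r lerN2 addrC => ev; rewrite add0e; apply: ge_ereal_inf.
exists (energy s Omega (\val w \+ \val v) a b)%:E.
  by exists (\val v) => //; apply/MspP; exists v.
by rewrite (energyE a b (w + v)) lee_fin.
Qed.

End translation.

Theorem theorem3p3 (R : realType) (s : R) (N : nat) (Omega : set 'rV[R]_N)
    (lam : nat -> R) (k : nat)
    (hs : 0 < s < 1) (hN : 2 * s < N%:R)
    (hOmega : bounded_lipschitz_domain Omega)
    (hlam : distinct_eigenvalues s Omega lam)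
    (hk : (2 <= k)%N) :
  let nu := nu_curve s Omega lam k in
  let mu := mu_curve s Omega lam k in
  let J := Jint lam k in
  [/\ [/\ curve_continuous lam k nu,
          curve_decreasing lam k nu,
          nu (lam k) = (lam k)%:E,
          forall a b, J a -> J b -> b%:E = nu a -> Fucik s Omega (a, b) &
          forall a b, J a -> J b -> (b%:E < nu a)%E -> ~ Fucik s Omega (a, b)],
      [/\ curve_continuous lam k mu,
          curve_decreasing lam k mu,
          mu (lam k) = (lam k)%:E,
          forall a b, J a -> J b -> b%:E = mu a -> Fucik s Omega (a, b) &
          forall a b, J a -> J b -> (mu a < b%:E)%E -> ~ Fucik s Omega (a, b)] &
      forall a, J a -> (nu a <= mu a)%E].
Proof.
have /andP[s0 _] := hs; case: hOmega => oO _ _ bO _.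
have lf := Xspace_forms s0 oO bO.
case: hlam => lam1 lam_lt lamE.
have lamP la : (exists2 u, beX u u != 0 & @Eig R _ (@ipX R s N Omega) (@beX R s N Omega) la u) <->
    exists2 j, (0 < j)%N & la = lam j.
  by split=> [/(is_eigenvalueE oO)/lamE|/lamE/(is_eigenvalueE oO)].
move=> nu mu J.
pose Pn := @minimax_nonneg R _ ipX beX (@posX R s N Omega) 1
  (@Nn R _ ipX beX lam k.-1) (@Mm R _ ipX beX lam k.-1).
pose Pm := @minimax_nonneg R _ ipX beX (@posX R s N Omega) (-1)
  (@Mm R _ ipX beX lam k) (@Nn R _ ipX beX lam k).
have nuE : nu = sup_curve J Pn.
  apply/funext => a; congr (ereal_sup (_ @` (_ `&` _))); apply/funext => b.
  by apply/propext; exact: n_funcE.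
have muE : mu = inf_curve J Pm.
  apply/funext => a; congr (ereal_inf (_ @` (_ `&` _))); apply/funext => b.
  by apply/propext; exact: m_funcE.
have rn := region_low lf lam1 lam_lt lamP hk.
have rm := region_high lf lam1 lam_lt lamP hk.
have sol := solution_lam lf lamP hk.
have k0 : (0 < k)%N by exact: leq_trans hk.
have Jk : J (lam k).
  apply/andP; split; apply: lam_lt; last by rewrite k0 /=.
  by case: (k) hk => [|[]]//= j _; rewrite ltnSn.
have FE a b := FucikE s0 oO bO a b.
split; first split.
- by move=> a Ja; rewrite nuE => fin; exact: (sup_curve_continuous rn).
- move=> a1 a2 J1 J2 a12; rewrite nuE => -[] [_ [b Jb bE]];
    apply: (sup_curve_decreasing rn J1 J2 Jb a12); [left|right]; exact: bE.
- rewrite nuE; apply: (sup_curve_diag rn) => //.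
  exact: (minimax_low_lam lf lam1 lam_lt lamP).
- move=> a b Ja Jb; rewrite nuE => /esym bE; apply/FE.
  by have [Pab nS] := sup_curve_in rn Ja Jb bE; exact: (mr_boundary rn).
- move=> a b Ja Jb; rewrite nuE => /(sup_curve_lt rn Ja Jb) Sab /FE h.
  exact: (mr_interior rn Ja Jb h).
- split.
  + by move=> a Ja; rewrite muE => fin; exact: (inf_curve_continuous rm).
  + move=> a1 a2 J1 J2 a12; rewrite muE => -[] [_ [b Jb bE]];
      apply: (inf_curve_decreasing rm J1 J2 Jb a12); [left|right]; exact: bE.
  + rewrite muE; apply: (inf_curve_diag rm) => //.
    exact: (minimax_high_lam lf lam_lt).
  + move=> a b Ja Jb; rewrite muE => /esym bE; apply/FE.
    by have [Pab nS] := inf_curve_in rm Ja Jb bE; exact: (mr_boundary rm).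
  + move=> a b Ja Jb; rewrite muE => /(inf_curve_gt rm Ja Jb) Sab /FE h.
    exact: (mr_interior rm Ja Jb h).
(* It suffices to compare nu a with each b of the set whose infimum is mu a; a larger nu a would put
   (a, b) in S. *)
move=> a Ja; rewrite nuE muE; apply: le_ereal_inf_tmp => _ [b [Jb Pab] <-].
rewrite leNgt; apply/negP => /(sup_curve_lt rn Ja Jb) Sab.
exact: (minimax_low_high lf lam1 lam_lt lamP hk Ja Jb Sab Pab).
Qed.
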